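(* Let $F:\mathsf{G}_2'\to\mathrm{Diff}(\mathrm{Ein}^{2,3})$ be the map $F(\psi)=\psi|_{\mathrm{Ein}^{2,3}}$. Then $F$ is injective, and for $\varphi\in\mathrm{Diff}(\mathrm{Ein}^{2,3})$ the condition $\varphi\in\mathrm{image}(F)$ is equivalent to each of the following conditions: (1) $\varphi$ preserves annihilators infinitesimally: $\varphi^*\mathscr{D}=\mathscr{D}$; (2) $\varphi$ preserves annihilator submanifolds: $\varphi(\mathbb{P}\mathrm{Ann}(x))=\mathbb{P}\mathrm{Ann}(\varphi(x))$ for all $x\in\mathrm{Ein}^{2,3}$; (3) $\varphi\in\mathrm{Isom}(d_3)$: $d_3(\varphi(x),\varphi(y))=d_3(x,y)$ for all $x,y\in\mathrm{Ein}^{2,3}$; (4) $\varphi$ preserves annihilator lines: $\varphi(\mathscr{L}_{x,y})=\mathscr{L}_{\varphi(x),\varphi(y)}$ for all $x,y\in\mathrm{Ein}^{2,3}$ with $d_3(x,y)=1$.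
   Context: Split octonions: $\mathbb{O}'=\mathbb{H}\oplus\mathbb{H}$ with product $(a,b)\odot(c,d)=(ac+db^*,\,a^*d+cb)$ ($*$ = quaternionic conjugation) and bilinear form $(a,b)\cdot(c,d)=\langle a,c\rangle_{\mathbb{H}}-\langle b,d\rangle_{\mathbb{H}}$; $\mathrm{Im}\,\mathbb{O}'=1^\perp$ (signature $(3,4)$); for $x,y\in\mathrm{Im}\,\mathbb{O}'$, $x\times y$ is the component of $x\odot y$ in $\mathrm{Im}\,\mathbb{O}'$. $\mathsf{G}_2'=\mathrm{Aut}_{\mathbb{R}\text{-alg}}(\mathbb{O}')$, which acts linearly on $\mathrm{Im}\,\mathbb{O}'$ preserving $\cdot$ and $\times$. $\mathrm{Ein}^{2,3}=\{[x]\in\mathbb{P}(\mathrm{Im}\,\mathbb{O}'): x\cdot x=0\}$; $\psi|_{\mathrm{Ein}^{2,3}}$ denotes the diffeomorphism induced by $\psi$. $\mathrm{Ann}([u])=\mathrm{Ann}(u)=\{v\in\mathrm{Im}\,\mathbb{O}':u\times v=0\}$; for $[u]\in\mathrm{Ein}^{2,3}$ it is a 3-dimensional totally isotropic subspace, so $\mathbb{P}\mathrm{Ann}([u])\subset\mathrm{Ein}^{2,3}$. $\mathscr{D}$ is the rank 2 (in fact $(2,3,5)$) distribution on $\mathrm{Ein}^{2,3}$ given, under $T_{[u]}\mathrm{Ein}^{2,3}\cong\mathrm{Hom}_{\mathbb{R}}([u],u^\perp/[u])$, by $\mathscr{D}_{[u]}=\{X:X([u])\subset\mathrm{Ann}(u)/[u]\}$;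 $\varphi^*\mathscr{D}=\mathscr{D}$ means $d\varphi(\mathscr{D}_x)=\mathscr{D}_{\varphi(x)}$ for all $x$. $d_3:\mathrm{Ein}^{2,3}\times\mathrm{Ein}^{2,3}\to\{0,1,2,3\}$ is given by $d_3([u],[v])=0$ if $[u]=[v]$; $=1$ if $[u]\neq[v]$ and $u\times v=0$; $=2$ if $u\cdot v=0$ and $u\times v\ne0$; $=3$ if $u\cdot v\neq0$. For $x,y\in\mathrm{Ein}^{2,3}$ with $d_3(x,y)=1$, $\mathscr{L}_{x,y}=\mathbb{P}(\mathrm{span}_{\mathbb{R}}\langle x,y\rangle)\subset\mathrm{Ein}^{2,3}$. The symbol $\mathscr{L}_{x,y}$ is only defined when $d_3(x,y)=1$, so condition (4) includes that $d_3(\varphi(x),\varphi(y))=1$ whenever $d_3(x,y)=1$. *)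

(* Defs.v *)
(* The real numbers are an arbitrary R : realType. *)
From HB Require Import structures.
From mathcomp Require Import all_boot all_order all_algebra.
From mathcomp Require Import all_classical all_reals all_analysis.
From mathcomp Require Import ring.
Set Implicit Arguments.
Unset Strict Implicit.
Unset Printing Implicit Defensive.
Import Order.TTheory GRing.Theory Num.Theory numFieldNormedType.Exports.
Local Open Scope classical_set_scope.
Local Open Scope ring_scope.

Definition Quat (R : realType) := 'rV[R]_4.

(* [quat a b c d] is a + b i + c j + d k *)
Definition quat (R : realType) (a b c d : R) : Quat R :=
  \row_(i < 4) nth 0 [:: a; b; c; d] i.

Definition qone (R : realType) : Quat R := quat 1 0 0 0.

Definition qmul (R : realType) (x y : Quat R) : Quat R :=
  quat (x 0 0 * y 0 0 - x 0 1 * y 0 1 - x 0 2 * y 0 2 - x 0 3 * y 0 3)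
       (x 0 0 * y 0 1 + x 0 1 * y 0 0 + x 0 2 * y 0 3 - x 0 3 * y 0 2)
       (x 0 0 * y 0 2 - x 0 1 * y 0 3 + x 0 2 * y 0 0 + x 0 3 * y 0 1)
       (x 0 0 * y 0 3 + x 0 1 * y 0 2 - x 0 2 * y 0 1 + x 0 3 * y 0 0).

Definition qconj (R : realType) (x : Quat R) : Quat R :=
  quat (x 0 0) (- x 0 1) (- x 0 2) (- x 0 3).

Definition qdot (R : realType) (x y : Quat R) : R := \sum_(i < 4) x 0 i * y 0 i.

Definition Oct (R : realType) := (Quat R * Quat R)%type.

Definition omul (R : realType) (x y : Oct R) : Oct R :=
  (qmul x.1 y.1 + qmul y.2 (qconj x.2), qmul (qconj x.1) y.2 + qmul y.1 x.2).

Definition oone (R : realType) : Oct R := (qone R, 0).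

Definition odot (R : realType) (x y : Oct R) : R := qdot x.1 y.1 - qdot x.2 y.2.

Definition ImO (R : realType) : set (Oct R) := [set x | odot x (oone R) = 0].

(* orthogonal projection onto Im O' along the line R 1, using 1 . 1 = 1 *)
Definition im_part (R : realType) (z : Oct R) : Oct R :=
  z - odot z (oone R) *: oone R.

Definition cross (R : realType) (x y : Oct R) : Oct R := im_part (omul x y).

Record G2' (R : realType) := MkG2' {
  g2fun :> 'End(Oct R);
  g2_bij : bijective g2fun;
  g2_mul : forall x y, g2fun (omul x y) = omul (g2fun x) (g2fun y) }.

Definition is_ein (R : realType) (L : {vspace Oct R}) : bool :=
  (\dim L == 1%N) && `[< forall u, u \in L -> ImO u /\ odot u u = 0 >].

Definition Ein (R : realType) := {L : {vspace Oct R} | is_ein L}.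

Definition line (R : realType) (x : Ein R) : {vspace Oct R} := val x.

(* a nonzero vector spanning the line x *)
Definition rep (R : realType) (x : Ein R) : Oct R := vpick (line x).

Definition Ann (R : realType) (u : Oct R) : set (Oct R) :=
  [set v | ImO v /\ cross u v = 0].

Definition PAnn (R : realType) (x : Ein R) : set (Ein R) :=
  [set y | forall v, v \in line y -> Ann (rep x) v].

Definition d3 (R : realType) (x y : Ein R) : nat :=
  if x == y then 0%N
  else if cross (rep x) (rep y) == 0 then 1%N
  else if odot (rep x) (rep y) == 0 then 2%N
  else 3%N.

(* P(span(x, y)); only used when d3 x y = 1, in which case the span is totally
   isotropic and every line in it is a point of Ein *)
Definition ann_line (R : realType) (x y : Ein R) : set (Ein R) :=
  [set z | (line z <= line x + line y)%VS].

(* C^n on an open set U of a finite-dimensional space: all iterated directional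
   derivatives up to order n exist and are continuous on U *)
Fixpoint Ck_on (R : realType) (V W : normedModType R) (n : nat) (U : set V)
    (f : V -> W) : Prop :=
  if n is n'.+1 then
    (forall x v, U x -> derivable f x v) /\ (forall v, Ck_on n' U ('D_v f))
  else forall x, U x -> {for x, continuous f}.

Definition Cinf_on (R : realType) (V W : normedModType R) (U : set V)
    (f : V -> W) : Prop :=
  forall n, Ck_on n U f.

(* f expresses phi in homogeneous coordinates on U: it is smooth on the open set
   U of the ambient space and sends every nonzero isotropic vector w of Im O' in U
   to a nonzero vector of the line phi([w]) *)
Definition local_lift (R : realType) (phi : Ein R -> Ein R) (U : set (Oct R))
    (f : Oct R -> Oct R) : Prop :=
  [/\ open U, Cinf_on U f &
      forall (y : Ein R) (w : Oct R),
        U w -> w \in line y -> w != 0 -> f w \in line (phi y) /\ f w != 0].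

(* Ein carries the smooth structure of an embedded submanifold of projective
   space: a map is smooth iff around every point it is given, in homogeneous
   coordinates, by a map that extends smoothly to an open set of vectors *)
Definition smooth_map (R : realType) (phi : Ein R -> Ein R) : Prop :=
  forall (x : Ein R) (u : Oct R), u \in line x -> u != 0 ->
    exists U f, U u /\ local_lift phi U f.

Definition is_diffeo (R : realType) (phi : Ein R -> Ein R) : Prop :=
  smooth_map phi /\
  exists psi : Ein R -> Ein R, [/\ cancel phi psi, cancel psi phi & smooth_map psi].

Record Diff (R : realType) := MkDiff {
  diff_fun :> Ein R -> Ein R;
  diff_funP : is_diffeo diff_fun }.

(* x^perp / x consists of the cosets w + x with w in x^perp, where x^perp is the
   orthogonal complement in Im O' *)
Definition perp (R : realType) (x : Ein R) : set (Oct R) :=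
  [set w | ImO w /\ forall u, u \in line x -> odot u w = 0].

Definition coset (R : realType) (x : Ein R) (w : Oct R) : set (Oct R) :=
  [set w' | w' - w \in line x].

(* T_x Ein = Hom(x, x^perp / x): coset-valued maps on the line x that are linear
   for the quotient operations.  The velocity at time 0 of a curve t |-> [c t],
   with c isotropic, is the X such that X (c 0) is the coset of c'(0) *)
Definition tangent (R : realType) (x : Ein R) :
    set (subvs_of (line x) -> set (Oct R)) :=
  [set X | (forall s, exists2 w, perp x w & X s = coset x w) /\
           forall (a : R) s t w w', X s w -> X t w' ->
             X (a *: s + t) (a *: w + w')].

(* every coset X(s) lies in Ann(x), i.e. X(x) is contained in Ann(x) / x *)
Definition distr (R : realType) (x : Ein R) :
    set (subvs_of (line x) -> set (Oct R)) :=
  [set X | tangent X /\ forall s, X s `<=` Ann (rep x)].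

(* The differential of phi at x under the identification above.  If f is a local
   lift of phi near a nonzero s in x and w represents X(s), then dphi(X) is the
   linear map on the line phi(x) that sends f s to the coset of df_s(w).  For
   smooth phi this does not depend on the choice of f, s and w, because w is
   tangent to the isotropic cone at s. *)
Definition dmap (R : realType) (phi : Ein R -> Ein R) (x : Ein R)
    (X : subvs_of (line x) -> set (Oct R)) :
    subvs_of (line (phi x)) -> set (Oct R) :=
  fun t => [set z | exists U f (s : subvs_of (line x)) (w : Oct R) (c : R),
    [/\ local_lift phi U f, U (vsval s), s != 0, X s w &
        vsval t = c *: f (vsval s) /\ coset (phi x) (c *: 'D_w f (vsval s)) z]].

Definition preserves_distr (R : realType) (phi : Ein R -> Ein R) : Prop :=
  forall x, @dmap R phi x @` @distr R x = @distr R (phi x).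

Definition preserves_PAnn (R : realType) (phi : Ein R -> Ein R) : Prop :=
  forall x, phi @` PAnn x = PAnn (phi x).

Definition d3_isometry (R : realType) (phi : Ein R -> Ein R) : Prop :=
  forall x y, d3 (phi x) (phi y) = d3 x y.

Definition preserves_ann_lines (R : realType) (phi : Ein R -> Ein R) : Prop :=
  forall x y, d3 x y = 1%N ->
    d3 (phi x) (phi y) = 1%N /\ phi @` ann_line x y = ann_line (phi x) (phi y).

Lemma quatP (R : realType) (x y : Quat R) :
  x 0 0 = y 0 0 -> x 0 1 = y 0 1 -> x 0 2 = y 0 2 -> x 0 3 = y 0 3 -> x = y.
Proof.
move=> e0 e1 e2 e3; apply/rowP => -[[|[|[|[|//]]]] i4].
- by rewrite (_ : Ordinal i4 = 0) //; apply: val_inj.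
- by rewrite (_ : Ordinal i4 = 1) //; apply: val_inj.
- by rewrite (_ : Ordinal i4 = 2) //; apply: val_inj.
- by rewrite (_ : Ordinal i4 = 3) //; apply: val_inj.
Qed.

Lemma quatE (R : realType) (a b c d : R) :
  (quat a b c d 0 0 = a) * (quat a b c d 0 1 = b) *
  (quat a b c d 0 2 = c) * (quat a b c d 0 3 = d).
Proof. by rewrite !mxE. Qed.

Lemma qdotE (R : realType) (x y : Quat R) :
  qdot x y = x 0 0 * y 0 0 + x 0 1 * y 0 1 + x 0 2 * y 0 2 + x 0 3 * y 0 3.
Proof.
rewrite /qdot !big_ord_recl big_ord0 addr0 !addrA.
by do !congr (_ + _); congr (_ * _); congr (_ _ _); apply: val_inj.
Qed.

Lemma odot_one (R : realType) (x : Oct R) : odot x (oone R) = x.1 0 0.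
Proof. by rewrite /odot !qdotE /= !quatE !mxE; ring. Qed.

Lemma omul1 (R : realType) (x : Oct R) : omul x (oone R) = x.
Proof.
case: x => a b; rewrite /omul /=; congr pair; apply: quatP;
  by rewrite /qmul /qconj /qone !(quatE, mxE); ring.
Qed.

Lemma omul1l (R : realType) (x : Oct R) : omul (oone R) x = x.
Proof.
case: x => a b; rewrite /omul /=; congr pair; apply: quatP;
  by rewrite /qmul /qconj /qone !(quatE, mxE); ring.
Qed.

Lemma omul_sqr (R : realType) (x : Oct R) :
  omul x x = (2 * odot x (oone R)) *: x - odot x x *: oone R.
Proof.
rewrite odot_one; case: x => a b; rewrite /odot !qdotE /omul /=.
congr pair; apply: quatP;
  by rewrite /qmul /qconj /qone !(quatE, mxE) /=; ring.
Qed.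

Lemma odotZZ (R : realType) (c d : R) (x y : Oct R) :
  odot (c *: x) (d *: y) = c * d * odot x y.
Proof. by rewrite /odot !qdotE /= !mxE; ring. Qed.

Lemma crossZZ (R : realType) (c d : R) (x y : Oct R) :
  cross (c *: x) (d *: y) = (c * d) *: cross x y.
Proof.
case: x y => [x1 x2] [y1 y2]; rewrite /cross /im_part !odot_one /omul /=.
congr pair; apply: quatP;
  by rewrite /qmul /qconj /qone !(quatE, mxE) /=; ring.
Qed.

Lemma rep_line (R : realType) (x : Ein R) : line x = <[rep x]>%VS /\ rep x != 0.
Proof.
have /andP[/eqP dx _] := valP x.
have x0 : rep x != 0 by rewrite vpick0 -dimv_eq0 dx.
split=> //; apply/esym/eqP; rewrite eqEdim -memvE memv_pick /= dx.
by rewrite dim_vline x0.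
Qed.

Lemma lineP (R : realType) (x : Ein R) (u : Oct R) : u \in line x -> u != 0 ->
  exists2 c : R, c != 0 & u = c *: rep x.
Proof.
have [-> _] := rep_line x => /vlineP[c ->] c0; exists c => //.
by apply: contraNneq c0 => ->; rewrite scale0r.
Qed.

(* Ann and d_3 do not depend on the chosen representatives *)
Lemma Ann_rep (R : realType) (x : Ein R) (u : Oct R) :
  u \in line x -> u != 0 -> Ann u = Ann (rep x).
Proof.
move=> /lineP h /h[c c0 ->].
have E v : cross (c *: rep x) v = c *: cross (rep x) v.
  by rewrite -[v in LHS]scale1r crossZZ mulr1.
apply/seteqP; split=> v [iv] /= e; split=> //; last by rewrite E e scaler0.
by move/eqP: e; rewrite E scaler_eq0 (negbTE c0) => /eqP.
Qed.

Lemma d3_rep (R : realType) (x y : Ein R) (u v : Oct R) :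
  u \in line x -> u != 0 -> v \in line y -> v != 0 ->
  d3 x y = if x == y then 0%N else if cross u v == 0 then 1%N
           else if odot u v == 0 then 2%N else 3%N.
Proof.
move=> /lineP h /h[c c0 ->] /lineP k /k[d d0 ->].
by rewrite crossZZ odotZZ scaler_eq0 !mulf_eq0 (negbTE c0) (negbTE d0).
Qed.

Section G2Action.
Variables (R : realType) (psi : G2' R).

Lemma g2_inj : injective psi.
Proof. exact: bij_inj (g2_bij psi). Qed.

Lemma g2_one : psi (oone R) = oone R.
Proof.
have [h _ hK] := g2_bij psi.
by rewrite -[LHS]omul1 -{2}(hK (oone R)) -g2_mul omul1l hK.
Qed.

Lemma oone_neq0 : oone R != 0.
Proof.
apply/eqP => /(congr1 (fun x : Oct R => x.1 0 0)) /=.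
by rewrite !mxE /=; apply/eqP/oner_neq0.
Qed.

Lemma odot_oone : odot (oone R) (oone R) = 1.
Proof. by rewrite odot_one /= quatE. Qed.

Lemma odotZl (c : R) (x y : Oct R) : odot (c *: x) y = c * odot x y.
Proof. by rewrite /odot !qdotE /= !mxE; ring. Qed.

Lemma g2_quadratic (x : Oct R) : ImO x ->
  odot (psi x) (oone R) = 0 /\ odot (psi x) (psi x) = odot x x.
Proof.
move=> x1; have := congr1 psi (omul_sqr x).
rewrite g2_mul omul_sqr x1 mulr0 scale0r sub0r linearN /=.
rewrite [psi (odot x x *: oone R)]linearZ /= g2_one.
set r := odot (psi x) (oone R) => e.
have r0 : r = 0.
  apply/eqP; apply/negP => /negP rN0.
  have r2 : 2 * r != 0 by rewrite mulf_neq0// pnatr_eq0.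
  pose c := (2 * r)^-1 * (odot (psi x) (psi x) - odot x x).
  have psix : psi x = c *: oone R.
    rewrite -[LHS]scale1r -(mulVf r2) -scalerA.
    rewrite -[_ *: psi x](subrK (odot (psi x) (psi x) *: oone R)) e.
    by rewrite -scaleNr -scalerDl scalerA addrC /c.
  have xc : x = c *: oone R by apply: g2_inj; rewrite linearZ /= g2_one.
  move: x1; rewrite /ImO /= xc odotZl odot_oone mulr1 => c0.
  by move: rN0; rewrite /r psix c0 scale0r odot_one mxE eqxx.
split=> //; move: e; rewrite r0 mulr0 scale0r sub0r => /oppr_inj/eqP.
rewrite -subr_eq0 -scalerBl scaler_eq0 (negbTE oone_neq0) orbF subr_eq0.
by move/eqP.
Qed.

Lemma g2_ker : lker psi == 0%VS.
Proof. by apply/lker0P; exact: g2_inj. Qed.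

Lemma g2_is_ein (x : Ein R) : is_ein (psi @: line x)%VS.
Proof.
have /andP[dx /asboolP ex] := valP x.
apply/andP; split.
  by rewrite limg_dim_eq // (eqP g2_ker) capv0.
apply/asboolP => _ /memv_imgP[u ux ->].
by have [iu uu] := ex u ux; have [p0 pp] := g2_quadratic iu;
  split; rewrite ?pp.
Qed.

Definition g2_act (x : Ein R) : Ein R :=
  exist (fun L : {vspace Oct R} => is_ein L) (psi @: line x)%VS (g2_is_ein x).

Lemma g2_inv_bij : bijective (psi^-1)%VF.
Proof.
by exists psi; [exact: lker0_lfunVK g2_ker | exact: lker0_lfunK g2_ker].
Qed.

Lemma g2_inv_mul (x y : Oct R) :
  (psi^-1)%VF (omul x y) = omul ((psi^-1)%VF x) ((psi^-1)%VF y).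
Proof. by apply: g2_inj; rewrite g2_mul !(lker0_lfunVK g2_ker). Qed.

Definition g2_inv : G2' R := MkG2' g2_inv_bij g2_inv_mul.

End G2Action.

Lemma lfun_continuous (R : realType) (A : 'End(Oct R)) : continuous A.
Proof.
pose e i : Quat R := delta_mx 0 i.
have AE : (A : Oct R -> Oct R) = fun x =>
    \sum_(i < 4) x.1 0 i *: A (e i, 0) + \sum_(i < 4) x.2 0 i *: A (0, e i).
  apply/funext => -[a b] /=.
  have -> : (a, b) = \sum_(i < 4) a 0 i *: (e i, 0) +
                     \sum_(i < 4) b 0 i *: (0, e i) :> Oct R.
    rewrite [LHS](_ : _ = (a, 0) + (0, b)); last first.
      by congr pair; rewrite ?addr0 ?add0r.
    rewrite {1}[a]row_sum_delta {1}[b]row_sum_delta; congr (_ + _).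
      by elim/big_rec2: _ => // i u v _ <-; congr pair; rewrite /= scaler0 addr0.
    by elim/big_rec2: _ => // i u v _ <-; congr pair; rewrite /= scaler0 addr0.
  rewrite linearD !linear_sum /=.
  by congr (_ + _); apply: eq_bigr => i _; rewrite linearZ.
have sumc (g : Oct R -> Quat R) (B : 'I_4 -> Oct R) : continuous g ->
    continuous (fun x => \sum_(i < 4) g x 0 i *: B i).
  move=> gc.
  apply: (@continuous_big (Oct R) 'I_4 +%R 0 xpredT _ (Oct R) _
           (fun i x => g x 0 i *: B i)) => [|i _ x]; first exact: add_continuous.
  suff gi : (g y 0 i) @[y --> x] --> g x 0 i by exact: cvgZr_tmp gi.
  exact: (continuous_comp (gc x) (@coord_continuous R 1 4 0 i (g x))).
rewrite AE => x; apply: cvgD; apply: sumc => y; [exact: cvg_fst|exact: cvg_snd].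
Qed.

Lemma lfun_Cinf (R : realType) (A : 'End(Oct R)) : Cinf_on setT A.
Proof.
case=> [|n] /=; first by move=> x _; exact: lfun_continuous.
have dA x : differentiable A x.
  by apply: linear_differentiable; exact: lfun_continuous.
split=> [x v _|v]; first exact: diff_derivable.
have -> : 'D_v A = cst (A v).
  by apply/funext => x; rewrite deriveE // diff_lin //; exact: lfun_continuous.
elim: n (A v) => [|n IHn] w /=; first by move=> x _; exact: cst_continuous.
split=> [x u _|u]; first exact: derivable_cst.
by rewrite (_ : 'D_u _ = cst 0) //; apply/funext => x; rewrite derive_cst.
Qed.

Lemma g2_act_smooth (R : realType) (psi : G2' R) : smooth_map (g2_act psi).
Proof.
move=> x u ux u0; exists setT, psi; split=> //; split.
- exact: openT.
- exact: lfun_Cinf.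
- move=> y w _ wy w0; split; first exact: memv_img.
  by apply: contra_neq w0 => pw; apply: (@g2_inj _ psi); rewrite pw linear0.
Qed.

Lemma g2_act_diffeo (R : realType) (psi : G2' R) : is_diffeo (g2_act psi).
Proof.
split; first exact: g2_act_smooth.
exists (g2_act (g2_inv psi)); split; last exact: g2_act_smooth.
- move=> x; apply: val_inj; rewrite /= /line /= -limg_comp.
  by rewrite lker0_compVf ?g2_ker // lim1g.
- move=> x; apply: val_inj; rewrite /= /line /= -limg_comp.
  by rewrite lker0_compfV ?g2_ker // lim1g.
Qed.

Definition F (R : realType) (psi : G2' R) : Diff R := MkDiff (g2_act_diffeo psi).

(* Main.v *)
Require Import Defs.
From HB Require Import structures.
From mathcomp Require Import all_boot all_order all_algebra.
From mathcomp Require Import all_classical all_reals all_analysis.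
From mathcomp Require Import ring lra.
Set Implicit Arguments.
Unset Strict Implicit.
Unset Printing Implicit Defensive.
Import Order.TTheory GRing.Theory Num.Theory numFieldNormedType.Exports.
Local Open Scope classical_set_scope.
Local Open Scope ring_scope.

(** The conditions on annihilator submanifolds, on d3 and on annihilator lines are
compared with each other and with the group through incidence geometry; the condition
on the distribution enters through the 2-jet of a lift.

Algebra.  Split octonions are determined by their imaginary cross product, and
the double cross product identity cross_cross forces the whole multiplication table
once three pairwise orthogonal null vectors E1, E2, E3 with (E1 x E2) . E3 = 1/2
are given.  Hence G2' acts transitively on such triples (g2_triple); in
particular it is transitive on points and on pairs of a point p and a direction w
in Ann(p) off p (null_trans, flag_trans).  This reduces every statement about
annihilators to a computation at a base point: Ann(p) is a totally isotropic
3-space, three mutually annihilating points lie on a line (collinear_triangle), and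
two orthogonal points u, v that do not annihilate each other have exactly one common
neighbor, [u x v].

Isometries.  Since d3 <= 2 means having a common neighbor, d3 is determined by the
relation d3 <= 1.  So preserving annihilator submanifolds, annihilator lines or d3 is
the same for a bijection (PAnn_iso, lines_iso, iso_PAnn, iso_lines); more precisely
an injective map preserving the distances 1 and 2 preserves d3 (iso_of_12).

Isometries come from G2' (iso_g2).  After composing with an element of G2', an
isometry fixes the points of a frame e1, e2, e3 and the point of (1,1,1).  The planes
spanned by e1, e2, e3 and by their cross products f1, f2, f3 are dual under
orthogonality, so on affine coordinates the isometry acts by a map s with
s(mx + b) = s(m)s(x) + s(b); a ring endomorphism of the real numbers is the identity,
and all points of both planes are fixed (plane_fixed).  Any other point is moved by
the subgroup of G2' preserving both planes to one of two special points.  Each special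
point is determined by the fixed points up to a ratio whose cube is 1, hence is fixed
(fixed_special_points).

Preserving the distribution.  Let f be a local lift of a diffeomorphism preserving
the distribution.  Then df maps Ann(p) into Ann(f p), and it maps independent
directions modulo p to independent directions (distr_tangential).  Differentiating
these two facts along curves of pairs (p, w) with p x w = 0 gives relations
between the second derivatives of f.  They imply that the derivative of f in the
direction e3 is orthogonal to f(e1) and to the derivative in the direction f2, but not
to the derivative in the direction f3 (jet_algebra).  Differentiating the orthogonality
once more along the annihilator line e1 + t f2 shows that the second derivative of f
along the line is a combination of f and of its first derivative (jet_line).  Hence
the ratios of the Pluecker coordinates of (f, f') are constant, the image of the line
stays in a line, first locally and then globally by connectedness (line_image), and the
map preserves the distances 1 and 2 (tangential_iso).

Conversely, any lift f of the map induced by psi is proportional to psi on null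
vectors, so its derivatives agree with those of psi up to a factor and modulo the line
of psi (g2_lift_derive); the differential is therefore the transport of coset-valued
maps by psi, which preserves the distribution.

Injectivity.  If psi1 and psi2 induce the same map, then psi1 = k(u) psi2 on each null
vector u.  Comparing scalars on e1, e2, e3, on their sum and on e1 + f2 forces k = 1
(F_inj). *)

(** * Products and coordinates on the imaginary split octonions *)

Section Coordinates.
Variable R : realType.
Implicit Types x y z u v w : Oct R.

Lemma octP x y :
  x.1 0 0 = y.1 0 0 -> x.1 0 1 = y.1 0 1 -> x.1 0 2 = y.1 0 2 ->
  x.1 0 3 = y.1 0 3 -> x.2 0 0 = y.2 0 0 -> x.2 0 1 = y.2 0 1 ->
  x.2 0 2 = y.2 0 2 -> x.2 0 3 = y.2 0 3 -> x = y.
Proof. by case: x y => [? ?] [? ?] /= *; congr pair; apply: quatP. Qed.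

(** Proves an identity between combinations of vectors once, for an abstract linear
form, instead of once per coordinate. *)
Lemma linear_ext x y : (forall L : Oct R -> R, (forall u v, L (u + v) = L u + L v) ->
  (forall k u, L (k *: u) = k * L u) -> (forall u, L (- u) = - L u) -> L 0 = 0 -> L x = L y) ->
  x = y.
Proof.
move=> h; apply: octP;
  [apply: (h (fun z => z.1 0 0))|apply: (h (fun z => z.1 0 1))
  |apply: (h (fun z => z.1 0 2))|apply: (h (fun z => z.1 0 3))
  |apply: (h (fun z => z.2 0 0))|apply: (h (fun z => z.2 0 1))
  |apply: (h (fun z => z.2 0 2))|apply: (h (fun z => z.2 0 3))] => *;
  by rewrite /= mxE.
Qed.

Lemma ImOE x : ImO x <-> x.1 0 0 = 0.
Proof. by rewrite /ImO /= odot_one. Qed.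

Lemma crossE x y : cross x y =
  (quat 0
    (x.1 0 0 * y.1 0 1 + x.1 0 1 * y.1 0 0 + x.1 0 2 * y.1 0 3 - x.1 0 3 * y.1 0 2
     - y.2 0 0 * x.2 0 1 + y.2 0 1 * x.2 0 0 - y.2 0 2 * x.2 0 3 + y.2 0 3 * x.2 0 2)
    (x.1 0 0 * y.1 0 2 - x.1 0 1 * y.1 0 3 + x.1 0 2 * y.1 0 0 + x.1 0 3 * y.1 0 1
     - y.2 0 0 * x.2 0 2 + y.2 0 1 * x.2 0 3 + y.2 0 2 * x.2 0 0 - y.2 0 3 * x.2 0 1)
    (x.1 0 0 * y.1 0 3 + x.1 0 1 * y.1 0 2 - x.1 0 2 * y.1 0 1 + x.1 0 3 * y.1 0 0
     - y.2 0 0 * x.2 0 3 - y.2 0 1 * x.2 0 2 + y.2 0 2 * x.2 0 1 + y.2 0 3 * x.2 0 0),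
   quat
    (x.1 0 0 * y.2 0 0 + x.1 0 1 * y.2 0 1 + x.1 0 2 * y.2 0 2 + x.1 0 3 * y.2 0 3
     + y.1 0 0 * x.2 0 0 - y.1 0 1 * x.2 0 1 - y.1 0 2 * x.2 0 2 - y.1 0 3 * x.2 0 3)
    (x.1 0 0 * y.2 0 1 - x.1 0 1 * y.2 0 0 - x.1 0 2 * y.2 0 3 + x.1 0 3 * y.2 0 2
     + y.1 0 0 * x.2 0 1 + y.1 0 1 * x.2 0 0 + y.1 0 2 * x.2 0 3 - y.1 0 3 * x.2 0 2)
    (x.1 0 0 * y.2 0 2 + x.1 0 1 * y.2 0 3 - x.1 0 2 * y.2 0 0 - x.1 0 3 * y.2 0 1
     + y.1 0 0 * x.2 0 2 - y.1 0 1 * x.2 0 3 + y.1 0 2 * x.2 0 0 + y.1 0 3 * x.2 0 1)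
    (x.1 0 0 * y.2 0 3 - x.1 0 1 * y.2 0 2 + x.1 0 2 * y.2 0 1 - x.1 0 3 * y.2 0 0
     + y.1 0 0 * x.2 0 3 + y.1 0 1 * x.2 0 2 - y.1 0 2 * x.2 0 1 + y.1 0 3 * x.2 0 0)).
Proof.
rewrite /cross /im_part !odot_one /omul /=.
by congr pair; apply: quatP; rewrite /qmul /qconj /qone !(quatE, mxE) /=; ring.
Qed.

Lemma odotE x y : odot x y =
  x.1 0 0 * y.1 0 0 + x.1 0 1 * y.1 0 1 + x.1 0 2 * y.1 0 2 + x.1 0 3 * y.1 0 3
  - x.2 0 0 * y.2 0 0 - x.2 0 1 * y.2 0 1 - x.2 0 2 * y.2 0 2 - x.2 0 3 * y.2 0 3.
Proof. by rewrite /odot !qdotE; ring. Qed.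

Lemma ImO_cross x y : ImO (cross x y).
Proof. by apply/ImOE; rewrite crossE /= quatE. Qed.

Lemma ImOD x y : ImO x -> ImO y -> ImO (x + y).
Proof. by move=> /ImOE hx /ImOE hy; apply/ImOE; rewrite /= mxE hx hy addr0. Qed.

Lemma ImOZ (k : R) x : ImO x -> ImO (k *: x).
Proof. by move=> /ImOE hx; apply/ImOE; rewrite /= mxE hx mulr0. Qed.

Lemma ImON x : ImO x -> ImO (- x).
Proof. by rewrite -scaleN1r; exact: ImOZ. Qed.

Lemma ImOB x y : ImO x -> ImO y -> ImO (x - y).
Proof. by move=> hx hy; apply: ImOD => //; exact: ImON. Qed.

Lemma ImO0 : ImO (0 : Oct R).
Proof. by apply/ImOE; rewrite /= mxE. Qed.

Lemma odotC x y : odot x y = odot y x.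
Proof. by rewrite !odotE; ring. Qed.

Lemma odotDl x y z : odot (x + y) z = odot x z + odot y z.
Proof. by rewrite !odotE /= !mxE; ring. Qed.

Lemma odotDr x y z : odot x (y + z) = odot x y + odot x z.
Proof. by rewrite !(odotC x) odotDl. Qed.

Lemma odotZr (k : R) x y : odot x (k *: y) = k * odot x y.
Proof. by rewrite odotC odotZl odotC. Qed.

Lemma odotNl x y : odot (- x) y = - odot x y.
Proof. by rewrite -scaleN1r odotZl mulN1r. Qed.

Lemma odotNr x y : odot x (- y) = - odot x y.
Proof. by rewrite odotC odotNl odotC. Qed.

Lemma odot0l x : odot 0 x = 0.
Proof. by rewrite -(scale0r 0) odotZl mul0r. Qed.

Lemma odot0r x : odot x 0 = 0.
Proof. by rewrite odotC odot0l. Qed.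

Lemma crossDl x y z : cross (x + y) z = cross x z + cross y z.
Proof. by rewrite !crossE; apply: octP; rewrite /= !(quatE, mxE) /=; ring. Qed.

Lemma crossDr x y z : cross x (y + z) = cross x y + cross x z.
Proof. by rewrite !crossE; apply: octP; rewrite /= !(quatE, mxE) /=; ring. Qed.

Lemma crossZl (k : R) x y : cross (k *: x) y = k *: cross x y.
Proof. by rewrite -[y in LHS]scale1r crossZZ mulr1. Qed.

Lemma crossZr (k : R) x y : cross x (k *: y) = k *: cross x y.
Proof. by rewrite -[x in LHS]scale1r crossZZ mul1r. Qed.

Lemma crossNl x y : cross (- x) y = - cross x y.
Proof. by rewrite -scaleN1r crossZl scaleN1r. Qed.

Lemma crossNr x y : cross x (- y) = - cross x y.
Proof. by rewrite -scaleN1r crossZr scaleN1r. Qed.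

Lemma cross0l x : cross 0 x = 0.
Proof. by rewrite -{1}(scale0r x) crossZl scale0r. Qed.

Lemma cross0r x : cross x 0 = 0.
Proof. by rewrite -{1}(scale0r x) crossZr scale0r. Qed.

(** Zorn's vector-matrix coordinates: x = (a, c, b) stands for the matrix with
diagonal (c, -c) and off-diagonal vectors a, b in R^3. The triples a and b span dual
isotropic 3-spaces, and the cross products of R^3 inside each of them make the
action of SL_3 visible. *)
Definition zorn (a1 a2 a3 c b1 b2 b3 : R) : Oct R :=
  (quat 0 ((a1 + b1) / 2) ((a2 + b2) / 2) ((a3 + b3) / 2),
   quat c ((a1 - b1) / 2) ((a2 - b2) / 2) ((a3 - b3) / 2)).

Lemma ImO_zorn a1 a2 a3 c b1 b2 b3 : ImO (zorn a1 a2 a3 c b1 b2 b3).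
Proof. by apply/ImOE; rewrite /= quatE. Qed.

Lemma ImO_zornP x : ImO x ->
  exists a1 a2 a3 c b1 b2 b3, x = zorn a1 a2 a3 c b1 b2 b3.
Proof.
move=> /ImOE hx.
exists (x.1 0 1 + x.2 0 1), (x.1 0 2 + x.2 0 2), (x.1 0 3 + x.2 0 3), (x.2 0 0),
  (x.1 0 1 - x.2 0 1), (x.1 0 2 - x.2 0 2), (x.1 0 3 - x.2 0 3).
by apply: octP; rewrite /zorn /= quatE ?hx //; field.
Qed.

Lemma cross_zorn a1 a2 a3 c b1 b2 b3 a1' a2' a3' c' b1' b2' b3' :
  cross (zorn a1 a2 a3 c b1 b2 b3) (zorn a1' a2' a3' c' b1' b2' b3') =
  zorn (b2 * b3' - b3 * b2' + c * a1' - c' * a1)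
     (b3 * b1' - b1 * b3' + c * a2' - c' * a2)
     (b1 * b2' - b2 * b1' + c * a3' - c' * a3)
     ((b1 * a1' + b2 * a2' + b3 * a3' - a1 * b1' - a2 * b2' - a3 * b3') / 2)
     (a2 * a3' - a3 * a2' - c * b1' + c' * b1)
     (a3 * a1' - a1 * a3' - c * b2' + c' * b2)
     (a1 * a2' - a2 * a1' - c * b3' + c' * b3).
Proof. by rewrite crossE; apply: octP; rewrite /zorn /= !quatE; field. Qed.

Lemma odot_zorn a1 a2 a3 c b1 b2 b3 a1' a2' a3' c' b1' b2' b3' :
  odot (zorn a1 a2 a3 c b1 b2 b3) (zorn a1' a2' a3' c' b1' b2' b3') =
  (a1 * b1' + a2 * b2' + a3 * b3' + b1 * a1' + b2 * a2' + b3 * a3') / 2 - c * c'.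
Proof. by rewrite odotE /zorn /= !quatE; field. Qed.

Lemma zornD a1 a2 a3 c b1 b2 b3 a1' a2' a3' c' b1' b2' b3' :
  zorn a1 a2 a3 c b1 b2 b3 + zorn a1' a2' a3' c' b1' b2' b3' =
  zorn (a1 + a1') (a2 + a2') (a3 + a3') (c + c') (b1 + b1') (b2 + b2') (b3 + b3').
Proof. by apply: octP; rewrite /zorn /= mxE !quatE; field. Qed.

Lemma zornZ k a1 a2 a3 c b1 b2 b3 :
  k *: zorn a1 a2 a3 c b1 b2 b3 =
  zorn (k * a1) (k * a2) (k * a3) (k * c) (k * b1) (k * b2) (k * b3).
Proof. by apply: octP; rewrite /zorn /= mxE !quatE; field. Qed.

Lemma zorn_inj a1 a2 a3 c b1 b2 b3 a1' a2' a3' c' b1' b2' b3' :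
  zorn a1 a2 a3 c b1 b2 b3 = zorn a1' a2' a3' c' b1' b2' b3' ->
  [/\ a1 = a1', a2 = a2' & a3 = a3'] /\ [/\ c = c', b1 = b1', b2 = b2' & b3 = b3'].
Proof.
move=> e.
have E i := congr1 (fun x : Oct R => x.1 0 i) e.
have F i := congr1 (fun x : Oct R => x.2 0 i) e.
move: (E 1) (E 2) (E 3) (F 0) (F 1) (F 2) (F 3); rewrite /zorn /= !quatE => *.
by split; split; lra.
Qed.

Lemma zorn0 : zorn 0 0 0 0 0 0 0 = 0.
Proof. by apply: octP; rewrite /zorn /= quatE mxE //; field. Qed.

Lemma crossC x y : ImO x -> ImO y -> cross x y = - cross y x.
Proof.
move=> /ImO_zornP [a1 [a2 [a3 [a0 [a4 [a5 [a6 ->]]]]]]].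
move=> /ImO_zornP [b1 [b2 [b3 [b0 [b4 [b5 [b6 ->]]]]]]].
by rewrite -scaleN1r !(cross_zorn, zornZ); congr zorn; field.
Qed.

Lemma crossxx x : ImO x -> cross x x = 0.
Proof.
move=> /ImO_zornP [a1 [a2 [a3 [a0 [a4 [a5 [a6 ->]]]]]]].
by rewrite cross_zorn -zorn0; congr zorn; field.
Qed.

Lemma odot_crossl x y z : ImO x -> ImO y -> ImO z ->
  odot (cross x y) z = odot x (cross y z).
Proof.
move=> /ImO_zornP [a1 [a2 [a3 [a0 [a4 [a5 [a6 ->]]]]]]].
move=> /ImO_zornP [b1 [b2 [b3 [b0 [b4 [b5 [b6 ->]]]]]]].
move=> /ImO_zornP [c1 [c2 [c3 [c0 [c4 [c5 [c6 ->]]]]]]].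
by rewrite !(cross_zorn, odot_zorn); field.
Qed.

(** The polarized form of the alternative law; with skewness and odot_crossl it is
the only property of the cross product used below, apart from coordinates at a base
point. *)
Lemma cross_cross x y z : ImO x -> ImO y -> ImO z ->
  cross x (cross y z) + cross y (cross x z) =
  odot x z *: y + odot y z *: x + (- (2 * odot x y)) *: z.
Proof.
move=> /ImO_zornP [a1 [a2 [a3 [a0 [a4 [a5 [a6 ->]]]]]]].
move=> /ImO_zornP [b1 [b2 [b3 [b0 [b4 [b5 [b6 ->]]]]]]].
move=> /ImO_zornP [c1 [c2 [c3 [c0 [c4 [c5 [c6 ->]]]]]]].
by rewrite !(cross_zorn, odot_zorn, zornZ, zornD); congr zorn; field.
Qed.

Lemma omul_real x y : odot (omul x y) (oone R) =
  2 * (odot x (oone R) * odot y (oone R)) - odot x y.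
Proof. by rewrite !odot_one odotE /omul /= /qmul /qconj !(quatE, mxE); ring. Qed.

Lemma omul_cross x y : omul x y = odot (omul x y) (oone R) *: oone R + cross x y.
Proof. by rewrite /cross /im_part addrC subrK. Qed.

Lemma omulE x y : ImO x -> ImO y -> omul x y = cross x y - odot x y *: oone R.
Proof.
move=> hx hy; rewrite omul_cross omul_real hx mul0r mulr0 sub0r addrC.
by rewrite scaleNr.
Qed.

(** Pairing x = (a, b) with (a, -b) gives a sum of squares. *)
Lemma odot_nondeg x : ImO x -> (forall y, ImO y -> odot x y = 0) -> x = 0.
Proof.
move=> /ImOE hx h.
have := h (x.1, - x.2); rewrite odotE /= !mxE hx => h0.
have {}h0 := h0 (proj2 (ImOE (x.1, - x.2)) hx).
by apply: octP; rewrite ?mxE ?hx //; nra.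
Qed.

End Coordinates.

Section ImaginaryPart.
Variable R : realType.
Implicit Types x y z u v w : Oct R.

Lemma ImO_im_part x : ImO (im_part x).
Proof.
by rewrite /ImO /= /im_part odotDl odotNl odotZl odot_oone mulr1 subrr.
Qed.

Lemma im_partE x : x = odot x (oone R) *: oone R + im_part x.
Proof. by rewrite /im_part addrC subrK. Qed.

(** Computed from the cross product, as 1 x v = v = v x 1 for imaginary v and 1 x 1
= 0. *)
Lemma omul_split (r s : R) u v : ImO u -> ImO v ->
  omul (r *: oone R + u) (s *: oone R + v) =
  (r * s - odot u v) *: oone R + (r *: v + s *: u + cross u v).
Proof.
move=> hu hv; have hu0 : odot u (oone R) = 0 := hu; have hv0 : odot v (oone R) = 0 := hv.
have im_Im w : ImO w -> im_part w = w by move=> hw; rewrite /im_part hw scale0r subr0.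
have one_cross w : ImO w -> cross (oone R) w = w by move=> hw; rewrite /cross omul1l im_Im.
have cross_one w : ImO w -> cross w (oone R) = w by move=> hw; rewrite /cross omul1 im_Im.
have one_one : cross (oone R) (oone R) = 0.
  by rewrite /cross omul1 /im_part odot_oone scale1r subrr.
rewrite omul_cross omul_real !(odotDl, odotZl, odotDr, odotZr) odot_oone.
rewrite (odotC (oone R)) hu0 hv0 !crossDl !crossDr !crossZl !crossZr.
rewrite (one_cross v hv) (cross_one u hu) one_one !scaler0.
move: (oone R) (cross u v) (odot u v) => e c d.
by apply: linear_ext => L LD LZ LN L0; rewrite !(LD, LZ, LN, L0); ring.
Qed.

End ImaginaryPart.

(** * Products determined by a multiplication table *)

Section Tables.
Variable R : realType.
Implicit Types x y z : Oct R.
Lemma addrr_inj x y : x + x = y + y -> x = y.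
Proof.
move=> e; have h : 1 = 2^-1 + 2^-1 :> R by field.
by rewrite -[x]scale1r -[y]scale1r h !scalerDl -!scalerDr e.
Qed.

Section Table.
Variable X : Oct R -> Oct R -> Oct R.
Hypotheses (XDl : forall x y z, X (x + y) z = X x z + X y z)
  (XZl : forall k x y, X (k *: x) y = k *: X x y)
  (XC : forall x y, X x y = - X y x).
Variables E1 E2 E3 H F1 F2 F3 : Oct R.

(** The candidate image of Zorn coordinates under the linear map that sends the
standard basis to E1, E2, E3, H, F1, F2, F3. *)
Definition comb (a1 a2 a3 c b1 b2 b3 : R) : Oct R :=
  a1 *: E1 + a2 *: E2 + a3 *: E3 + c *: H + b1 *: F1 + b2 *: F2 + b3 *: F3.

Hypotheses (X12 : X E1 E2 = F3) (X23 : X E2 E3 = F1) (X31 : X E3 E1 = F2).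
Hypotheses (Y12 : X F1 F2 = E3) (Y23 : X F2 F3 = E1) (Y31 : X F3 F1 = E2).
Hypotheses (Z12 : X E1 F2 = 0) (Z13 : X E1 F3 = 0) (Z21 : X E2 F1 = 0).
Hypotheses (Z23 : X E2 F3 = 0) (Z31 : X E3 F1 = 0) (Z32 : X E3 F2 = 0).
Hypotheses (K1 : X E1 F1 = (- 2^-1) *: H) (K2 : X E2 F2 = (- 2^-1) *: H).
Hypotheses (K3 : X E3 F3 = (- 2^-1) *: H).
Hypotheses (EH1 : X E1 H = - E1) (EH2 : X E2 H = - E2) (EH3 : X E3 H = - E3).
Hypotheses (FH1 : X F1 H = F1) (FH2 : X F2 H = F2) (FH3 : X F3 H = F3).

(** A skew product satisfying the table of the standard basis is given in
coordinates by the formula of the cross product; the operations are kept abstract so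
that the expansion meets no octonion coordinates. *)
Lemma table_cross a1 a2 a3 c b1 b2 b3 a1' a2' a3' c' b1' b2' b3' :
  X (comb a1 a2 a3 c b1 b2 b3) (comb a1' a2' a3' c' b1' b2' b3') =
  comb (b2 * b3' - b3 * b2' + c * a1' - c' * a1)
     (b3 * b1' - b1 * b3' + c * a2' - c' * a2)
     (b1 * b2' - b2 * b1' + c * a3' - c' * a3)
     ((b1 * a1' + b2 * a2' + b3 * a3' - a1 * b1' - a2 * b2' - a3 * b3') / 2)
     (a2 * a3' - a3 * a2' - c * b1' + c' * b1)
     (a3 * a1' - a1 * a3' - c * b2' + c' * b2)
     (a1 * a2' - a2 * a1' - c * b3' + c' * b3).
Proof.
have XDr x y z : X x (y + z) = X x y + X x z by rewrite XC XDl opprD -!(XC x).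
have XZr k x y : X x (k *: y) = k *: X x y by rewrite XC XZl -scalerN -(XC x).
have XX x : X x x = 0.
  apply: addrr_inj; rewrite addr0 {2}XC; exact: subrr.
rewrite /comb !(XDl, XDr, XZl, XZr, XX) (XC E2 E1) (XC E3 E2) (XC E1 E3).
rewrite (XC F2 E1) (XC F3 E1) (XC F1 E2) (XC F3 E2) (XC F1 E3) (XC F2 E3).
rewrite (XC F2 F1) (XC F3 F2) (XC F1 F3) !(XC H) (XC F1 E1) (XC F2 E2) (XC F3 E3).
rewrite X12 X23 X31 Y12 Y23 Y31 Z12 Z13 Z21 Z23 Z31 Z32 K1 K2 K3.
rewrite EH1 EH2 EH3 FH1 FH2 FH3.
by apply: linear_ext => L LD LZ LN L0; rewrite !(LD, LZ, LN, L0); ring.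
Qed.

Lemma comb_lin (U : Oct R) k p0 p1 p2 p3 p4 p5 p6 p7 q0 q1 q2 q3 q4 q5 q6 q7 :
  (k * q0 + p0) *: U +
  comb (k * q1 + p1 + (k * q5 + p5)) (k * q2 + p2 + (k * q6 + p6))
     (k * q3 + p3 + (k * q7 + p7)) (k * q4 + p4) (k * q1 + p1 - (k * q5 + p5))
     (k * q2 + p2 - (k * q6 + p6)) (k * q3 + p3 - (k * q7 + p7)) =
  k *: (q0 *: U + comb (q1 + q5) (q2 + q6) (q3 + q7) q4 (q1 - q5) (q2 - q6) (q3 - q7)) +
  (p0 *: U + comb (p1 + p5) (p2 + p6) (p3 + p7) p4 (p1 - p5) (p2 - p6) (p3 - p7)).
Proof.
by rewrite /comb; apply: linear_ext => L LD LZ LN L0; rewrite !(LD, LZ, LN, L0); ring.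
Qed.
End Table.

Section TableDot.
Variable B : Oct R -> Oct R -> R.
Hypotheses (BDl : forall x y z, B (x + y) z = B x z + B y z)
  (BZl : forall k x y, B (k *: x) y = k * B x y)
  (BC : forall x y, B x y = B y x).
Variables E1 E2 E3 H F1 F2 F3 : Oct R.
Hypotheses (E11 : B E1 E1 = 0) (E22 : B E2 E2 = 0) (E33 : B E3 E3 = 0).
Hypotheses (E12 : B E1 E2 = 0) (E23 : B E2 E3 = 0) (E31 : B E3 E1 = 0).
Hypotheses (F11 : B F1 F1 = 0) (F22 : B F2 F2 = 0) (F33 : B F3 F3 = 0).
Hypotheses (F12 : B F1 F2 = 0) (F23 : B F2 F3 = 0) (F31 : B F3 F1 = 0).
Hypotheses (C12 : B E1 F2 = 0) (C13 : B E1 F3 = 0) (C21 : B E2 F1 = 0).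
Hypotheses (C23 : B E2 F3 = 0) (C31 : B E3 F1 = 0) (C32 : B E3 F2 = 0).
Hypotheses (C11 : B E1 F1 = 2^-1) (C22 : B E2 F2 = 2^-1) (C33 : B E3 F3 = 2^-1).
Hypotheses (EH1 : B E1 H = 0) (EH2 : B E2 H = 0) (EH3 : B E3 H = 0).
Hypotheses (FH1 : B F1 H = 0) (FH2 : B F2 H = 0) (FH3 : B F3 H = 0).
Hypothesis HH : B H H = -1.

Local Notation comb := (comb E1 E2 E3 H F1 F2 F3).

Lemma table_odot a1 a2 a3 c b1 b2 b3 a1' a2' a3' c' b1' b2' b3' :
  B (comb a1 a2 a3 c b1 b2 b3) (comb a1' a2' a3' c' b1' b2' b3') =
  (a1 * b1' + a2 * b2' + a3 * b3' + b1 * a1' + b2 * a2' + b3 * a3') / 2 - c * c'.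
Proof.
have BDr x y z : B x (y + z) = B x y + B x z by rewrite BC BDl -!(BC x).
have BZr k x y : B x (k *: y) = k * B x y by rewrite BC BZl -(BC x).
rewrite /comb !(BDl, BDr, BZl, BZr) (BC E2 E1) (BC E3 E2) (BC E1 E3).
rewrite (BC F2 E1) (BC F3 E1) (BC F1 E2) (BC F3 E2) (BC F1 E3) (BC F2 E3).
rewrite (BC F2 F1) (BC F3 F2) (BC F1 F3) !(BC H) (BC F1 E1) (BC F2 E2) (BC F3 E3).
rewrite E11 E22 E33 E12 E23 E31 F11 F22 F33 F12 F23 F31 C12 C13 C21 C23 C31 C32.
by rewrite C11 C22 C33 EH1 EH2 EH3 FH1 FH2 FH3 HH; field.
Qed.
End TableDot.

End Tables.

(** * Automorphisms from null triples *)

Section NullTriples.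
Variable R : realType.
Implicit Types x y z u v w : Oct R.

(** Octonions are R 1 + Im, and the product is recovered from the cross product and
the form by omul_split; injectivity comes from non-degeneracy. *)
Lemma g2_of_cross (A : 'End(Oct R)) : A (oone R) = oone R ->
  (forall u, ImO u -> ImO (A u)) ->
  (forall u v, ImO u -> ImO v -> A (cross u v) = cross (A u) (A v)) ->
  (forall u v, ImO u -> ImO v -> odot (A u) (A v) = odot u v) ->
  exists psi : G2' R, forall x, psi x = A x.
Proof.
move=> A1 AI AC AO.
have Ainj : lker A == 0%VS.
  apply/lker0P => x y /eqP; rewrite -subr_eq0 -linearB /= => /eqP.
  set d := x - y => Ad; apply/eqP; rewrite -subr_eq0 -/d; apply/eqP.
  have ih := ImO_im_part d.
  have e := congr1 A (im_partE d); rewrite Ad linearD linearZ /= A1 in e.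
  have r0 : odot d (oone R) = 0.
    have := congr1 (fun z => odot z (oone R)) e.
    by rewrite odot0l odotDl odotZl odot_oone mulr1 (AI _ ih : odot _ _ = 0) addr0.
  move: e; rewrite r0 scale0r add0r => /esym e.
  rewrite (im_partE d) r0 scale0r add0r; apply: odot_nondeg => // v hv.
  by rewrite -AO // e odot0l.
have Ab : bijective A.
  exists (A^-1)%VF; [exact: lker0_lfunK | exact: lker0_lfunVK].
have Am x y : A (omul x y) = omul (A x) (A y).
  have hx := ImO_im_part x; have hy := ImO_im_part y.
  rewrite (im_partE x) (im_partE y).
  move: (odot x _) (odot y _) (im_part x) (im_part y) hx hy => r t u v hu hv.
  rewrite omul_split //; have := omul_split r t (AI _ hu) (AI _ hv).
  rewrite -AC // AO // => e.
  move: (odot u v) (cross u v) e => o c e.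
  by rewrite !linearD !linearZ /= A1 e.
by exists (MkG2' Ab Am).
Qed.

Lemma g2_ImO (psi : G2' R) u : ImO u -> ImO (psi u).
Proof. by move=> /(g2_quadratic psi) []. Qed.

Lemma g2_odot (psi : G2' R) u v : ImO u -> ImO v ->
  odot (psi u) (psi v) = odot u v.
Proof.
move=> hu hv.
have [_ e1] := g2_quadratic psi (ImOD hu hv).
have [_ e2] := g2_quadratic psi hu; have [_ e3] := g2_quadratic psi hv.
move: e1; rewrite linearD /= !odotDl !odotDr e2 e3 (odotC (psi v)) (odotC v).
by move=> e; lra.
Qed.

Lemma g2_cross (psi : G2' R) u v : ImO u -> ImO v ->
  psi (cross u v) = cross (psi u) (psi v).
Proof.
move=> hu hv; have := g2_mul psi u v.
rewrite !omulE //; try exact: g2_ImO.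
by rewrite linearB linearZ /= g2_one g2_odot // => /addIr.
Qed.

(** The double cross product with a repeated null vector: the source of most
vanishing statements below. *)
Lemma null_cross x y : ImO x -> ImO y -> odot x x = 0 ->
  cross x (cross x y) = odot x y *: x.
Proof.
move=> hx hy nx; have := cross_cross hx hx hy.
by rewrite nx mulr0 oppr0 scale0r addr0 => /addrr_inj.
Qed.

Lemma odot_cross_self x y : ImO x -> ImO y -> odot x (cross x y) = 0.
Proof. by move=> hx hy; rewrite -odot_crossl // crossxx // odot0l. Qed.

Lemma odot_cross_self2 x y : ImO x -> ImO y -> odot y (cross x y) = 0.
Proof. by move=> hx hy; rewrite crossC // odotNr odot_cross_self ?oppr0. Qed.

Lemma null_cross_null x y : ImO x -> ImO y -> odot x x = 0 -> odot x y = 0 ->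
  odot (cross x y) (cross x y) = 0.
Proof.
move=> hx hy nx xy.
have hc := ImO_cross x y.
by rewrite {1}crossC // odotNl odot_crossl // null_cross // xy scale0r odot0r oppr0.
Qed.

Definition e1 : Oct R := zorn 1 0 0 0 0 0 0.
Definition e2 : Oct R := zorn 0 1 0 0 0 0 0.
Definition e3 : Oct R := zorn 0 0 1 0 0 0 0.
Definition hh : Oct R := zorn 0 0 0 1 0 0 0.
Definition f1 : Oct R := zorn 0 0 0 0 1 0 0.
Definition f2 : Oct R := zorn 0 0 0 0 0 1 0.
Definition f3 : Oct R := zorn 0 0 0 0 0 0 1.

Lemma zornE (a1 a2 a3 c b1 b2 b3 : R) (x := zorn a1 a2 a3 c b1 b2 b3) :
  ((x.1 0 0 = 0) * (x.2 0 0 = c)) *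
  ((x.1 0 1 + x.2 0 1 = a1) * (x.1 0 2 + x.2 0 2 = a2) * (x.1 0 3 + x.2 0 3 = a3)) *
  ((x.1 0 1 - x.2 0 1 = b1) * (x.1 0 2 - x.2 0 2 = b2) * (x.1 0 3 - x.2 0 3 = b3)).
Proof. by rewrite /x /zorn /= !quatE; do !split; field. Qed.

Section Triple.
Variables E1 E2 E3 : Oct R.
Hypotheses (I1 : ImO E1) (I2 : ImO E2) (I3 : ImO E3).
Hypotheses (N1 : odot E1 E1 = 0) (N2 : odot E2 E2 = 0) (N3 : odot E3 E3 = 0).
Hypotheses (O12 : odot E1 E2 = 0) (O23 : odot E2 E3 = 0) (O31 : odot E3 E1 = 0).
Hypothesis V : odot (cross E1 E2) E3 = 2^-1.

Let F1 := cross E2 E3.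
Let F2 := cross E3 E1.
Let F3 := cross E1 E2.
Let H := (-2) *: cross E1 F1.

Let J1 : ImO F1. Proof. exact: ImO_cross. Qed.
Let J2 : ImO F2. Proof. exact: ImO_cross. Qed.
Let J3 : ImO F3. Proof. exact: ImO_cross. Qed.
Let JH : ImO H. Proof. by apply: ImOZ; exact: ImO_cross. Qed.

Let O21 : odot E2 E1 = 0. Proof. by rewrite odotC. Qed.
Let O32 : odot E3 E2 = 0. Proof. by rewrite odotC. Qed.
Let O13 : odot E1 E3 = 0. Proof. by rewrite odotC. Qed.

Let EF11 : odot E1 F1 = 2^-1.
Proof. by rewrite /F1 -odot_crossl. Qed.
Let EF22 : odot E2 F2 = 2^-1.
Proof. by rewrite /F2 -odot_crossl // odotC -odot_crossl. Qed.
Let EF33 : odot E3 F3 = 2^-1.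
Proof. by rewrite odotC. Qed.
Let EF12 : odot E1 F2 = 0. Proof. exact: odot_cross_self2. Qed.
Let EF13 : odot E1 F3 = 0. Proof. exact: odot_cross_self. Qed.
Let EF21 : odot E2 F1 = 0. Proof. exact: odot_cross_self. Qed.
Let EF23 : odot E2 F3 = 0. Proof. exact: odot_cross_self2. Qed.
Let EF31 : odot E3 F1 = 0. Proof. exact: odot_cross_self2. Qed.
Let EF32 : odot E3 F2 = 0. Proof. exact: odot_cross_self. Qed.

Let X21 : cross E2 E1 = - F3. Proof. by rewrite crossC. Qed.
Let X32 : cross E3 E2 = - F1. Proof. by rewrite crossC. Qed.
Let X13 : cross E1 E3 = - F2. Proof. by rewrite crossC. Qed.

Let EFx12 : cross E1 F2 = 0.
Proof. by rewrite -[F2]opprK -X13 crossNr null_cross // O13 scale0r oppr0. Qed.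
Let EFx13 : cross E1 F3 = 0.
Proof. by rewrite /F3 null_cross // O12 scale0r. Qed.
Let EFx21 : cross E2 F1 = 0.
Proof. by rewrite /F1 null_cross // O23 scale0r. Qed.
Let EFx23 : cross E2 F3 = 0.
Proof. by rewrite -[F3]opprK -X21 crossNr null_cross // O21 scale0r oppr0. Qed.
Let EFx31 : cross E3 F1 = 0.
Proof. by rewrite -[F1]opprK -X32 crossNr null_cross // O32 scale0r oppr0. Qed.
Let EFx32 : cross E3 F2 = 0.
Proof. by rewrite /F2 null_cross // O31 scale0r. Qed.

Let K1 : cross E1 F1 = (- 2^-1) *: H.
Proof. by rewrite /H scalerA mulrNN mulVf ?scale1r // pnatr_eq0. Qed.
Let K2 : cross E2 F2 = (- 2^-1) *: H.
Proof.
rewrite -K1; have := cross_cross I1 I2 I3.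
rewrite -/F1 X13 crossNr O13 O23 O12 mulr0 oppr0 !scale0r !addr0 => /eqP.
by rewrite subr_eq0 => /eqP.
Qed.
Let K3 : cross E3 F3 = (- 2^-1) *: H.
Proof.
rewrite -K2; have := cross_cross I2 I3 I1.
rewrite -/F2 X21 crossNr O21 O31 O23 mulr0 oppr0 !scale0r !addr0 => /eqP.
by rewrite subr_eq0 => /eqP ->.
Qed.

Let HE (P Q : Oct R) : ImO P -> ImO Q -> odot P P = 0 -> odot P Q = 2^-1 ->
  cross P Q = (- 2^-1) *: H -> cross P H = - P.
Proof.
move=> hP hQ nP pq k.
have -> : H = (-2) *: cross P Q by rewrite k scalerA mulrNN divff ?scale1r // pnatr_eq0.
by rewrite crossZr null_cross // pq scalerA mulNr divff ?scaleN1r // pnatr_eq0.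
Qed.
Let E1H : cross E1 H = - E1. Proof. exact: (HE I1 J1). Qed.
Let E2H : cross E2 H = - E2. Proof. exact: (HE I2 J2). Qed.
Let E3H : cross E3 H = - E3. Proof. exact: (HE I3 J3). Qed.

Let HO P Q : ImO P -> ImO Q -> cross P Q = (- 2^-1) *: H ->
  odot P H = 0 /\ odot Q H = 0.
Proof.
move=> hP hQ k.
have -> : H = (-2) *: cross P Q by rewrite k scalerA mulrNN divff ?scale1r // pnatr_eq0.
by rewrite !odotZr odot_cross_self // odot_cross_self2 // mulr0.
Qed.
Let OH1 := HO I1 J1 K1.
Let OH2 := HO I2 J2 K2.
Let OH3 := HO I3 J3 K3.

Let FF11 : odot F1 F1 = 0. Proof. exact: null_cross_null. Qed.
Let FF22 : odot F2 F2 = 0. Proof. exact: null_cross_null. Qed.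
Let FF33 : odot F3 F3 = 0. Proof. exact: null_cross_null. Qed.
Let FF12 : odot F1 F2 = 0.
Proof. by rewrite (odot_crossl I2 I3 J2) EFx32 odot0r. Qed.
Let FF23 : odot F2 F3 = 0.
Proof. by rewrite (odot_crossl I3 I1 J3) EFx13 odot0r. Qed.
Let FF31 : odot F3 F1 = 0.
Proof. by rewrite (odot_crossl I1 I2 J1) EFx21 odot0r. Qed.
Let OHH : odot H H = -1.
Proof.
rewrite {1}/H odotZl odot_crossl // (crossC J1 JH).
have : cross H F1 = - F1.
  have := cross_cross JH I2 I3.
  rewrite -/F1 (odotC H E2) (proj1 OH2) (odotC H E3) (proj1 OH3) O23 mulr0 oppr0.
  rewrite !scale0r !addr0 (crossC JH I3) E3H opprK -/F1 => /eqP.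
  by rewrite addr_eq0 => /eqP.
by move=> ->; rewrite opprK EF11; field.
Qed.

Let HF (P Q S : Oct R) : ImO P -> ImO Q -> odot P Q = 0 -> odot P H = 0 ->
  odot Q H = 0 -> cross Q H = - Q -> S = cross P Q -> cross S H = S.
Proof.
move=> hP hQ pq hp hq k ->.
have := cross_cross JH hP hQ.
rewrite (odotC H P) hp (odotC H Q) hq pq mulr0 oppr0 !scale0r !addr0.
rewrite (crossC JH hQ) k opprK => /eqP; rewrite addr_eq0 => /eqP e.
by rewrite crossC ?e ?opprK //; exact: ImO_cross.
Qed.
Let F1H : cross F1 H = F1.
Proof. by apply: (HF I2 I3) => //; [apply: OH2.1|apply: OH3.1]. Qed.
Let F2H : cross F2 H = F2.
Proof. by apply: (HF I3 I1) => //; [apply: OH3.1|apply: OH1.1]. Qed.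
Let F3H : cross F3 H = F3.
Proof. by apply: (HF I1 I2) => //; [apply: OH1.1|apply: OH2.1]. Qed.

Let FFx (P Q S T U : Oct R) : ImO P -> ImO Q -> ImO S -> ImO T ->
  odot P Q = 2^-1 -> odot S Q = 0 -> odot S P = 0 ->
  cross P Q = (- 2^-1) *: H -> cross S H = - S ->
  T = cross S P -> cross Q T = S.
Proof.
move=> hP hQ hS hT pq sq sp k sh ->.
have := cross_cross hQ hS hP.
rewrite (odotC Q P) pq (odotC Q S) sq sp mulr0 oppr0 !scale0r !addr0.
rewrite (crossC hQ hP) k scaleNr opprK crossZr sh scalerN => /eqP.
rewrite subr_eq => /eqP ->.
by rewrite -scalerDl (_ : _ + _ = 1) ?scale1r //; field.
Qed.
Let X12 : cross F1 F2 = E3.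
Proof. exact: (FFx _ I1 J1 I3 J2). Qed.
Let X23 : cross F2 F3 = E1.
Proof. exact: (FFx _ I2 J2 I1 J3). Qed.
Let X31 : cross F3 F1 = E2.
Proof. exact: (FFx _ I3 J3 I2 J1). Qed.

(* The cross product is skew only on imaginary vectors; its skew part is skew everywhere. *)
Let X x y := 2^-1 *: (cross x y - cross y x).
Let XE x y : ImO x -> ImO y -> X x y = cross x y.
Proof.
move=> hx hy; rewrite /X (crossC hy hx); move: (cross x y) => z.
by rewrite opprK scalerDr -scalerDl (_ : _ + _ = 1) ?scale1r //; field.
Qed.
Let XDl x y z : X (x + y) z = X x z + X y z.
Proof.
rewrite /X crossDl crossDr.
move: (cross x z) (cross z x) (cross y z) (cross z y) => a b c d.
by rewrite -scalerDr opprD addrACA.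
Qed.
Let XZl k x y : X (k *: x) y = k *: X x y.
Proof.
rewrite /X crossZl crossZr; move: (cross x y) (cross y x) => a b.
by rewrite -scalerBr !scalerA mulrC.
Qed.
Let XC x y : X x y = - X y x.
Proof. by rewrite /X; move: (cross x y) (cross y x) => a b; rewrite -scalerN opprB. Qed.

Let B := comb E1 E2 E3 H F1 F2 F3.

Let ImO_B a1 a2 a3 c b1 b2 b3 : ImO (B a1 a2 a3 c b1 b2 b3).
Proof. by rewrite /B /comb; do !apply: ImOD; apply: ImOZ. Qed.

Let B_cross a1 a2 a3 c b1 b2 b3 a1' a2' a3' c' b1' b2' b3' :
  cross (B a1 a2 a3 c b1 b2 b3) (B a1' a2' a3' c' b1' b2' b3') =
  B (b2 * b3' - b3 * b2' + c * a1' - c' * a1)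
     (b3 * b1' - b1 * b3' + c * a2' - c' * a2)
     (b1 * b2' - b2 * b1' + c * a3' - c' * a3)
     ((b1 * a1' + b2 * a2' + b3 * a3' - a1 * b1' - a2 * b2' - a3 * b3') / 2)
     (a2 * a3' - a3 * a2' - c * b1' + c' * b1)
     (a3 * a1' - a1 * a3' - c * b2' + c' * b2)
     (a1 * a2' - a2 * a1' - c * b3' + c' * b3).
Proof. by rewrite -XE //; apply: table_cross; rewrite ?XE. Qed.

Let B_odot a1 a2 a3 c b1 b2 b3 a1' a2' a3' c' b1' b2' b3' :
  odot (B a1 a2 a3 c b1 b2 b3) (B a1' a2' a3' c' b1' b2' b3') =
  (a1 * b1' + a2 * b2' + a3 * b3' + b1 * a1' + b2 * a2' + b3 * a3') / 2 - c * c'.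
Proof.
apply: table_odot => //; [exact: odotDl|exact: odotZl|exact: odotC|..].
- exact: OH1.1.
- exact: OH2.1.
- exact: OH3.1.
- exact: OH1.2.
- exact: OH2.2.
- exact: OH3.2.
Qed.

Let A x : Oct R := x.1 0 0 *: oone R +
  B (x.1 0 1 + x.2 0 1) (x.1 0 2 + x.2 0 2) (x.1 0 3 + x.2 0 3) (x.2 0 0)
    (x.1 0 1 - x.2 0 1) (x.1 0 2 - x.2 0 2) (x.1 0 3 - x.2 0 3).

Let A_zorn a1 a2 a3 c b1 b2 b3 : A (zorn a1 a2 a3 c b1 b2 b3) = B a1 a2 a3 c b1 b2 b3.
Proof.
by rewrite /A !zornE scale0r add0r.
Qed.

Let A_lin : linear A.
Proof.
move=> k x y.
have E (u v : Oct R) : [/\ (k *: u + v).1 0 0 = k * u.1 0 0 + v.1 0 0,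
   (k *: u + v).1 0 1 = k * u.1 0 1 + v.1 0 1,
   (k *: u + v).1 0 2 = k * u.1 0 2 + v.1 0 2 &
   (k *: u + v).1 0 3 = k * u.1 0 3 + v.1 0 3] /\
  [/\ (k *: u + v).2 0 0 = k * u.2 0 0 + v.2 0 0,
   (k *: u + v).2 0 1 = k * u.2 0 1 + v.2 0 1,
   (k *: u + v).2 0 2 = k * u.2 0 2 + v.2 0 2 &
   (k *: u + v).2 0 3 = k * u.2 0 3 + v.2 0 3] by rewrite /= !mxE.
have [[e0 a1 a2 a3] [b0 b1 b2 b3]] := E x y.
rewrite /A e0 a1 a2 a3 b0 b1 b2 b3.
move: (x.1 0 0) (x.1 0 1) (x.1 0 2) (x.1 0 3) (x.2 0 0) (x.2 0 1) (x.2 0 2) (x.2 0 3).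
move: (y.1 0 0) (y.1 0 1) (y.1 0 2) (y.1 0 3) (y.2 0 0) (y.2 0 1) (y.2 0 2) (y.2 0 3).
move=> {e0 a1 a2 a3 b0 b1 b2 b3} p0 p1 p2 p3 p4 p5 p6 p7 q0 q1 q2 q3 q4 q5 q6 q7.
exact: comb_lin.
Qed.

(** All entries of the multiplication table of E1, E2, E3, their three cross
products and H follow from the hypotheses by the double cross product identity; so
the linear map matching the standard basis with these seven vectors is an
automorphism. *)
Lemma g2_triple : exists psi : G2' R, [/\ psi e1 = E1, psi e2 = E2 & psi e3 = E3].
Proof.
pose AL : {linear Oct R -> Oct R} := HB.pack A (GRing.isLinear.Build R _ _ _ A A_lin).
have AE x : linfun AL x = A x by rewrite lfunE.
have [||||psi psiE] := @g2_of_cross (linfun AL).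
- rewrite AE /A /oone /qone /= !quatE !mxE !(addr0, subr0) scale1r.
  by rewrite /B /comb !scale0r !addr0.
- move=> u /ImO_zornP [a1 [a2 [a3 [a0 [a4 [a5 [a6 ->]]]]]]].
  by rewrite AE A_zorn.
- move=> u v /ImO_zornP [a1 [a2 [a3 [a0 [a4 [a5 [a6 ->]]]]]]].
  move=> /ImO_zornP [b1 [b2 [b3 [b0 [b4 [b5 [b6 ->]]]]]]].
  by rewrite !AE cross_zorn !A_zorn B_cross.
- move=> u v /ImO_zornP [a1 [a2 [a3 [a0 [a4 [a5 [a6 ->]]]]]]].
  move=> /ImO_zornP [b1 [b2 [b3 [b0 [b4 [b5 [b6 ->]]]]]]].
  by rewrite !AE odot_zorn !A_zorn B_odot.
by exists psi; rewrite !psiE !AE !A_zorn /B /comb !scale1r !scale0r !(addr0, add0r).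
Qed.
End Triple.
End NullTriples.

(** * Transitivity of the automorphism group *)

Section Transitivity.
Variable R : realType.
Implicit Types x y z u v w p : Oct R.
Implicit Type psi : G2' R.

Lemma zorn_std a1 a2 a3 c b1 b2 b3 : zorn a1 a2 a3 c b1 b2 b3 =
  a1 *: e1 R + a2 *: e2 R + a3 *: e3 R + c *: hh R
  + b1 *: f1 R + b2 *: f2 R + b3 *: f3 R.
Proof. by rewrite !zornZ !zornD; congr zorn; ring. Qed.

Lemma g2_zorn psi a1 a2 a3 c b1 b2 b3 : psi (zorn a1 a2 a3 c b1 b2 b3) =
  a1 *: psi (e1 R) + a2 *: psi (e2 R) + a3 *: psi (e3 R) + c *: psi (hh R)
  + b1 *: psi (f1 R) + b2 *: psi (f2 R) + b3 *: psi (f3 R).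
Proof. by rewrite zorn_std !linearD !linearZ. Qed.

Lemma cross_e12 : cross (e1 R) (e2 R) = f3 R.
Proof. by rewrite cross_zorn; congr zorn; field. Qed.
Lemma cross_e23 : cross (e2 R) (e3 R) = f1 R.
Proof. by rewrite cross_zorn; congr zorn; field. Qed.
Lemma cross_e31 : cross (e3 R) (e1 R) = f2 R.
Proof. by rewrite cross_zorn; congr zorn; field. Qed.
Lemma cross_f23 : cross (f2 R) (f3 R) = e1 R.
Proof. by rewrite cross_zorn; congr zorn; field. Qed.
Lemma cross_e1f1 : cross (e1 R) (f1 R) = (- 2^-1) *: hh R.
Proof. by rewrite cross_zorn zornZ; congr zorn; field. Qed.

Lemma g2_f1 psi : psi (f1 R) = cross (psi (e2 R)) (psi (e3 R)).
Proof. by rewrite -cross_e23; apply: g2_cross; exact: ImO_zorn. Qed.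
Lemma g2_f2 psi : psi (f2 R) = cross (psi (e3 R)) (psi (e1 R)).
Proof. by rewrite -cross_e31; apply: g2_cross; exact: ImO_zorn. Qed.
Lemma g2_f3 psi : psi (f3 R) = cross (psi (e1 R)) (psi (e2 R)).
Proof. by rewrite -cross_e12; apply: g2_cross; exact: ImO_zorn. Qed.
Lemma g2_hh psi : psi (hh R) = (-2) *: cross (psi (e1 R)) (psi (f1 R)).
Proof.
rewrite -(g2_cross psi (ImO_zorn _ _ _ _ _ _ _) (ImO_zorn _ _ _ _ _ _ _)) cross_e1f1 linearZ /= scalerA.
by rewrite (_ : _ * _ = 1) ?scale1r //; field.
Qed.

Lemma riesz (l : Oct R -> R) : (forall x y, l (x + y) = l x + l y) ->
  (forall k x, l (k *: x) = k * l x) ->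
  exists x, ImO x /\ forall y, ImO y -> l y = odot x y.
Proof.
move=> lD lZ.
exists (zorn (2 * l (f1 R)) (2 * l (f2 R)) (2 * l (f3 R)) (- l (hh R))
           (2 * l (e1 R)) (2 * l (e2 R)) (2 * l (e3 R))).
split=> [|y /ImO_zornP [a1 [a2 [a3 [a0 [a4 [a5 [a6 ->]]]]]]]]; first exact: ImO_zorn.
by rewrite odot_zorn zorn_std !lD !lZ; field.
Qed.

(** Separates w from V by an imaginary vector: the linear form obtained from the
component of w off V, represented through riesz. *)
Lemma dual_vector (V : {vspace Oct R}) w : (forall v, v \in V -> ImO v) -> ImO w ->
  w \notin V -> exists x, [/\ ImO x, forall v, v \in V -> odot x v = 0 & odot x w = 1].
Proof.
move=> VI hw wV; pose r y := y - projv V y.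
have rw : r w != 0.
  by apply: contraNneq wV => /eqP; rewrite subr_eq0 => /eqP ->; exact: memv_proj.
have hr : ImO (r w) by apply: ImOB => //; apply: VI; exact: memv_proj.
have [a ha aw] : exists2 a, ImO a & odot (r w) a != 0.
  apply: contrapT => H; move/eqP: rw; apply; apply: odot_nondeg => // a ha.
  by apply/eqP/negPn/negP => ra; apply: H; exists a.
have [||x [hx xE]] := @riesz (fun y => (odot (r w) a)^-1 * odot (r y) a).
- move=> y z; rewrite /r linearD /= -mulrDr -odotDl.
  by congr (_ * odot _ _); rewrite opprD addrACA.
- move=> k y; rewrite /r linearZ /= -scalerBr odotZl.
  by rewrite mulrCA.
exists x; split=> // [v vV|]; rewrite -xE //; last by rewrite mulVf.
  by rewrite {2}/r (projv_id vV) subrr odot0l mulr0.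
exact: VI.
Qed.

(** Both equations are read from the double cross product applied to p. *)
Lemma Ann_perp p w : ImO p -> ImO w -> p != 0 -> odot p p = 0 -> cross p w = 0 ->
  odot p w = 0 /\ odot w w = 0.
Proof.
move=> hp hw p0 np pw.
have pw0 : odot p w = 0.
  have := null_cross hp hw np; rewrite pw cross0r => /esym/eqP.
  by rewrite scaler_eq0 (negbTE p0) orbF => /eqP.
split=> //; have := cross_cross hw hw hp.
rewrite (crossC hw hp) pw oppr0 cross0r addr0 (odotC w p) pw0 scale0r !add0r.
move/esym/eqP; rewrite scaler_eq0 (negbTE p0) orbF oppr_eq0 mulf_eq0.
by rewrite pnatr_eq0 /= => /eqP.
Qed.

(** A vector q with q . p = 1 and q . w = 0 gives E3 = (q x w) / 2 with E3 x p = w.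
A null E2 orthogonal to p and E3 with E2 . w = 1/2 then completes a triple (p, E2,
E3), and w = E3 x p is the image of f2 = e3 x e1. *)
Lemma flag_trans p w : ImO p -> ImO w -> p != 0 -> odot p p = 0 ->
  cross p w = 0 -> w \notin <[p]>%VS ->
  exists psi, psi (e1 R) = p /\ psi (f2 R) = w.
Proof.
move=> hp hw p0 np pw wp.
have [pw0 nw] := Ann_perp hp hw p0 np pw.
have w0 : w != 0 by apply: contraNneq wp => ->; exact: mem0v.
have [q [hq qw qp]] : exists q, [/\ ImO q, odot q w = 0 & odot q p = 1].
  have [v /vlineP [k ->]|||q [hq qw qp]] := @dual_vector <[w]>%VS p.
  - exact: ImOZ.
  - by [].
  - apply: contraNN wp => /vlineP [k pk]; apply/vlineP; exists k^-1.
    rewrite pk scalerA mulVf ?scale1r //.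
    by apply: contraNneq p0 => k0; rewrite pk k0 scale0r.
  by exists q; split=> //; apply: qw; exact: memv_line.
(* The factor 1/2 comes from p x (q x w) = - 2 w, as p . q = 1. *)
pose E3 := 2^-1 *: cross q w.
have hE3 : ImO E3 by apply: ImOZ; exact: ImO_cross.
have E3p : cross E3 p = w.
  have := cross_cross hp hq hw.
  rewrite pw cross0r addr0 pw0 qw !scale0r !add0r odotC qp mulr1 => e.
  rewrite crossC // crossZr e scalerA mulrN mulVf ?pnatr_eq0 //.
  by rewrite scaleN1r opprK.
have nE3 : odot E3 E3 = 0.
  rewrite odotZZ crossC // odotNl odotNr opprK null_cross_null ?mulr0 //.
  by rewrite odotC.
have E3p0 : odot E3 p = 0.
  by rewrite odotZl odot_crossl // (crossC hw hp) pw oppr0 odot0r mulr0.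
have qE3 : odot q E3 = 0 by rewrite odotZr odot_cross_self ?mulr0.
have wE3 : odot w E3 = 0 by rewrite -E3p odotC odot_cross_self.
clearbody E3.
have [v [hv [vp vE3] vw]] :
    exists v, [/\ ImO v, odot v p = 0 /\ odot v E3 = 0 & odot v w = 1].
  have [v vP|||v [hv vV vw]] := @dual_vector (<[p]> + <[E3]>)%VS w.
  - have /memv_addP [_ /vlineP [a ->] [_ /vlineP [b ->] ->]] := vP.
    by apply: ImOD; exact: ImOZ.
  - by [].
  - apply/negP => /memv_addP [_ /vlineP [a ->] [_ /vlineP [b ->] wE]].
    have a0 : a = 0.
      have := congr1 (odot q) wE; rewrite qw odotDr !odotZr qp qE3 mulr1 mulr0.
      by rewrite addr0.
    have b0 : b = 0.
      move/eqP: pw; rewrite {1}wE a0 scale0r add0r crossZr crossC // E3p.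
      by rewrite scalerN oppr_eq0 scaler_eq0 (negbTE w0) orbF => /eqP.
    by move: w0; rewrite wE a0 b0 !scale0r addr0 eqxx.
  exists v; split=> //; split; apply: vV.
    exact: (subvP (addvSl _ _) _ (memv_line p)).
  exact: (subvP (addvSr _ _) _ (memv_line E3)).
(* Adding a multiple of w makes v null without changing the products with p, E3, w. *)
pose E2 := 2^-1 *: (v + (- 2^-1 * odot v v) *: w).
have hE2 : ImO E2 by apply: ImOZ; apply: ImOD => //; exact: ImOZ.
have [|||||psi [psi1 psi2 psi3]] := @g2_triple _ p E2 E3 hp hE2 hE3 np _ nE3.
- rewrite odotZZ !(odotDl, odotDr, odotZl, odotZr) nw vw (odotC w) vw.
  by field.
- by rewrite odotZr odotDr odotZr pw0 odotC vp; ring.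
- by rewrite odotZl odotDl odotZl vE3 wE3; ring.
- exact: E3p0.
- rewrite crossC // odotNl odot_crossl // crossC // E3p odotNr opprK.
  by rewrite odotZl odotDl odotZl nw vw; ring.
by exists psi; rewrite g2_f2 psi1 psi3.
Qed.

Lemma orthogonal3 (a1 a2 a3 : R) : exists d1 d2 d3,
  a1 * d1 + a2 * d2 + a3 * d3 = 0 /\ ~ [/\ d1 = 0, d2 = 0 & d3 = 0].
Proof.
have [a20|a20] := eqVneq a2 0; last first.
  by exists a2, (- a1), 0; split; [ring|case=> e; rewrite e eqxx in a20].
exists 0, 1, 0; split; first by rewrite a20; ring.
by case=> _ /eqP; rewrite oner_eq0.
Qed.

(** By flag_trans it suffices to find a vector of Ann(p) off p. One is written down
in Zorn coordinates, by cases on the vanishing of c and of the two vectors a and b.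
*)
Lemma null_trans p : ImO p -> p != 0 -> odot p p = 0 ->
  exists psi, psi (e1 R) = p.
Proof.
move=> hp p0 np.
suff [w [hw pw wp]] : exists w, [/\ ImO w, cross p w = 0 & w \notin <[p]>%VS].
  by have [psi [? _]] := flag_trans hp hw p0 np pw wp; exists psi.
move: hp p0 np => /ImO_zornP [a1 [a2 [a3 [c [b1 [b2 [b3 ->]]]]]]] p0.
rewrite odot_zorn => np.
have {}np : a1 * b1 + a2 * b2 + a3 * b3 = c * c by lra.
have [c0|c0] := eqVneq c 0; last first.
  have [d1 [d2 [d3 [ad dd]]]] := orthogonal3 a1 a2 a3.
  exists (zorn (b3 * d2 - b2 * d3) (b1 * d3 - b3 * d1) (b2 * d1 - b1 * d2) 0
             (c * d1) (c * d2) (c * d3)).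
  split; first exact: ImO_zorn.
    rewrite cross_zorn -zorn0; congr zorn; try ring.
    - by transitivity (- c / 2 * (a1 * d1 + a2 * d2 + a3 * d3)); [field|rewrite ad mulr0].
    - transitivity (d1 * (a1 * b1 + a2 * b2 + a3 * b3) - c * c * d1
         - b1 * (a1 * d1 + a2 * d2 + a3 * d3)); first by ring.
      by rewrite np ad; ring.
    - transitivity (d2 * (a1 * b1 + a2 * b2 + a3 * b3) - c * c * d2
         - b2 * (a1 * d1 + a2 * d2 + a3 * d3)); first by ring.
      by rewrite np ad; ring.
    - transitivity (d3 * (a1 * b1 + a2 * b2 + a3 * b3) - c * c * d3
         - b3 * (a1 * d1 + a2 * d2 + a3 * d3)); first by ring.
      by rewrite np ad; ring.
  apply/negP => /vlineP [k]; rewrite zornZ => /zorn_inj [_ [/esym/eqP]].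
  rewrite mulf_eq0 (negbTE c0) orbF => /eqP -> /eqP + /eqP + /eqP.
  rewrite !mul0r !mulf_eq0 (negbTE c0) /= => /eqP ? /eqP ? /eqP ?.
  by apply: dd.
subst c; rewrite mul0r in np.
have [/andP [/andP [/eqP ? /eqP ?] /eqP ?]|ha] :=
  boolP ((a1 == 0) && (a2 == 0) && (a3 == 0)); last first.
  have [/andP [/andP [/eqP ? /eqP ?] /eqP ?]|hb] :=
    boolP ((b1 == 0) && (b2 == 0) && (b3 == 0)); last first.
    exists (zorn a1 a2 a3 0 0 0 0); split; first exact: ImO_zorn.
      rewrite cross_zorn -zorn0; congr zorn; try ring.
      by transitivity ((a1 * b1 + a2 * b2 + a3 * b3) / 2); [field|rewrite np mul0r].
    apply/negP => /vlineP [k]; rewrite zornZ => /zorn_inj [[A1 A2 A3] [_ B1 B2 B3]].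
    have [k0|k0] := eqVneq k 0.
      by move: ha; rewrite A1 A2 A3 k0 !mul0r eqxx.
    move: hb; have E b : 0 = k * b -> b = 0.
      by move=> /esym/eqP; rewrite mulf_eq0 (negbTE k0) => /eqP.
    by rewrite (E _ B1) (E _ B2) (E _ B3) eqxx.
  subst b1 b2 b3.
  have [d1 [d2 [d3 [ad dd]]]] := orthogonal3 a1 a2 a3.
  exists (zorn 0 0 0 0 d1 d2 d3); split; first exact: ImO_zorn.
    rewrite cross_zorn -zorn0; congr zorn; try ring.
    by transitivity (- (a1 * d1 + a2 * d2 + a3 * d3) / 2); [field|rewrite ad oppr0 mul0r].
  apply/negP => /vlineP [k]; rewrite zornZ => /zorn_inj [_ [_ ? ? ?]].
  by apply: dd; split; lra.
subst a1 a2 a3.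
have [d1 [d2 [d3 [ad dd]]]] := orthogonal3 b1 b2 b3.
exists (zorn d1 d2 d3 0 0 0 0); split; first exact: ImO_zorn.
  rewrite cross_zorn -zorn0; congr zorn; try ring.
  by transitivity ((b1 * d1 + b2 * d2 + b3 * d3) / 2); [field|rewrite ad mul0r].
apply/negP => /vlineP [k]; rewrite zornZ => /zorn_inj [[? ? ?] _].
by apply: dd; split; lra.
Qed.
End Transitivity.

(** * Annihilators of null vectors *)

Section Annihilators.
Variable R : realType.
Implicit Types x y z u v w p : Oct R.
Implicit Type psi : G2' R.

Definition nul p := [/\ ImO p, odot p p = 0 & p != 0].

Lemma g2_invK psi v : psi (g2_inv psi v) = v.
Proof. exact: lker0_lfunVK (g2_ker psi) v. Qed.

Lemma g2_Kinv psi v : g2_inv psi (psi v) = v.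
Proof. exact: lker0_lfunK (g2_ker psi) v. Qed.

Lemma g2_comp psi psi' : exists chi : G2' R, forall x, chi x = psi (psi' x).
Proof.
have bij : bijective (psi \o psi')%VF.
  exists (g2_inv psi' \o g2_inv psi)%VF => x.
    by rewrite !comp_lfunE /= g2_Kinv g2_Kinv.
  by rewrite !comp_lfunE /= g2_invK g2_invK.
have mul x y : (psi \o psi')%VF (omul x y) = omul ((psi \o psi')%VF x) ((psi \o psi')%VF y).
  by rewrite !comp_lfunE /= !g2_mul.
by exists (MkG2' bij mul) => x /=; rewrite comp_lfunE.
Qed.

Lemma g2_neq0 psi v : v != 0 -> psi v != 0.
Proof. by apply: contra_neq => h; apply: (@g2_inj _ psi); rewrite h linear0. Qed.

Lemma nul_g2 psi p : nul p -> nul (psi p).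
Proof.
by move=> [hp np p0]; split; [exact: g2_ImO|rewrite g2_odot|exact: g2_neq0].
Qed.

Lemma nulZ k p : k != 0 -> nul p -> nul (k *: p).
Proof.
move=> k0 [hp np p0]; split; [exact: ImOZ|by rewrite odotZZ np mulr0|].
by rewrite scaler_eq0 negb_or k0.
Qed.

Lemma zorn_neq0 (a1 a2 a3 c b1 b2 b3 : R) :
  zorn a1 a2 a3 c b1 b2 b3 != 0 <->
  ~ ([/\ a1 = 0, a2 = 0 & a3 = 0] /\ [/\ c = 0, b1 = 0, b2 = 0 & b3 = 0]).
Proof.
split=> [/eqP h [[? ? ?] [? ? ? ?]]|h]; first by subst; apply: h; exact: zorn0.
by apply/eqP; rewrite -(zorn0 R) => /zorn_inj.
Qed.

Lemma nul_e1 : nul (e1 R).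
Proof.
split; [exact: ImO_zorn|by rewrite odot_zorn; field|].
by apply/zorn_neq0 => -[[/eqP]]; rewrite oner_eq0.
Qed.

Lemma Ann_e1 v : ImO v -> cross (e1 R) v = 0 ->
  exists x y z : R, v = x *: e1 R + y *: f2 R + z *: f3 R.
Proof.
move=> /ImO_zornP [a1 [a2 [a3 [c [b1 [b2 [b3 ->]]]]]]].
rewrite cross_zorn -zorn0 => /zorn_inj [[A1 A2 A3] [C B1 B2 B3]].
exists a1, b2, b3; rewrite !zornZ !zornD; congr zorn; lra.
Qed.

(** By transitivity, every annihilator looks like Ann(e1) = span(e1, f2, f3). *)
Lemma Ann_frame p : nul p -> exists psi, psi (e1 R) = p /\
  forall v, ImO v -> cross p v = 0 ->
  exists x y z : R, v = x *: p + y *: psi (f2 R) + z *: psi (f3 R).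
Proof.
move=> [hp np p0]; have [psi psi1] := null_trans hp p0 np.
exists psi; split=> // v hv pv.
have [||x [y [z e]]] := @Ann_e1 (g2_inv psi v).
- exact: g2_ImO.
- apply: (@g2_inj _ psi); rewrite linear0 g2_cross ?psi1 ?g2_invK //.
    exact: ImO_zorn.
  exact: g2_ImO.
exists x, y, z; rewrite -psi1 -[LHS](g2_invK psi) e.
by rewrite !linearD !linearZ.
Qed.

Lemma cross_e1f2 : cross (e1 R) (f2 R) = 0.
Proof. by rewrite cross_zorn -zorn0; congr zorn; field. Qed.
Lemma cross_e1f3 : cross (e1 R) (f3 R) = 0.
Proof. by rewrite cross_zorn -zorn0; congr zorn; field. Qed.

Lemma g2_table psi : [/\ cross (psi (e1 R)) (psi (f2 R)) = 0,
  cross (psi (e1 R)) (psi (f3 R)) = 0 &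
  cross (psi (f2 R)) (psi (f3 R)) = psi (e1 R)].
Proof.
rewrite -!g2_cross ?cross_e1f2 ?cross_e1f3 ?cross_f23 ?linear0 //;
  exact: ImO_zorn.
Qed.

Lemma Ann_iso p u v : nul p -> ImO u -> ImO v ->
  cross p u = 0 -> cross p v = 0 -> odot u v = 0.
Proof.
move=> [hp np p0] hu hv pu pv.
have [pu0 nu] := Ann_perp hp hu p0 np pu; have [pv0 nv] := Ann_perp hp hv p0 np pv.
have := cross_cross hu hv hp.
rewrite (crossC hv hp) (crossC hu hp) pu pv oppr0 !cross0r addr0.
rewrite (odotC u p) (odotC v p) pu0 pv0 !scale0r !add0r => /esym/eqP.
rewrite scaler_eq0 (negbTE p0) orbF oppr_eq0 mulf_eq0 pnatr_eq0 /=.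
by move/eqP.
Qed.

(** On Ann(p) / p the cross product is an area form with values in the line of p;
this is what makes linear independence modulo p an equation. *)
Lemma Ann_cross p u v : nul p -> ImO u -> ImO v ->
  cross p u = 0 -> cross p v = 0 -> exists m, cross u v = m *: p.
Proof.
move=> np hu hv pu pv; have [psi [psi1 F]] := Ann_frame np.
have [x [y [z ->]]] := F u hu pu; have [x' [y' [z' ->]]] := F v hv pv.
exists (y * z' - z * y'); have [t1 t2 t3] := g2_table psi.
rewrite -psi1 !(crossDl, crossDr, crossZl, crossZr) t1 t2 t3.
have hp : ImO (psi (e1 R)) by apply: g2_ImO; exact: ImO_zorn.
have h2 : ImO (psi (f2 R)) by apply: g2_ImO; exact: ImO_zorn.
have h3 : ImO (psi (f3 R)) by apply: g2_ImO; exact: ImO_zorn.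
rewrite !crossxx // (crossC h2 hp) (crossC h3 hp) (crossC h3 h2) t1 t2 t3.
by move: (psi _) => P; apply: linear_ext => L LD LZ LN L0; rewrite !(LD, LZ, LN, L0); ring.
Qed.

(** Cramer's rule for the area form of Ann(p) / p. *)
Lemma Ann_span p u v w m : nul p -> ImO u -> ImO v -> ImO w ->
  cross p u = 0 -> cross p v = 0 -> cross p w = 0 ->
  cross u v = m *: p -> m != 0 ->
  exists x y z : R, w = x *: p + y *: u + z *: v.
Proof.
move=> np hu hv hw pu pv pw uv m0; have [psi [psi1 F]] := Ann_frame np.
have [t1 t2 t3] := g2_table psi; have [hp npp p0] := np.
have h2 : ImO (psi (f2 R)) by apply: g2_ImO; exact: ImO_zorn.
have h3 : ImO (psi (f3 R)) by apply: g2_ImO; exact: ImO_zorn.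
have [a [b [c E]]] := F u hu pu; have [a' [b' [c' E']]] := F v hv pv.
have [a'' [b'' [c'' E'']]] := F w hw pw.
have d : b * c' - c * b' = m.
  move: uv; rewrite E E' !(crossDl, crossDr, crossZl, crossZr).
  rewrite -psi1 !crossxx // ?psi1 // (crossC h2 hp) (crossC h3 hp) (crossC h3 h2) -psi1.
  rewrite t1 t2 t3 psi1 => /eqP; rewrite -subr_eq0 => /eqP e.
  have {}e : (b * c' - c * b' - m) *: p = 0.
    by rewrite -e; apply: linear_ext => L LD LZ LN L0; rewrite !(LD, LZ, LN, L0); ring.
  move/eqP: e; rewrite scaler_eq0 (negbTE p0) orbF subr_eq0.
  by move/eqP.
exists (a'' - (b'' * c' - c'' * b') / m * a - (c'' * b - b'' * c) / m * a'),
  ((b'' * c' - c'' * b') / m), ((c'' * b - b'' * c) / m).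
rewrite E E' E'' -d; have {}m0 : b * c' - c * b' != 0 by rewrite d.
move: (psi (f2 R)) (psi (f3 R)) => G H.
by apply: linear_ext => L LD LZ LN L0; rewrite !(LD, LZ, LN, L0); field.
Qed.

(** A line through p in Ann(p) has zero area. *)
Lemma cross_span0 p u v (a b c a' b' c' : R) : ImO p -> ImO u -> ImO v ->
  cross p u = 0 -> cross p v = 0 -> cross u v = 0 ->
  cross (a *: p + b *: u + c *: v) (a' *: p + b' *: u + c' *: v) = 0.
Proof.
move=> hp hu hv pu pv uv.
rewrite !crossDl !crossDr !crossZl !crossZr (crossC hu hp) (crossC hv hp) (crossC hv hu).
by rewrite pu pv uv !crossxx // !oppr0 !scaler0 !addr0.
Qed.

(** No triangles in the incidence geometry: at p = e1, v = f2 the third coordinate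
of w in Ann(e1) is read off from f2 x f3 = e1. *)
Lemma collinear_triangle p v w : nul p -> ImO v -> ImO w -> cross p v = 0 ->
  cross p w = 0 -> cross v w = 0 -> v \notin <[p]>%VS ->
  exists x y : R, w = x *: p + y *: v.
Proof.
move=> np hv hw pv pw vw vp; have [hp npp p0] := np.
have [psi [psi1 psi2]] := flag_trans hp hv p0 npp pv vp.
have [||x [y [z e]]] := @Ann_e1 (g2_inv psi w).
- exact: g2_ImO.
- apply: (@g2_inj _ psi); rewrite linear0 g2_cross ?psi1 ?g2_invK //.
    exact: ImO_zorn.
  exact: g2_ImO.
have E : w = x *: p + y *: v + z *: psi (f3 R).
  by rewrite -psi1 -psi2 -[LHS](g2_invK psi) e !linearD !linearZ.
exists x, y; suff z0 : z = 0 by rewrite E z0 scale0r addr0.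
have [t1 t2 t3] := g2_table psi.
move: vw; rewrite E !(crossDr, crossZr) crossxx // (crossC hv hp) pv oppr0.
rewrite !scaler0 !add0r -psi2 t3 psi1 => /eqP.
by rewrite scaler_eq0 (negbTE p0) orbF => /eqP.
Qed.

(** Ann(p) is a maximal totally isotropic subspace, and a null vector orthogonal to
it lies in it. *)
Lemma perp_Ann p z : nul p -> ImO z -> odot z z = 0 ->
  (forall v, ImO v -> cross p v = 0 -> odot z v = 0) -> cross p z = 0.
Proof.
move=> np hz nz zA; have [psi [psi1 _]] := Ann_frame np.
have hz' := @g2_ImO _ (g2_inv psi) _ hz.
have [a1 [a2 [a3 [c [b1 [b2 [b3 E]]]]]]] := ImO_zornP hz'.
have Ez : z = psi (zorn a1 a2 a3 c b1 b2 b3) by rewrite -E g2_invK.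
have [t1 t2 t3] := g2_table psi.
have [hp _ _] := np.
have h2 : ImO (psi (f2 R)) by apply: g2_ImO; exact: ImO_zorn.
have h3 : ImO (psi (f3 R)) by apply: g2_ImO; exact: ImO_zorn.
have := zA p hp (crossxx hp); have := zA _ h2; have := zA _ h3.
rewrite -psi1 t1 t2 Ez !g2_odot; try exact: ImO_zorn.
move=> /(_ erefl); rewrite odot_zorn => o3 /(_ erefl); rewrite odot_zorn => o2.
rewrite odot_zorn => o1.
move: nz; rewrite Ez g2_odot ?odot_zorn; try exact: ImO_zorn.
move=> nz; have b10 : b1 = 0 by lra. have a20 : a2 = 0 by lra.
have a30 : a3 = 0 by lra.
have c0 : c = 0.
  move: nz; rewrite b10 a20 a30 => nz; apply/eqP; rewrite -sqrf_eq0 expr2.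
  by apply/eqP; lra.
rewrite -g2_cross; try exact: ImO_zorn.
rewrite -[RHS](linear0 psi) -zorn0 cross_zorn b10 a20 a30 c0; congr (psi _).
by congr zorn; field.
Qed.

Lemma common_neighbor u v : nul u -> nul v -> odot u v = 0 -> cross u v != 0 ->
  [/\ nul (cross u v), cross u (cross u v) = 0 & cross v (cross u v) = 0].
Proof.
move=> [hu nu u0] [hv nv v0] uv c0; split.
- by split=> //; [exact: ImO_cross|exact: null_cross_null].
- by rewrite null_cross // uv scale0r.
- by rewrite (crossC hu hv) crossNr null_cross // odotC uv scale0r oppr0.
Qed.

(** If w annihilates u and v it annihilates u x v; were w not proportional to u x v,
both u and v would lie on the line of u x v and w, and their product would vanish.
*)
Lemma common_neighbor_uniq u v w : nul u -> nul v -> nul w -> odot u v = 0 ->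
  cross u v != 0 -> cross w u = 0 -> cross w v = 0 -> w \in <[cross u v]>%VS.
Proof.
move=> nu nv nw uv c0 wu wv.
have [nc uc vc] := common_neighbor nu nv uv c0.
have [hu _ u0] := nu; have [hv _ v0] := nv; have [hw nww w0] := nw.
have [wu0 _] := Ann_perp hw hu w0 nww wu; have [wv0 _] := Ann_perp hw hv w0 nww wv.
have hc := ImO_cross u v.
have wc : cross w (cross u v) = 0.
  have := cross_cross hw hu hv.
  by rewrite wv cross0r addr0 wu0 wv0 uv mulr0 oppr0 !scale0r !addr0.
apply/negPn/negP => wl.
have cw : cross (cross u v) w = 0 by rewrite crossC // wc oppr0.
have [|x [y Eu]] := collinear_triangle nc hw hu cw _ wu wl; first by rewrite crossC // uc oppr0.
have [|x' [y' Ev]] := collinear_triangle nc hw hv cw _ wv wl; first by rewrite crossC // vc oppr0.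
move/eqP: c0; apply.
have -> : cross u v = cross (x *: cross u v + y *: w) (x' *: cross u v + y' *: w).
  by rewrite -Eu -Ev.
move: (cross u v) cw wc hc => c cw wc hc.
rewrite !(crossDl, crossDr, crossZl, crossZr) cw wc !crossxx // !scaler0.
by rewrite !addr0 !scaler0 addr0.
Qed.

End Annihilators.

(** * The incidence distance *)

Section Incidence.
Variable R : realType.
Implicit Types u v w p : Oct R.
Implicit Types x y z : Ein R.
Implicit Type psi : G2' R.

Lemma nul_rep x : nul (rep x).
Proof.
have [lx x0] := rep_line x; have /andP[_ /asboolP ex] := valP x.
by have [] := ex (rep x) (memv_pick _).
Qed.

Lemma line_rep x : line x = <[rep x]>%VS.
Proof. by have [] := rep_line x. Qed.

Lemma nul_in x u : u \in line x -> u != 0 -> nul u.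
Proof. by move=> ux u0; have [c c0 ->] := lineP ux u0; exact/nulZ/nul_rep. Qed.

Lemma line_of x u : u \in line x -> u != 0 -> line x = <[u]>%VS.
Proof.
move=> ux u0; apply/esym/eqP; rewrite eqEdim -memvE ux dim_vline u0 /=.
by have /andP[/eqP ->] := valP x.
Qed.

Lemma ex_pt u : nul u -> {x | line x = <[u]>%VS}.
Proof.
move=> [hu nu u0].
suff H : is_ein <[u]>%VS by exists (exist (fun L => is_ein L) _ H).
rewrite /is_ein dim_vline u0 eqxx /=; apply/asboolP => _ /vlineP [k ->].
by split; [exact: ImOZ|rewrite odotZZ nu mulr0].
Qed.

Lemma line_inj x y : line x = line y -> x = y.
Proof. by move=> e; apply: val_inj. Qed.

Lemma Ein_eq x y : rep y \in <[rep x]>%VS -> y = x.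
Proof.
move=> /vlineP [k e]; apply: line_inj; rewrite !line_rep e.
have [_ y0] := rep_line y.
apply/eqP; rewrite eqEdim -memvE memvZ ?memv_line //= !dim_vline.
by rewrite -e y0; case: (_ != 0).
Qed.

Lemma d3_eq0 x y : (d3 x y == 0%N) = (x == y).
Proof. by rewrite /d3; case: (eqVneq x y) => // _; case: ifP => // _; case: ifP. Qed.

Lemma d3xx x : d3 x x = 0%N.
Proof. by apply/eqP; rewrite d3_eq0. Qed.

(** The values of d3 are handled through the level sets d3 <= 1 and d3 <= 2, which
are plain equations between representatives. *)
Lemma d3_le1 x y : (d3 x y <= 1)%N = (cross (rep x) (rep y) == 0).
Proof.
rewrite /d3; case: (eqVneq x y) => [->|_].
  by have [h _ _] := nul_rep y; rewrite crossxx // eqxx.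
by case: ifP => // _; case: ifP.
Qed.

Lemma d3_le2 x y : (d3 x y <= 2)%N = (odot (rep x) (rep y) == 0).
Proof.
have [hx nx x0] := nul_rep x; have [hy ny y0] := nul_rep y.
rewrite /d3; case: (eqVneq x y) => [->|_]; first by rewrite ny eqxx.
case: ifP => [/eqP c|_]; last by case: ifP.
by have [-> _] := Ann_perp hx hy x0 nx c; rewrite eqxx.
Qed.

Lemma d3_le3 x y : (d3 x y <= 3)%N.
Proof. by rewrite /d3; case: ifP => // _; case: ifP => // _; case: ifP. Qed.

Lemma d3C x y : d3 x y = d3 y x.
Proof.
have [hx nx x0] := nul_rep x; have [hy ny y0] := nul_rep y.
by rewrite /d3 eq_sym (crossC hx hy) oppr_eq0 odotC.
Qed.

Lemma d3_pt u v x y : nul u -> nul v -> line x = <[u]>%VS -> line y = <[v]>%VS ->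
  ((d3 x y <= 1)%N = (cross u v == 0)) * ((d3 x y <= 2)%N = (odot u v == 0)).
Proof.
move=> [hu nu u0] [hv nv v0] lx ly.
have ux : u \in line x by rewrite lx memv_line.
have vy : v \in line y by rewrite ly memv_line.
have [c c0 ec] := lineP ux u0; have [d dn0 ed] := lineP vy v0.
rewrite d3_le1 d3_le2 ec ed crossZZ odotZZ scaler_eq0 !mulf_eq0.
by rewrite (negbTE c0) (negbTE dn0).
Qed.

Lemma rep_pt u x : nul u -> line x = <[u]>%VS -> exists2 k, k != 0 & u = k *: rep x.
Proof. by move=> [_ _ u0] lx; apply: lineP => //; rewrite lx memv_line. Qed.

Lemma d3_eq_levels x y x' y' : (d3 x' y' == 0%N) = (d3 x y == 0%N) ->
  (d3 x' y' <= 1)%N = (d3 x y <= 1)%N -> (d3 x' y' <= 2)%N = (d3 x y <= 2)%N ->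
  d3 x' y' = d3 x y.
Proof.
move: (d3_le3 x' y') (d3_le3 x y).
by case: (d3 x y) => [|[|[|[|//]]]]; case: (d3 x' y') => [|[|[|[|//]]]].
Qed.

(** Two orthogonal points are adjacent or have the common neighbor [u x v]. *)
Lemma d3_le2_path x y : (d3 x y <= 2)%N <-> exists z, (d3 x z <= 1)%N /\ (d3 z y <= 1)%N.
Proof.
have nx := nul_rep x; have ny := nul_rep y.
have [hx _ _] := nx; have [hy _ _] := ny.
split=> [|[z [xz zy]]]; last first.
  have nz := nul_rep z; have [hz _ _] := nz.
  move: xz zy; rewrite d3C !d3_le1 d3_le2 => /eqP zx /eqP zy.
  by rewrite (Ann_iso nz hx hy zx zy).
rewrite d3_le2 => /eqP o.
have [c|c] := eqVneq (cross (rep x) (rep y)) 0.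
  by exists y; rewrite d3xx d3_le1 c eqxx.
have [nc xc yc] := common_neighbor nx ny o c.
have [z lz] := ex_pt nc.
exists z; rewrite (d3C z) (d3_pt nx nc (line_rep x) lz) (d3_pt ny nc (line_rep y) lz).
by rewrite xc yc eqxx.
Qed.

(** The projective form of collinear_triangle. *)
Lemma d3_triangle x y z : d3 x y = 1%N -> (d3 x z <= 1)%N -> (d3 y z <= 1)%N ->
  exists a b : R, rep z = a *: rep x + b *: rep y.
Proof.
move=> xy; have nx := nul_rep x; have ny := nul_rep y; have nz := nul_rep z.
have [hx _ _] := nx; have [hy _ _] := ny; have [hz _ _] := nz.
rewrite !d3_le1 => /eqP xz /eqP yz.
have /eqP xy0 : cross (rep x) (rep y) == 0 by rewrite -d3_le1 xy.
apply: collinear_triangle => //; apply/negP => /Ein_eq e.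
by move: xy; rewrite e d3xx.
Qed.

(** An annihilator line is the set of points adjacent to two of its points; this
describes lines by distances only. *)
Lemma ann_lineE x y z : d3 x y = 1%N ->
  ann_line x y z <-> (d3 x z <= 1)%N /\ (d3 y z <= 1)%N.
Proof.
move=> xy; split.
  rewrite /ann_line /= !line_rep => h.
  have [hx _ _] := nul_rep x; have [hy _ _] := nul_rep y.
  have /eqP xy0 : cross (rep x) (rep y) == 0 by rewrite -d3_le1 xy.
  have : rep z \in (<[rep x]> + <[rep y]>)%VS by apply: (subvP h); exact: memv_line.
  move=> /memv_addP [_ /vlineP [a ->] [_ /vlineP [b ->] e]].
  rewrite !d3_le1 e !crossDr !crossZr xy0 (crossC hy hx) xy0.
  by rewrite !crossxx // oppr0 !scaler0 addr0 eqxx.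
move=> [xz yz]; have [a [b e]] := d3_triangle xy xz yz.
rewrite /ann_line /= !line_rep e -memvE.
by apply: memv_add; apply: memvZ; exact: memv_line.
Qed.

Lemma PAnnE x y : PAnn x y <-> (d3 x y <= 1)%N.
Proof.
have [hx _ _] := nul_rep x; have [hy _ _] := nul_rep y.
rewrite d3_le1; split=> [h|/eqP xy v].
  have /h [_ /= e] : rep y \in line y by rewrite line_rep memv_line.
  by rewrite e.
rewrite line_rep => /vlineP [k ->]; split; first exact: ImOZ.
by rewrite /= crossZr xy scaler0.
Qed.

Section Isometries.
Variable phi : Ein R -> Ein R.
Hypothesis phi_inj : injective phi.

(** The point is that opposite points must not become orthogonal. Take opposite x
and y, a neighbor w of y orthogonal to x, and the common neighbor z of x and w, so
that x, z, w, y is a path with d3 x w = d3 z y = 2. If the image of x were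
orthogonal to the image of y, it would be orthogonal to the whole annihilator of the
image of w, hence adjacent to the image of w, against d3 x w = 2. *)
Lemma iso_of_12 : (forall x y, d3 x y = 1%N -> d3 (phi x) (phi y) = 1%N) ->
  (forall x y, d3 x y = 2%N -> d3 (phi x) (phi y) = 2%N) -> d3_isometry phi.
Proof.
move=> P1 P2 x y.
case: (ltngtP (d3 x y) 3) => [|| d3xy].
- case E: (d3 x y) => [|[|[|//]]] _; [|exact: P1|exact: P2].
  by move/eqP: E; rewrite d3_eq0 => /eqP ->; rewrite d3xx.
- by rewrite ltnNge d3_le3.
have nx := nul_rep x; have ny := nul_rep y.
have [hx _ _] := nx; have [hy nny y0] := ny.
have oxy : odot (rep x) (rep y) != 0 by rewrite -d3_le2 d3xy.
(* Ann(y) / y is 2-dimensional, so some direction in it is orthogonal to x. *)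
have [w [hw xw yw w0]] : exists w,
    [/\ ImO w, odot (rep x) w = 0, cross (rep y) w = 0 & w != 0].
  have [psi [psi1 _]] := Ann_frame ny; have [t1 t2 t3] := g2_table psi.
  have h2 : ImO (psi (f2 R)) by apply: g2_ImO; exact: ImO_zorn.
  have h3 : ImO (psi (f3 R)) by apply: g2_ImO; exact: ImO_zorn.
  have [oz|oz] := eqVneq (odot (rep x) (psi (f2 R))) 0.
    exists (psi (f2 R)); split=> //; first by rewrite -psi1.
    by apply/eqP => e; move/eqP: y0; apply; rewrite -psi1 -t3 e cross0l.
  exists (psi (f3 R) - (odot (rep x) (psi (f3 R)) / odot (rep x) (psi (f2 R))) *: psi (f2 R)).
  split.
  - by apply: ImOB => //; exact: ImOZ.
  - by rewrite odotDr odotNr odotZr divfK ?subrr.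
  - by rewrite crossDr crossNr crossZr -psi1 t1 t2 scaler0 subr0.
  - apply/eqP => /eqP; rewrite subr_eq0 => /eqP e; move/eqP: y0; apply.
    by rewrite -psi1 -t3 e crossZr crossxx // scaler0.
have [_ nnw] := Ann_perp hy hw y0 nny yw.
have nw : nul w by split.
have [W lW] := ex_pt nw.
have yW : d3 y W = 1%N.
  apply/eqP; rewrite eqn_leq (d3_pt ny nw (line_rep y) lW) yw eqxx /=.
  rewrite lt0n d3_eq0; apply/eqP => e; move/eqP: oxy; apply.
  have [k k0 wk] := rep_pt nw lW; move: xw; rewrite wk -e odotZr => /eqP.
  by rewrite mulf_eq0 (negbTE k0) => /eqP.
have xWle : (d3 x W <= 2)%N by rewrite (d3_pt nx nw (line_rep x) lW) xw.
have xW : d3 x W = 2%N.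
  apply/eqP; rewrite eqn_leq xWle ltnNge; apply/negP => le1.
  have : (d3 x y <= 2)%N by apply/d3_le2_path; exists W; rewrite (d3C W y) yW.
  by rewrite d3xy.
have /d3_le2_path [Z [xZ ZW]] := xWle.
have xZ1 : d3 x Z = 1%N.
  apply/eqP; rewrite eqn_leq xZ lt0n d3_eq0; apply/eqP => e.
  by move: ZW; rewrite -e xW.
have ZW1 : d3 Z W = 1%N.
  apply/eqP; rewrite eqn_leq ZW lt0n d3_eq0; apply/eqP => e.
  by move: xZ; rewrite e xW.
have Zy : d3 Z y = 2%N.
  apply/eqP; rewrite eqn_leq; apply/andP; split.
    by apply/d3_le2_path; exists W; rewrite ZW (d3C W y) yW.
  rewrite ltnNge; apply/negP => le1.
  have yZ1 : (d3 y Z <= 1)%N by rewrite d3C.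
  have WZ1 : (d3 W Z <= 1)%N by rewrite d3C.
  have [a [b e]] := d3_triangle yW yZ1 WZ1.
  have /eqP xZ0 : odot (rep x) (rep Z) == 0 by rewrite -d3_le2 xZ1.
  have /eqP xW0 : odot (rep x) (rep W) == 0 by rewrite -d3_le2 xW.
  have a0 : a = 0.
    move: xZ0; rewrite e odotDr !odotZr xW0 mulr0 addr0 => /eqP.
    by rewrite mulf_eq0 (negbTE oxy) orbF => /eqP.
  suff : Z = W by move=> ZeW; move: xZ; rewrite ZeW xW.
  by apply: Ein_eq; rewrite e a0 scale0r add0r memvZ // memv_line.
apply/eqP; rewrite d3xy eqn_leq d3_le3 ltnNge d3_le2; apply/negP => /eqP o.
have := P1 _ _ xZ1; have := P1 _ _ ZW1; have := P1 _ _ yW.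
have := P2 _ _ xW; have := P2 _ _ Zy.
clear -o.
move: (phi x) (phi y) (phi Z) (phi W) o => {}x {}y {}Z {}W.
have nx' := nul_rep x; have ny' := nul_rep y.
have nZ' := nul_rep Z; have nW' := nul_rep W.
have [hx' nnx' _] := nx'; have [hy' _ _] := ny'; have [hZ' _ _] := nZ'.
have [hW' _ _] := nW'.
move=> o Zy2 xW2 yW1 ZW1' xZ1'.
have /eqP WZ : cross (rep W) (rep Z) == 0 by rewrite -d3_le1 d3C ZW1'.
have /eqP Wy : cross (rep W) (rep y) == 0 by rewrite -d3_le1 d3C yW1.
have /eqP xZo : odot (rep x) (rep Z) == 0 by rewrite -d3_le2 xZ1'.
have /eqP xWo : odot (rep x) (rep W) == 0 by rewrite -d3_le2 xW2.
have Zyc : cross (rep Z) (rep y) != 0 by rewrite -d3_le1 Zy2.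
have [m em] := Ann_cross nW' hZ' hy' WZ Wy.
have m0 : m != 0 by apply: contraNneq Zyc => m0; rewrite em m0 scale0r.
have : cross (rep W) (rep x) == 0; last by rewrite -d3_le1 d3C xW2.
apply/eqP/perp_Ann => // v hv Wv.
have [a [b [c ->]]] := Ann_span nW' hZ' hy' hv WZ Wy Wv em m0.
by rewrite !odotDr !odotZr xZo xWo o; ring.
Qed.

(** Suppose x and y at distance 2 had adjacent images, and let z be the common
neighbor. By collinear_triangle the image of y lies on the line of the images of z
and x, which is the image of the line of z and x; injectivity puts y on that line.
*)
Lemma lines_iso : preserves_ann_lines phi -> d3_isometry phi.
Proof.
move=> L; apply: iso_of_12 => x y; first by move=> /L [].
move=> xy; have /d3_le2_path [z [xz zy]] : (d3 x y <= 2)%N by rewrite xy.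
have zx1 : d3 z x = 1%N.
  rewrite d3C; apply/eqP; rewrite eqn_leq xz lt0n d3_eq0; apply/eqP => e.
  by move: zy; rewrite -e xy.
have zy1 : d3 z y = 1%N.
  apply/eqP; rewrite eqn_leq zy lt0n d3_eq0; apply/eqP => e.
  by move: xz; rewrite e xy.
have [zx1' Lzx] := L _ _ zx1; have [zy1' _] := L _ _ zy1.
apply/eqP; rewrite eqn_leq; apply/andP; split.
  by apply/d3_le2_path; exists (phi z); rewrite d3C zx1' zy1'.
rewrite ltnNge; apply/negP => le1.
have : ann_line (phi z) (phi x) (phi y) by apply/ann_lineE; rewrite ?zy1'.
rewrite -Lzx => -[y' Ly' /phi_inj e]; move: Ly'; rewrite e.
by move=> /ann_lineE - /(_ zx1) [_]; rewrite xy.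
Qed.

Hypothesis phi_surj : forall y, exists x, phi x = y.

(** The sets PAnn encode d3 <= 1, and d3_le2_path expresses d3 <= 2 by them. *)
Lemma PAnn_iso : preserves_PAnn phi -> d3_isometry phi.
Proof.
move=> P.
have L1 x y : (d3 (phi x) (phi y) <= 1)%N = (d3 x y <= 1)%N.
  apply/idP/idP => /PAnnE.
    by rewrite -P => -[y' + /phi_inj <-]; move/PAnnE.
  by move=> xy; apply/PAnnE; rewrite -P; exists y.
move=> x y; apply: d3_eq_levels => //.
  by rewrite !d3_eq0 (inj_eq phi_inj).
apply/idP/idP => /d3_le2_path [z [xz zy]]; apply/d3_le2_path.
  by have [z' e] := phi_surj z; exists z'; rewrite -(L1 x) -(L1 z') e.
by exists (phi z); rewrite !L1.
Qed.

Lemma iso_PAnn : d3_isometry phi -> preserves_PAnn phi.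
Proof.
move=> I x; apply/seteqP; split=> y; last first.
  have [y' <-] := phi_surj y => /PAnnE; rewrite I => ?.
  by exists y' => //; apply/PAnnE.
by move=> [y' /PAnnE h <-]; apply/PAnnE; rewrite I.
Qed.

Lemma iso_lines : d3_isometry phi -> preserves_ann_lines phi.
Proof.
move=> I x y xy; have xy' : d3 (phi x) (phi y) = 1%N by rewrite I.
split=> //; apply/seteqP; split=> z; last first.
  have [z' <-] := phi_surj z => /(ann_lineE _ xy'); rewrite !I => h.
  by exists z' => //; apply/ann_lineE.
by move=> [z' /(ann_lineE _ xy) h <-]; apply/ann_lineE => //; rewrite !I.
Qed.

End Isometries.

Lemma g2_act_d3 psi : d3_isometry (g2_act psi).
Proof.
move=> x y.
have nx := nul_rep x; have ny := nul_rep y.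
have [hx _ _] := nx; have [hy _ _] := ny.
have L z : line (g2_act psi z) = <[psi (rep z)]>%VS.
  by rewrite /line /= line_rep limg_line.
have P := d3_pt (nul_g2 psi nx) (nul_g2 psi ny) (L x) (L y).
apply: d3_eq_levels.
- rewrite !d3_eq0; apply/eqP/eqP => [e|-> //].
  apply: line_inj; have := congr1 (@line R) e; rewrite /line /= => /(congr1 (fun V => (g2_inv psi @: V)%VS)).
  by rewrite -!limg_comp lker0_compVf ?g2_ker // !lim1g.
- rewrite P d3_le1 -g2_cross //.
  by rewrite -{1}(linear0 psi) (inj_eq (@g2_inj _ psi)).
- by rewrite P d3_le2 g2_odot.
Qed.

End Incidence.

(** * Incidence-preserving maps on a pair of dual planes *)

Section DualPlanes.
Variable R : realType.
Implicit Types u v w p : Oct R.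
Implicit Type psi : G2' R.

(** The squares are the nonnegative reals, so the map is increasing; it fixes the
rationals, which are dense. *)
Lemma rmorph_real_id (s : R -> R) : s 1 = 1 ->
  (forall x y, s (x + y) = s x + s y) -> (forall x y, s (x * y) = s x * s y) ->
  forall x, s x = x.
Proof.
move=> s1 sD sM.
have s0 : s 0 = 0 by apply: (addrI (s 0)); rewrite -sD !addr0.
have sB : zmod_morphism s.
  move=> x y; apply: (addIr (s y)); rewrite subrK -sD subrK.
  by [].
have sMul : monoid_morphism s by split.
pose sr : {rmorphism R -> R} := HB.pack s
  (GRing.isZmodMorphism.Build _ _ s sB) (GRing.isMonoidMorphism.Build _ _ s sMul).
have sq q : s (ratr q) = ratr q by exact: (fmorph_rat sr).
have mono x y : x <= y -> s x <= s y.
  move=> xy; rewrite -subr_ge0 -sB -[y - x]sqr_sqrtr ?subr_ge0 // expr2 sM -expr2.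
  exact: sqr_ge0.
move=> x; apply/eqP; rewrite eq_le; apply/andP; split; rewrite leNgt; apply/negP.
  move=> /rat_in_itvoo [q]; rewrite in_itv /= => /andP [xq qs].
  by have := mono _ _ (ltW xq); rewrite sq leNgt qs.
move=> /rat_in_itvoo [q]; rewrite in_itv /= => /andP [sq' qx].
by have := mono _ _ (ltW qx); rewrite sq leNgt sq'.
Qed.

(** The two dual isotropic 3-spaces spanned by e1, e2, e3 and by f1, f2, f3. *)
Definition va (a1 a2 a3 : R) : Oct R := zorn a1 a2 a3 0 0 0 0.
Definition vb (b1 b2 b3 : R) : Oct R := zorn 0 0 0 0 b1 b2 b3.

Lemma odot_vab a1 a2 a3 b1 b2 b3 :
  odot (va a1 a2 a3) (vb b1 b2 b3) = (a1 * b1 + a2 * b2 + a3 * b3) / 2.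
Proof. by rewrite odot_zorn; field. Qed.

Lemma nul_va a1 a2 a3 : nul (va a1 a2 a3) <-> ~ [/\ a1 = 0, a2 = 0 & a3 = 0].
Proof.
split=> [[_ _ /zorn_neq0 h] e|h]; first by apply: h; split.
by split; [exact: ImO_zorn|rewrite odot_zorn; field|apply/zorn_neq0 => -[e _]; exact: h].
Qed.

Lemma nul_vb b1 b2 b3 : nul (vb b1 b2 b3) <-> ~ [/\ b1 = 0, b2 = 0 & b3 = 0].
Proof.
split=> [[_ _ /zorn_neq0 h] [? ? ?]|h]; first by apply: h; do 2!split.
by split; [exact: ImO_zorn|rewrite odot_zorn; field|apply/zorn_neq0 => -[_ [_ ? ? ?]]; exact: h].
Qed.

(** An isometry of the incidence geometry, as a map on null vectors that is only
meaningful up to scalars. *)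
Definition hexmap (G : Oct R -> Oct R) :=
  [/\ forall u, nul u -> nul (G u),
      forall u v, nul u -> nul v -> (odot (G u) (G v) = 0 <-> odot u v = 0),
      forall u v, nul u -> nul v -> (cross (G u) (G v) = 0 <-> cross u v = 0) &
      forall k u, k != 0 -> nul u -> exists c, G (k *: u) = c *: G u].

Definition fixes (G : Oct R -> Oct R) u := exists k, G u = k *: u.

Section Frame.
Variable G : Oct R -> Oct R.
Hypothesis hG : hexmap G.

Let Gn u : nul u -> nul (G u). Proof. by case: hG => + _ _ _; apply. Qed.
Let Go u v : nul u -> nul v -> (odot (G u) (G v) = 0 <-> odot u v = 0).
Proof. by case: hG => _ + _ _; apply. Qed.
Let Gc u v : nul u -> nul v -> (cross (G u) (G v) = 0 <-> cross u v = 0).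
Proof. by case: hG => _ _ + _; apply. Qed.

Lemma fixesZ k u : k != 0 -> nul u -> fixes G u -> fixes G (k *: u).
Proof.
move=> k0 nu [l e]; case: hG => _ _ _ /(_ _ _ k0 nu) [c E].
by exists (c * l / k); rewrite E e !scalerA mulfVK.
Qed.

Lemma fixes_neq0 u : nul u -> fixes G u -> exists2 k, k != 0 & G u = k *: u.
Proof.
move=> nu [k e]; exists k => //; have [_ _] := Gn nu.
by apply: contraNneq => k0; rewrite e k0 scale0r.
Qed.

Lemma G_odot u v : nul u -> nul v -> fixes G v ->
  odot (G u) v = 0 <-> odot u v = 0.
Proof.
move=> nu nv /(fixes_neq0 nv) [k k0 e].
rewrite -(Go nu nv) e odotZr; split=> [->|/eqP]; first by rewrite mulr0.
by rewrite mulf_eq0 (negbTE k0) => /eqP.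
Qed.

(** The neighbor u x v of two fixed points is the only common neighbor, so it is
fixed. *)
Lemma fixes_nbr u v w k : nul u -> nul v -> nul w -> fixes G u -> fixes G v ->
  odot u v = 0 -> k != 0 -> cross u v = k *: w -> fixes G w.
Proof.
move=> nu nv nw fu fv uv k0 E.
have c0 : cross u v != 0.
  by rewrite E scaler_eq0 negb_or k0; have [] := nw.
have [nc uc vc] := common_neighbor nu nv uv c0.
have [hu _ _] := nu; have [hv _ _] := nv; have [hw _ _] := nw.
have K x : ImO x -> nul x -> fixes G x -> cross x (cross u v) = 0 -> cross (G w) x = 0.
  move=> hx nx /(fixes_neq0 nx) [l l0 e] xc.
  have : cross (G w) (G x) = 0.
    apply/Gc => //; rewrite crossC //; apply/eqP; rewrite oppr_eq0.
    by move/eqP: xc; rewrite E crossZr scaler_eq0 (negbTE k0).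
  by rewrite e crossZr => /eqP; rewrite scaler_eq0 (negbTE l0) => /eqP.
have := common_neighbor_uniq nu nv (Gn nw) uv c0 (K _ hu nu fu uc) (K _ hv nv fv vc).
by rewrite E => /vlineP [l e]; exists (l * k); rewrite e scalerA.
Qed.

Section Plane.
Hypotheses (G1 : fixes G (e1 R)) (G2 : fixes G (e2 R)) (G3 : fixes G (e3 R)).
Hypothesis Gs : fixes G (va 1 1 1).

Let n1 : nul (e1 R). Proof. by apply/nul_va => -[/eqP]; rewrite oner_eq0. Qed.
Let n2 : nul (e2 R). Proof. by apply/nul_va => -[_ /eqP]; rewrite oner_eq0. Qed.
Let n3 : nul (e3 R). Proof. by apply/nul_va => -[_ _ /eqP]; rewrite oner_eq0. Qed.
Let m1 : nul (f1 R). Proof. by apply/nul_vb => -[/eqP]; rewrite oner_eq0. Qed.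
Let m2 : nul (f2 R). Proof. by apply/nul_vb => -[_ /eqP]; rewrite oner_eq0. Qed.
Let m3 : nul (f3 R). Proof. by apply/nul_vb => -[_ _ /eqP]; rewrite oner_eq0. Qed.

Let F3 : fixes G (f3 R).
Proof.
apply: (@fixes_nbr (e1 R) (e2 R) _ 1) => //; rewrite ?oner_eq0 ?scale1r ?cross_e12 //.
by rewrite odot_zorn; field.
Qed.
Let F1 : fixes G (f1 R).
Proof.
apply: (@fixes_nbr (e2 R) (e3 R) _ 1) => //; rewrite ?oner_eq0 ?scale1r ?cross_e23 //.
by rewrite odot_zorn; field.
Qed.
Let F2 : fixes G (f2 R).
Proof.
apply: (@fixes_nbr (e3 R) (e1 R) _ 1) => //; rewrite ?oner_eq0 ?scale1r ?cross_e31 //.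
by rewrite odot_zorn; field.
Qed.

(** The plane of e1, e2, e3 consists of the null vectors orthogonal to all three. *)
Lemma G_va a1 a2 a3 : nul (va a1 a2 a3) ->
  exists a1' a2' a3', G (va a1 a2 a3) = va a1' a2' a3'.
Proof.
move=> na; have [hG' nG _] := Gn na.
have := G_odot na n1 G1; have := G_odot na n2 G2; have := G_odot na n3 G3.
have [x1 [x2 [x3 [c [y1 [y2 [y3 E]]]]]]] := ImO_zornP hG'.
move: nG; rewrite E !odot_zorn => nG [_ o3] [_ o2] [_ o1].
have {o1}y10 : y1 = 0 by have := o1 ltac:(field); lra.
have {o2}y20 : y2 = 0 by have := o2 ltac:(field); lra.
have {o3}y30 : y3 = 0 by have := o3 ltac:(field); lra.
exists x1, x2, x3; rewrite /va; congr zorn => //.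
apply/eqP; rewrite -sqrf_eq0 expr2; apply/eqP.
by move: nG; rewrite y10 y20 y30; lra.
Qed.

Lemma G_vb b1 b2 b3 : nul (vb b1 b2 b3) ->
  exists b1' b2' b3', G (vb b1 b2 b3) = vb b1' b2' b3'.
Proof.
move=> na; have [hG' nG _] := Gn na.
have := G_odot na m1 F1; have := G_odot na m2 F2; have := G_odot na m3 F3.
have [x1 [x2 [x3 [c [y1 [y2 [y3 E]]]]]]] := ImO_zornP hG'.
move: nG; rewrite E !odot_zorn => nG [_ o3] [_ o2] [_ o1].
have {o1}y10 : x1 = 0 by have := o1 ltac:(field); lra.
have {o2}y20 : x2 = 0 by have := o2 ltac:(field); lra.
have {o3}y30 : x3 = 0 by have := o3 ltac:(field); lra.
exists y1, y2, y3; rewrite /vb; congr zorn => //.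
apply/eqP; rewrite -sqrf_eq0 expr2; apply/eqP.
by move: nG; rewrite y10 y20 y30; lra.
Qed.

Let gpt u u' := exists2 k, k != 0 & G u = k *: u'.

Lemma va_intro u a1 a2 a3 k : nul u -> G u = va (k * a1) (k * a2) (k * a3) ->
  gpt u (va a1 a2 a3).
Proof.
move=> /Gn [_ _ nG] E; exists k; last by rewrite E zornZ; congr zorn; ring.
by apply: contraNneq nG => k0; rewrite E k0 !mul0r; apply/eqP; exact: zorn0.
Qed.

Lemma vb_intro u a1 a2 a3 k : nul u -> G u = vb (k * a1) (k * a2) (k * a3) ->
  gpt u (vb a1 a2 a3).
Proof.
move=> /Gn [_ _ nG] E; exists k; last by rewrite E zornZ; congr zorn; ring.
by apply: contraNneq nG => k0; rewrite E k0 !mul0r; apply/eqP; exact: zorn0.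
Qed.

Let inc a1 a2 a3 b1 b2 b3 a1' a2' a3' b1' b2' b3' :
  nul (va a1 a2 a3) -> nul (vb b1 b2 b3) -> gpt (va a1 a2 a3) (va a1' a2' a3') ->
  gpt (vb b1 b2 b3) (vb b1' b2' b3') -> a1 * b1 + a2 * b2 + a3 * b3 = 0 ->
  a1' * b1' + a2' * b2' + a3' * b3' = 0.
Proof.
move=> na nb [k k0 ea] [l l0 eb] h.
have : odot (G (va a1 a2 a3)) (G (vb b1 b2 b3)) = 0.
  by apply/Go => //; rewrite odot_vab h mul0r.
rewrite ea eb odotZZ odot_vab => /eqP.
by rewrite !mulf_eq0 (negbTE k0) (negbTE l0) /= invr_eq0 pnatr_eq0 orbF => /eqP.
Qed.

Let gpt_fix u : nul u -> fixes G u -> gpt u u.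
Proof. exact: fixes_neq0. Qed.

Let nv1 x y : nul (va x y 1). Proof. by apply/nul_va => -[_ _ /eqP]; rewrite oner_eq0. Qed.
Let nv2 x : nul (va 1 x 0). Proof. by apply/nul_va => -[/eqP]; rewrite oner_eq0. Qed.
Let nb1 x y : nul (vb 1 x y). Proof. by apply/nul_vb => -[/eqP]; rewrite oner_eq0. Qed.
Let nb2 x y : nul (vb x 1 y). Proof. by apply/nul_vb => -[_ /eqP]; rewrite oner_eq0. Qed.
Let nb3 x y : nul (vb x (-1) y).
Proof. by apply/nul_vb => -[_ /eqP]; rewrite oppr_eq0 oner_eq0. Qed.

Let g1 : gpt (va 1 0 0) (va 1 0 0). Proof. exact: gpt_fix. Qed.
Let g2 : gpt (va 0 1 0) (va 0 1 0). Proof. exact: gpt_fix. Qed.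
Let g3 : gpt (va 0 0 1) (va 0 0 1). Proof. exact: gpt_fix. Qed.
Let h1 : gpt (vb 1 0 0) (vb 1 0 0). Proof. exact: gpt_fix. Qed.
Let h2 : gpt (vb 0 1 0) (vb 0 1 0). Proof. exact: gpt_fix. Qed.
Let h3 : gpt (vb 0 0 1) (vb 0 0 1). Proof. exact: gpt_fix. Qed.
Let gs : gpt (va 1 1 1) (va 1 1 1). Proof. exact: gpt_fix. Qed.

Let gptA u a1 a2 a3 : G u = va a1 a2 a3 -> gpt u (va a1 a2 a3).
Proof. by move=> E; exists 1; rewrite ?oner_eq0 ?scale1r. Qed.
Let gptB u a1 a2 a3 : G u = vb a1 a2 a3 -> gpt u (vb a1 a2 a3).
Proof. by move=> E; exists 1; rewrite ?oner_eq0 ?scale1r. Qed.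

Let exS x : exists s, gpt (va x 0 1) (va s 0 1).
Proof.
have [a1 [a2 [a3 E]]] := G_va (nv1 x 0); have gE := gptA E.
have e : a2 = 0.
  by have := inc (nv1 x 0) m2 gE h2 ltac:(ring); lra.
have a30 : a3 != 0.
  apply/negP => /eqP a30; have := G_odot (nv1 x 0) m3 F3.
  rewrite E !odot_vab a30 !(mulr0,mul0r,addr0,add0r,mulr1) => -[/(_ erefl)/eqP].
  by rewrite mul1r invr_eq0 pnatr_eq0.
exists (a1 / a3); apply: (@va_intro _ _ _ _ a3) => //.
by rewrite E e mulr0 mulr1 mulrC divfK.
Qed.

Let exT y : exists s, gpt (va 0 y 1) (va 0 s 1).
Proof.
have [a1 [a2 [a3 E]]] := G_va (nv1 0 y); have gE := gptA E.
have e : a1 = 0.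
  by have := inc (nv1 0 y) m1 gE h1 ltac:(ring); lra.
have a30 : a3 != 0.
  apply/negP => /eqP a30; have := G_odot (nv1 0 y) m3 F3.
  rewrite E !odot_vab a30 !(mulr0,mul0r,addr0,add0r,mulr1) => -[/(_ erefl)/eqP].
  by rewrite mul1r invr_eq0 pnatr_eq0.
exists (a2 / a3); apply: (@va_intro _ _ _ _ a3) => //.
by rewrite E e mulr0 mulr1 mulrC divfK.
Qed.

(** Affine coordinates on the two planes are propagated by the incidence a1 b1 + a2
b2 + a3 b3 = 0: from the points (x, 0, 1) and (0, y, 1) to lines, from lines to all
points (x, y, 1). The fixed point (1, 1, 1) identifies the two coordinate maps, and
the point (x, mx + b, 1) of the line (m, -1, b) gives the equation of s. *)
Lemma plane_fixed : (forall a1 a2 a3, nul (va a1 a2 a3) -> fixes G (va a1 a2 a3)) /\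
  (forall b1 b2 b3, nul (vb b1 b2 b3) -> fixes G (vb b1 b2 b3)).
Proof.
have [s gS] := choice exS; have [t gT] := choice exT.
have L1 x : gpt (vb 1 0 (- x)) (vb 1 0 (- s x)).
  have [b1 [b2 [b3 E]]] := G_vb (nb1 0 (- x)); have gE := gptB E.
  have o1 := inc n2 (nb1 0 (- x)) g2 gE ltac:(ring).
  have o2 := inc (nv1 x 0) (nb1 0 (- x)) (gS x) gE ltac:(ring).
  apply: (@vb_intro _ _ _ _ b1) => //; rewrite E; congr vb; first by ring.
    by lra.
  by lra.
have L2 x : gpt (vb 0 1 (- x)) (vb 0 1 (- t x)).
  have [b1 [b2 [b3 E]]] := G_vb (nb2 0 (- x)); have gE := gptB E.
  have o1 := inc n1 (nb2 0 (- x)) g1 gE ltac:(ring).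
  have o2 := inc (nv1 0 x) (nb2 0 (- x)) (gT x) gE ltac:(ring).
  apply: (@vb_intro _ _ _ _ b2) => //; rewrite E; congr vb; last first.
  - by lra.
  - by ring.
  by lra.
have P x y : gpt (va x y 1) (va (s x) (t y) 1).
  have [a1 [a2 [a3 E]]] := G_va (nv1 x y); have gE := gptA E.
  have o1 := inc (nv1 x y) (nb1 0 (- x)) gE (L1 x) ltac:(ring).
  have o2 := inc (nv1 x y) (nb2 0 (- y)) gE (L2 y) ltac:(ring).
  apply: (@va_intro _ _ _ _ a3) => //; rewrite E; congr va; last by ring.
  - by lra.
  - by lra.
have uniqA u a1 a2 a1' a2' : gpt u (va a1 a2 1) -> gpt u (va a1' a2' 1) ->
    a1 = a1' /\ a2 = a2'.
  move=> [k k0 Ea] [l l0]; rewrite Ea !zornZ => /zorn_inj [[p1 p2 p3] _].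
  have kl : k = l by lra.
  by split; apply: (mulfI k0); rewrite ?p1 ?p2 kl.
have [s1 t1] := uniqA _ _ _ _ _ (P 1 1) gs.
have [s0 t0] := uniqA _ _ _ _ _ (P 0 0) g3.
(* The diagonal line through (0, 0, 1) and (1, 1, 1) is fixed, whence s = t. *)
have L3 : gpt (vb 1 (-1) 0) (vb 1 (-1) 0).
  have [b1 [b2 [b3 E]]] := G_vb (nb1 (-1) 0); have gE := gptB E.
  have o1 := inc n3 (nb1 (-1) 0) g3 gE ltac:(ring).
  have o2 := inc (nv1 1 1) (nb1 (-1) 0) gs gE ltac:(ring).
  apply: (@vb_intro _ _ _ _ b1) => //; rewrite E.
  have b30 : b3 = 0 by lra.
  congr vb; [by ring| |by rewrite b30 mulr0].
  by lra.
have st x : t x = s x.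
  by have := inc (nv1 x x) (nb1 (-1) 0) (P x x) L3 ltac:(ring); lra.
have L4 m : gpt (vb m (-1) 0) (vb (s m) (-1) 0).
  have [b1 [b2 [b3 E]]] := G_vb (nb3 m 0); have gE := gptB E.
  have o1 := inc n3 (nb3 m 0) g3 gE ltac:(ring).
  have o2 := inc (nv1 1 m) (nb3 m 0) (P 1 m) gE ltac:(ring).
  have b30 : b3 = 0 by lra.
  apply: (@vb_intro _ _ _ _ (- b2)) => //; rewrite E b30; congr vb; [|by ring|by ring].
  by move: o2; rewrite ?s0 ?s1 ?st => o2; lra.
have Q m : gpt (va 1 m 0) (va 1 (s m) 0).
  have [a1 [a2 [a3 E]]] := G_va (nv2 m); have gE := gptA E.
  have o1 := inc (nv2 m) m3 gE h3 ltac:(ring).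
  have o2 := inc (nv2 m) (nb3 m 0) gE (L4 m) ltac:(ring).
  have a30 : a3 = 0 by lra.
  apply: (@va_intro _ _ _ _ a1) => //; rewrite E a30; congr va; [by ring| |by ring].
  by move: o2; rewrite ?s0 ?s1 ?st => o2; lra.
have L5 m b : gpt (vb m (-1) b) (vb (s m) (-1) (s b)).
  have [b1 [b2 [b3 E]]] := G_vb (nb3 m b); have gE := gptB E.
  have o1 := inc (nv2 m) (nb3 m b) (Q m) gE ltac:(ring).
  have o2 := inc (nv1 0 b) (nb3 m b) (P 0 b) gE ltac:(ring).
  apply: (@vb_intro _ _ _ _ (- b2)) => //; rewrite E; congr vb; [|by ring|].
    by move: o1; rewrite ?s0 ?s1 ?st => o1; lra.
  by move: o2; rewrite ?s0 ?s1 ?st => o2; lra.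
(* The point (x, mx + b, 1) lies on the line (m, -1, b). *)
have aff m x b : s (m * x + b) = s m * s x + s b.
  have := inc (nv1 x (m * x + b)) (nb3 m b) (P x (m * x + b)) (L5 m b) ltac:(ring).
  by rewrite st; lra.
have sid : forall x, s x = x.
  apply: rmorph_real_id => // x y; first by rewrite -[x in LHS]mul1r aff s1 mul1r.
  by rewrite -[x * y]addr0 aff s0 addr0.
have gfix u : gpt u u -> fixes G u by move=> [k _ e]; exists k.
split=> [a1 a2 a3 na|b1 b2 b3 nb].
  have [a30|a30] := eqVneq a3 0; last first.
    have -> : va a1 a2 a3 = a3 *: va (a1 / a3) (a2 / a3) 1.
      by rewrite zornZ /va; congr zorn; field.
    apply: fixesZ => //; apply: gfix; have := P (a1 / a3) (a2 / a3).
    by rewrite st !sid.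
  subst a3; have [a10|a10] := eqVneq a1 0; last first.
    have -> : va a1 a2 0 = a1 *: va 1 (a2 / a1) 0.
      by rewrite zornZ /va; congr zorn; field.
    by apply: fixesZ => //; apply: gfix; have := Q (a2 / a1); rewrite sid.
  subst a1; have a20 : a2 != 0 by apply/eqP => a20; move/nul_va: na; apply.
  have -> : va 0 a2 0 = a2 *: va 0 1 0 by rewrite zornZ /va; congr zorn; ring.
  by apply: fixesZ => //; apply: gfix.
have [a20|a20] := eqVneq b2 0; last first.
  have -> : vb b1 b2 b3 = (- b2) *: vb (- b1 / b2) (-1) (- b3 / b2).
    by rewrite zornZ /vb; congr zorn; field.
  apply: fixesZ => //; first by rewrite oppr_eq0.
  by apply: gfix; have := L5 (- b1 / b2) (- b3 / b2); rewrite !sid.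
subst b2; have [a10|a10] := eqVneq b1 0; last first.
  have -> : vb b1 0 b3 = b1 *: vb 1 0 (- (- b3 / b1)).
    by rewrite zornZ /vb; congr zorn; field.
  by apply: fixesZ => //; apply: gfix; have := L1 (- b3 / b1); rewrite sid.
subst b1; have a30 : b3 != 0 by apply/eqP => a30; move/nul_vb: nb; apply.
have -> : vb 0 0 b3 = b3 *: vb 0 0 1 by rewrite zornZ /vb; congr zorn; ring.
by apply: fixesZ => //; apply: gfix.
Qed.
End Plane.
End Frame.
End DualPlanes.

(** * From two dual planes to all null vectors *)

Section AllPoints.
Variable R : realType.
Implicit Types u v w p : Oct R.
Implicit Type psi : G2' R.

Lemma hexmap_g2 (G : Oct R -> Oct R) psi psi' :
  hexmap G -> hexmap (fun u => psi' (G (psi u))).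
Proof.
move=> [Gn Go Gc Gz]; split.
- by move=> u nu; do 2!apply: nul_g2 || apply: Gn; apply: nul_g2.
- move=> u v nu nv; have nu' := nul_g2 psi nu; have nv' := nul_g2 psi nv.
  have [hu _ _] := nu; have [hv _ _] := nv.
  have [hu' _ _] := Gn _ nu'; have [hv' _ _] := Gn _ nv'.
  by rewrite g2_odot // Go // g2_odot.
- move=> u v nu nv; have nu' := nul_g2 psi nu; have nv' := nul_g2 psi nv.
  have [hu _ _] := nu; have [hv _ _] := nv.
  have [hu' _ _] := Gn _ nu'; have [hv' _ _] := Gn _ nv'.
  rewrite -g2_cross // -[X in _ = X <-> _](linear0 psi').
  have -> : psi' (cross (G (psi u)) (G (psi v))) = psi' 0 <->
     cross (G (psi u)) (G (psi v)) = 0 by split=> [/(@g2_inj _ psi')|->].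
  rewrite Gc // -g2_cross // -[X in _ = X <-> _](linear0 psi).
  by split=> [/(@g2_inj _ psi)|->].
- move=> k u k0 nu; have [c e] := Gz k _ k0 (nul_g2 psi nu).
  by exists c; rewrite linearZ /= e linearZ.
Qed.

Lemma fixes_conj G psi u : fixes (fun u => g2_inv psi (G (psi u))) u <->
  fixes G (psi u).
Proof.
split=> -[k e]; exists k; last by rewrite e linearZ /= g2_Kinv.
by rewrite -[LHS](g2_invK psi) e linearZ.
Qed.

Section Special.
Variable G : Oct R -> Oct R.
Hypothesis hG : hexmap G.
Hypothesis GA : forall a1 a2 a3, nul (va a1 a2 a3) -> fixes G (va a1 a2 a3).
Hypothesis GB : forall b1 b2 b3, nul (vb b1 b2 b3) -> fixes G (vb b1 b2 b3).

Let shapeB a1 a2 a3 c b1 b2 b3 a1' a2' a3' c' b1' b2' b3' (w1 w2 w3 : R) :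
  nul (zorn a1 a2 a3 c b1 b2 b3) ->
  G (zorn a1 a2 a3 c b1 b2 b3) = zorn a1' a2' a3' c' b1' b2' b3' ->
  ~ [/\ w1 = 0, w2 = 0 & w3 = 0] ->
  w1 * b1' + w2 * b2' + w3 * b3' = 0 <-> w1 * b1 + w2 * b2 + w3 * b3 = 0.
Proof.
move=> nu E /nul_va nw; have := G_odot hG nu nw (GA nw).
rewrite E !odot_zorn => -[i1 i2]; split=> h.
  by have := i1 ltac:(lra); lra.
by have := i2 ltac:(lra); lra.
Qed.

Let shapeA a1 a2 a3 c b1 b2 b3 a1' a2' a3' c' b1' b2' b3' (w1 w2 w3 : R) :
  nul (zorn a1 a2 a3 c b1 b2 b3) ->
  G (zorn a1 a2 a3 c b1 b2 b3) = zorn a1' a2' a3' c' b1' b2' b3' ->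
  ~ [/\ w1 = 0, w2 = 0 & w3 = 0] ->
  w1 * a1' + w2 * a2' + w3 * a3' = 0 <-> w1 * a1 + w2 * a2 + w3 * a3 = 0.
Proof.
move=> nu E /nul_vb nw; have := G_odot hG nu nw (GB nw).
rewrite E !odot_zorn => -[i1 i2]; split=> h.
  by have := i1 ltac:(lra); lra.
by have := i2 ltac:(lra); lra.
Qed.

Let w100 : ~ [/\ 1 = 0 :> R, 0 = 0 :> R & 0 = 0 :> R].
Proof. by case=> /eqP; rewrite oner_eq0. Qed.
Let w010 : ~ [/\ 0 = 0 :> R, 1 = 0 :> R & 0 = 0 :> R].
Proof. by case=> _ /eqP; rewrite oner_eq0. Qed.
Let w001 : ~ [/\ 0 = 0 :> R, 0 = 0 :> R & 1 = 0 :> R].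
Proof. by case=> _ _ /eqP; rewrite oner_eq0. Qed.
Let w110 : ~ [/\ 1 = 0 :> R, 1 = 0 :> R & 0 = 0 :> R].
Proof. by case=> /eqP; rewrite oner_eq0. Qed.
Let w10N : ~ [/\ 1 = 0 :> R, 0 = 0 :> R & -1 = 0 :> R].
Proof. by case=> /eqP; rewrite oner_eq0. Qed.
Let w01N : ~ [/\ 0 = 0 :> R, 1 = 0 :> R & -1 = 0 :> R].
Proof. by case=> _ /eqP; rewrite oner_eq0. Qed.

(** Orthogonality to the fixed planes leaves y = e1 + f2 and x = e3 + h + f3 one
ratio A / B and A2 : c2 : B2 to determine. The auxiliary null vector y', orthogonal
to both, ties the ratios together, and the vanishing of the cross product of x and y
then yields that the cube of A / B is 1, so that A = B by reality. *)
Lemma fixed_special_points : fixes G (zorn 1 0 0 0 0 1 0) /\ fixes G (zorn 0 0 1 1 0 0 1).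
Proof.
set y := zorn 1 0 0 0 0 1 0; set x := zorn 0 0 1 1 0 0 1.
(* A null vector orthogonal to both special points, whose image is determined up to the two scalars A3 and B3'. *)
pose y' : Oct R := zorn (-1) 1 1 0 (-1) 0 (-1).
have ny : nul y.
  by split; [exact: ImO_zorn|rewrite odot_zorn; field|apply/zorn_neq0 => -[/w100]].
have nx : nul x.
  by split; [exact: ImO_zorn|rewrite odot_zorn; field|apply/zorn_neq0 => -[/w001]].
have ny' : nul y'.
  split; [exact: ImO_zorn|rewrite odot_zorn; lra|apply/zorn_neq0 => -[[_ e _] _]].
  by apply: w010; split.
have [Gn Go Gc _] := hG.
have S u : nul u -> exists a1 a2 a3 c b1 b2 b3, G u = zorn a1 a2 a3 c b1 b2 b3 /\
    a1 * b1 + a2 * b2 + a3 * b3 = c * c.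
  move=> /Gn [hGu nGu _]; have [a1 [a2 [a3 [c [b1 [b2 [b3 E]]]]]]] := ImO_zornP hGu.
  exists a1, a2, a3, c, b1, b2, b3; split=> //.
  by move: nGu; rewrite E odot_zorn => ?; lra.
have [A [y2 [y3 [cy [y4 [B [y6 [Ey qy]]]]]]]] := S _ ny.
have [x1 [x2 [A2 [c2 [x4 [x5 [B2 [Ex qx]]]]]]]] := S _ nx.
have [z1 [A3 [z3 [cz [z4 [z5 [B3' [Ez qz]]]]]]]] := S _ ny'.
have neq0 (P : R) (c1 c2' : Prop) : (c1 <-> c2') -> ~ c2' -> (P = 0 -> c1) -> P != 0.
  by move=> [h _] n i; apply/eqP => /i /h.
have one0 : (1 : R) <> 0 by move=> /eqP; rewrite oner_eq0.
have {}y20 : y2 = 0 by have [_ h] := shapeA ny Ey w010; have := h ltac:(ring); lra.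
have {}y30 : y3 = 0 by have [_ h] := shapeA ny Ey w001; have := h ltac:(ring); lra.
have {}y40 : y4 = 0 by have [_ h] := shapeB ny Ey w100; have := h ltac:(ring); lra.
have {}y60 : y6 = 0 by have [_ h] := shapeB ny Ey w001; have := h ltac:(ring); lra.
have A0 : A != 0 by apply: (neq0 _ _ _ (shapeA ny Ey w100)); lra.
have B0 : B != 0 by apply: (neq0 _ _ _ (shapeB ny Ey w010)); lra.
have cy0 : cy = 0.
  apply/eqP; rewrite -sqrf_eq0 expr2; apply/eqP.
  by move: qy; rewrite y20 y30 y40 y60; lra.
have x10 : x1 = 0 by have [_ h] := shapeA nx Ex w100; have := h ltac:(ring); lra.
have x20 : x2 = 0 by have [_ h] := shapeA nx Ex w010; have := h ltac:(ring); lra.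
have x40 : x4 = 0 by have [_ h] := shapeB nx Ex w100; have := h ltac:(ring); lra.
have x50 : x5 = 0 by have [_ h] := shapeB nx Ex w010; have := h ltac:(ring); lra.
have A20 : A2 != 0 by apply: (neq0 _ _ _ (shapeA nx Ex w001)); lra.
have B20 : B2 != 0 by apply: (neq0 _ _ _ (shapeB nx Ex w001)); lra.
have q2 : A2 * B2 = c2 * c2 by move: qx; rewrite x10 x20; lra.
have z50 : z5 = 0 by have [_ h] := shapeB ny' Ez w010; have := h ltac:(ring); lra.
have z46 : z4 = B3' by have [_ h] := shapeB ny' Ez w10N; have := h ltac:(ring); lra.
have z12 : z1 = - A3 by have [_ h] := shapeA ny' Ez w110; have := h ltac:(ring); lra.
have z23 : z3 = A3 by have [_ h] := shapeA ny' Ez w01N; have := h ltac:(ring); lra.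
have A30 : A3 != 0 by apply: (neq0 _ _ _ (shapeA ny' Ez w010)); lra.
have B30 : B3' != 0 by apply: (neq0 _ _ _ (shapeB ny' Ez w001)); lra.
have yz : A * B3' + B * A3 = 0.
  have : odot (G y) (G y') = 0 by apply/Go => //; rewrite odot_zorn; field.
  by rewrite Ey Ez odot_zorn y20 y30 y40 y60 cy0 z46 z50; lra.
have xz : A2 * B3' + B2 * A3 = 0.
  have : odot (G x) (G y') = 0 by apply/Go => //; rewrite odot_zorn; field.
  have cz0 : cz = 0.
    apply/eqP; rewrite -sqrf_eq0 expr2; apply/eqP.
    by move: qz; rewrite z12 z23 z46 z50; lra.
  by rewrite Ex Ez odot_zorn x10 x20 x40 x50 cz0 z23; lra.
have [xy1 xy2] : c2 * A = B2 * B /\ A2 * A = c2 * B.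
  have : cross (G x) (G y) = 0.
    by apply/Gc => //; rewrite cross_zorn -zorn0; congr zorn; field.
  rewrite Ex Ey cross_zorn -zorn0 => /zorn_inj [[h1 _ _] [_ _ h2 _]].
  by move: h1 h2; rewrite ?x10 ?x20 ?x40 ?x50 ?y20 ?y30 ?y40 ?y60 ?cy0 => h1 h2; split; lra.
have AB : A2 * B = B2 * A.
  apply: (mulIf B30); apply/eqP; rewrite -subr_eq0; apply/eqP.
  transitivity (B * (A2 * B3' + B2 * A3) - B2 * (A * B3' + B * A3)); first by ring.
  by rewrite yz xz; ring.
have c20 : c2 != 0.
  by apply/eqP => c0; move: (mulf_neq0 A20 B20); rewrite q2 c0 mul0r eqxx.
have l3 : A ^+ 3 = B ^+ 3.
  apply: (mulfI c20); apply: (mulIf B20).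
  transitivity ((c2 * A) * (B2 * A) * A); first by ring.
  rewrite xy1 -AB; transitivity (B2 * B ^+ 2 * (A2 * A)); first by ring.
  by rewrite xy2; ring.
(* A^2 + AB + B^2 = (A/2 + B)^2 + 3 A^2 / 4 is positive. *)
have AeB : A = B.
  apply/eqP; rewrite -subr_eq0; apply/eqP.
  have /eqP : (A - B) * (A ^+ 2 + A * B + B ^+ 2) = 0.
    by transitivity (A ^+ 3 - B ^+ 3); [ring|rewrite l3 subrr].
  rewrite mulf_eq0 => /orP [/eqP //|/eqP h]; move/eqP: A0; case.
  by apply/eqP; rewrite -sqrf_eq0; apply/eqP; have := sqr_ge0 (A / 2 + B); have := sqr_ge0 A; lra.
have cB : c2 = B2 by apply: (mulIf A0); rewrite xy1 AeB.
have Ac : A2 = c2 by apply: (mulIf A0); rewrite xy2 AeB.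
split.
  exists A; rewrite Ey y20 y30 y40 y60 cy0 -AeB zornZ.
  by congr zorn; ring.
exists A2; rewrite Ex x10 x20 x40 x50 -cB -Ac zornZ.
by congr zorn; ring.
Qed.
End Special.

(** Automorphisms preserving the first plane preserve the dual plane, whose vectors
are the cross products. *)
Lemma va_vb_stable psi a11 a12 a13 a21 a22 a23 a31 a32 a33 :
  psi (e1 R) = va a11 a12 a13 -> psi (e2 R) = va a21 a22 a23 ->
  psi (e3 R) = va a31 a32 a33 ->
  (forall x1 x2 x3, exists y1 y2 y3, psi (va x1 x2 x3) = va y1 y2 y3) /\
  (forall x1 x2 x3, exists y1 y2 y3, psi (vb x1 x2 x3) = vb y1 y2 y3).
Proof.
move=> E1 E2 E3; split=> x1 x2 x3.
  rewrite g2_zorn !scale0r !addr0 E1 E2 E3 !zornZ !zornD.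
  by do 3!eexists; rewrite /va; congr zorn; rewrite !mulr0 !addr0.
rewrite g2_zorn !scale0r !add0r g2_f1 g2_f2 g2_f3 E1 E2 E3 !cross_zorn !zornZ !zornD.
by do 3!eexists; rewrite /vb; congr zorn; field.
Qed.

(** Up to a scalar, a null vector with c not zero is in the orbit of e3 + h + f3
under the automorphisms preserving the two planes, and one with c = 0 and a, b not
zero is in the orbit of e1 + f2; these automorphisms conjugate G to maps of the same
kind. *)
Lemma all_fixed G : hexmap G ->
  (forall a1 a2 a3, nul (va a1 a2 a3) -> fixes G (va a1 a2 a3)) ->
  (forall b1 b2 b3, nul (vb b1 b2 b3) -> fixes G (vb b1 b2 b3)) ->
  forall u, nul u -> fixes G u.
Proof.
move=> hG GA GB u nu.
have special psi a11 a12 a13 a21 a22 a23 a31 a32 a33 :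
  psi (e1 R) = va a11 a12 a13 -> psi (e2 R) = va a21 a22 a23 ->
  psi (e3 R) = va a31 a32 a33 ->
  fixes G (psi (zorn 1 0 0 0 0 1 0)) /\ fixes G (psi (zorn 0 0 1 1 0 0 1)).
  move=> E1 E2 E3; have [SA SB] := va_vb_stable E1 E2 E3.
  have [] := @fixed_special_points (fun u => g2_inv psi (G (psi u))) (hexmap_g2 _ _ hG).
  - move=> a1 a2 a3 na; apply/fixes_conj; have [y1 [y2 [y3 e]]] := SA a1 a2 a3.
    by rewrite e; apply: GA; rewrite -e; exact: nul_g2.
  - move=> a1 a2 a3 na; apply/fixes_conj; have [y1 [y2 [y3 e]]] := SB a1 a2 a3.
    by rewrite e; apply: GB; rewrite -e; exact: nul_g2.
  by move=> /fixes_conj ? /fixes_conj ?.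
have [hu nnu u0] := nu.
have [a1 [a2 [a3 [c [b1 [b2 [b3 E]]]]]]] := ImO_zornP hu.
have q : a1 * b1 + a2 * b2 + a3 * b3 = c * c by move: nnu; rewrite E odot_zorn => ?; lra.
have tri E1 E2 E3 := @g2_triple R E1 E2 E3.
have va_odot (x1 x2 x3 y1 y2 y3 : R) : odot (va x1 x2 x3) (va y1 y2 y3) = 0.
  by rewrite odot_zorn; lra.
have sqn (x1 x2 x3 : R) :
    ~ [/\ x1 = 0, x2 = 0 & x3 = 0] -> x1 ^+ 2 + x2 ^+ 2 + x3 ^+ 2 != 0.
  move=> h; apply/eqP => e; apply: h.
  have := sqr_ge0 x1; have := sqr_ge0 x2; have := sqr_ge0 x3 => h1 h2 h3.
  by split; apply/eqP; rewrite -sqrf_eq0; apply/eqP; lra.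
have [c0|c0] := eqVneq c 0; last first.
  have bb : a1 / c * (b1 / c) + a2 / c * (b2 / c) + a3 / c * (b3 / c) = 1.
    transitivity ((a1 * b1 + a2 * b2 + a3 * b3) / (c * c)); first by field.
    by rewrite q divff // mulf_neq0.
  have Eu : u = c *: zorn (a1 / c) (a2 / c) (a3 / c) 1 (b1 / c) (b2 / c) (b3 / c).
    by rewrite E zornZ; congr zorn; field.
  move: (a1 / c) (a2 / c) (a3 / c) (b1 / c) (b2 / c) (b3 / c) bb Eu.
  move=> {E q}a1 {}a2 {}a3 {}b1 {}b2 {}b3 bb Eu.
  have [d1 [d2 [d3' [bd dd]]]] := orthogonal3 b1 b2 b3; have d0 := sqn _ _ _ dd.
  pose n := d1 ^+ 2 + d2 ^+ 2 + d3' ^+ 2; rewrite -/n in d0.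
  pose E2 : Oct R :=
    va ((b2 * d3' - b3 * d2) / n) ((b3 * d1 - b1 * d3') / n) ((b1 * d2 - b2 * d1) / n).
  have e12 : cross (va d1 d2 d3') E2 = vb b1 b2 b3.
    rewrite cross_zorn; congr zorn; try lra.
    - transitivity ((b1 * n - d1 * (b1 * d1 + b2 * d2 + b3 * d3')) / n).
        by rewrite /n; field.
      by rewrite bd mulr0 subr0 mulfK.
    - transitivity ((b2 * n - d2 * (b1 * d1 + b2 * d2 + b3 * d3')) / n).
        by rewrite /n; field.
      by rewrite bd mulr0 subr0 mulfK.
    - transitivity ((b3 * n - d3' * (b1 * d1 + b2 * d2 + b3 * d3')) / n).
        by rewrite /n; field.
      by rewrite bd mulr0 subr0 mulfK.
  have [||||||||||psi [p1 p2 p3]] := tri (va d1 d2 d3') E2 (va a1 a2 a3);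
    rewrite ?va_odot //; try exact: ImO_zorn.
    by rewrite e12 odotC odot_vab bb mul1r.
  have -> : u = c *: psi (zorn 0 0 1 1 0 0 1).
    rewrite Eu; congr (_ *: _); rewrite g2_zorn !scale0r !addr0 !add0r !scale1r.
    rewrite g2_f3 p1 p2 p3 e12.
    have -> : hh R = (-2) *: cross (e3 R) (f3 R).
      by rewrite cross_zorn zornZ; congr zorn; field.
    rewrite linearZ /= g2_cross; try exact: ImO_zorn.
    rewrite g2_f3 p1 p2 p3 e12 cross_zorn !zornZ !zornD; congr zorn; lra.
  apply: fixesZ => //; last by have [] := special _ _ _ _ _ _ _ _ _ _ p1 p2 p3.
  apply: nul_g2; split; [exact: ImO_zorn|by rewrite odot_zorn; lra|].
  by apply/zorn_neq0 => -[[_ _ /eqP]]; rewrite oner_eq0.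
subst c; rewrite mul0r in q.
have [[? ? ?]|an] := pselect [/\ a1 = 0, a2 = 0 & a3 = 0].
  by subst a1 a2 a3; rewrite E; apply: GB; rewrite /vb -E.
have [[? ? ?]|bn] := pselect [/\ b1 = 0, b2 = 0 & b3 = 0].
  by subst b1 b2 b3; rewrite E; apply: GA; rewrite /va -E.
have a0 := sqn _ _ _ an; have b0 := sqn _ _ _ bn.
pose n := a1 ^+ 2 + a2 ^+ 2 + a3 ^+ 2; rewrite -/n in a0.
pose m := b1 ^+ 2 + b2 ^+ 2 + b3 ^+ 2; rewrite -/m in b0.
pose E3 : Oct R :=
  va ((a2 * b3 - a3 * b2) / n) ((a3 * b1 - a1 * b3) / n) ((a1 * b2 - a2 * b1) / n).
pose E2 : Oct R := va (b1 / m) (b2 / m) (b3 / m).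
have e31 : cross E3 (va a1 a2 a3) = vb b1 b2 b3.
  rewrite cross_zorn; congr zorn; try lra.
  - transitivity ((b1 * n - a1 * (a1 * b1 + a2 * b2 + a3 * b3)) / n).
      by rewrite /n; field.
    by rewrite q mulr0 subr0 mulfK.
  - transitivity ((b2 * n - a2 * (a1 * b1 + a2 * b2 + a3 * b3)) / n).
      by rewrite /n; field.
    by rewrite q mulr0 subr0 mulfK.
  - transitivity ((b3 * n - a3 * (a1 * b1 + a2 * b2 + a3 * b3)) / n).
      by rewrite /n; field.
    by rewrite q mulr0 subr0 mulfK.
have [||||||||||psi [p1 p2 p3]] := tri (va a1 a2 a3) E2 E3;
  rewrite ?va_odot //; try exact: ImO_zorn.
  rewrite odotC -odot_crossl; try exact: ImO_zorn.
  rewrite e31 odotC odot_vab.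
  transitivity ((b1 ^+ 2 + b2 ^+ 2 + b3 ^+ 2) / m / 2); first by field.
  by rewrite -/m divff // mul1r.
have -> : u = psi (zorn 1 0 0 0 0 1 0).
  rewrite E g2_zorn !scale0r !addr0 !scale1r g2_f2 p1 p3 e31.
  by rewrite zornD; congr zorn; lra.
by have [] := special _ _ _ _ _ _ _ _ _ _ p1 p2 p3.
Qed.
End AllPoints.

(** * Isometries are induced by automorphisms *)

Section FundamentalTheorem.
Variable R : realType.
Implicit Types u v w p : Oct R.
Implicit Type psi : G2' R.

Lemma cube_root (a : R) : exists k : R, k ^+ 3 = a.
Proof.
have pos (b : R) : 0 <= b -> exists k : R, k ^+ 3 = b.
  move=> b0; exists (b `^ 3^-1).
  by rewrite -powR_mulrn ?powR_ge0 // -powRrM mulVf ?powRr1 // pnatr_eq0.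
have [a0|a0] := leP 0 a; first exact: pos.
have [|k e] := pos (- a); first by rewrite oppr_ge0 ltW.
by exists (- k); rewrite exprNn e; ring.
Qed.

(** A map of points turned into a map of null vectors, where the algebra applies. *)
Definition vector_map (phi : Ein R -> Ein R) u : Oct R :=
  if pselect (nul u) is left h then rep (phi (projT1 (ex_pt h))) else 0.

Lemma vector_mapE phi u x : nul u -> line x = <[u]>%VS -> vector_map phi u = rep (phi x).
Proof.
move=> nu lx; rewrite /vector_map; case: pselect => // h.
case: (ex_pt h) => y /= ly; congr (rep (phi _)).
by apply: line_inj; rewrite lx ly.
Qed.

Lemma vector_map_hexmap phi : d3_isometry phi -> hexmap (vector_map phi).
Proof.
move=> I; split.
- by move=> u nu; have [x lx] := ex_pt nu; rewrite (vector_mapE _ nu lx); exact: nul_rep.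
- move=> u v nu nv; have [x lx] := ex_pt nu; have [y ly] := ex_pt nv.
  rewrite (vector_mapE _ nu lx) (vector_mapE _ nv ly).
  have := I x y; have [_ P] := d3_pt nu nv lx ly => e.
  by split=> /eqP; [rewrite -d3_le2 e P|rewrite -P -e d3_le2] => /eqP.
- move=> u v nu nv; have [x lx] := ex_pt nu; have [y ly] := ex_pt nv.
  rewrite (vector_mapE _ nu lx) (vector_mapE _ nv ly).
  have := I x y; have [P _] := d3_pt nu nv lx ly => e.
  by split=> /eqP; [rewrite -d3_le1 e P|rewrite -P -e d3_le1] => /eqP.
- move=> k u k0 nu; have [x lx] := ex_pt nu; exists 1; rewrite scale1r.
  rewrite (vector_mapE phi nu lx) (@vector_mapE phi _ x) //; first exact: nulZ.
  rewrite lx; apply/eqP; rewrite eqEdim -memvE !dim_vline scaler_eq0 negb_or k0.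
  apply/andP; split=> //; apply/vlineP; exists k^-1.
  by rewrite scalerA mulVf ?scale1r.
Qed.

Lemma hexmap_post psi (G : Oct R -> Oct R) : hexmap G ->
  hexmap (fun u => g2_inv psi (G u)).
Proof.
move=> hG.
have bij : bijective (\1%VF : 'End(Oct R)) by exists id => x; rewrite id_lfunE.
have mul (x y : Oct R) : (\1%VF : 'End(Oct R)) (omul x y) =
  omul ((\1%VF : 'End(Oct R)) x) ((\1%VF : 'End(Oct R)) y) by rewrite !id_lfunE.
have := hexmap_g2 (MkG2' bij mul) (g2_inv psi) hG.
by congr hexmap; apply/funext => u /=; rewrite id_lfunE.
Qed.

(** The point (1, 1, 1) is sent to some (c1, c2, c3) with nonzero coordinates. The
diagonal automorphism with entries k c1, k c2, k c3 corrects this, where k makes the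
product of the entries 1. *)
Lemma fixesA_of_frame (G : Oct R -> Oct R) : hexmap G ->
  fixes G (e1 R) -> fixes G (e2 R) -> fixes G (e3 R) ->
  exists psi, forall u, nul u -> fixes (fun u => g2_inv psi (G u)) u.
Proof.
move=> hG G1 G2 G3.
have n111 : nul (va 1 1 1 : Oct R) by apply/nul_va => -[/eqP]; rewrite oner_eq0.
have [c1 [c2 [c3 E]]] := G_va hG G1 G2 G3 n111.
have neq (f : Oct R) b1 b2 b3 : nul f -> f = vb b1 b2 b3 -> fixes G f ->
    (b1 + b2 + b3) / 2 != 0 -> c1 * b1 + c2 * b2 + c3 * b3 != 0.
  move=> nf ef ff b0; apply/eqP => c0; have [h _] := G_odot hG n111 nf ff.
  move: h; rewrite E ef !odot_vab c0 mul0r => /(_ erefl)/eqP; rewrite !mul1r.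
  by apply/negP.
have half0 : 2^-1 != 0 :> R by rewrite invr_eq0 pnatr_eq0.
have n1 : nul (e1 R) by exact: nul_e1.
have n2 : nul (e2 R) by apply/nul_va => -[_ /eqP]; rewrite oner_eq0.
have n3 : nul (e3 R) by apply/nul_va => -[_ _ /eqP]; rewrite oner_eq0.
have m1 : nul (f1 R) by apply/nul_vb => -[/eqP]; rewrite oner_eq0.
have m2 : nul (f2 R) by apply/nul_vb => -[_ /eqP]; rewrite oner_eq0.
have m3 : nul (f3 R) by apply/nul_vb => -[_ _ /eqP]; rewrite oner_eq0.
have F3 : fixes G (f3 R).
  apply: (@fixes_nbr _ _ hG (e1 R) (e2 R) _ 1); rewrite ?oner_eq0 ?scale1r ?cross_e12 //.
  by rewrite odot_zorn; lra.
have F1 : fixes G (f1 R).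
  apply: (@fixes_nbr _ _ hG (e2 R) (e3 R) _ 1); rewrite ?oner_eq0 ?scale1r ?cross_e23 //.
  by rewrite odot_zorn; lra.
have F2 : fixes G (f2 R).
  apply: (@fixes_nbr _ _ hG (e3 R) (e1 R) _ 1); rewrite ?oner_eq0 ?scale1r ?cross_e31 //.
  by rewrite odot_zorn; lra.
have c10 : c1 != 0.
  by have := neq _ _ _ _ m1 erefl F1; rewrite !addr0 mul1r mulr1 !mulr0 !addr0; apply.
have c20 : c2 != 0.
  by have := neq _ _ _ _ m2 erefl F2; rewrite !addr0 add0r mul1r mulr1 !mulr0 !addr0 add0r; apply.
have c30 : c3 != 0.
  by have := neq _ _ _ _ m3 erefl F3; rewrite !add0r mul1r mulr1 !mulr0 !add0r; apply.
have [k k3] := cube_root (c1 * c2 * c3)^-1.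
have k0 : k != 0.
  have : k ^+ 3 != 0 by rewrite k3 invr_eq0 !mulf_neq0.
  by apply: contra_neq => ->; rewrite expr0n.
have kc : k ^+ 3 * (c1 * c2 * c3) = 1 by rewrite k3 mulVf // !mulf_neq0.
have [||||||||||psi [p1 p2 p3]] := @g2_triple R (va (k * c1) 0 0) (va 0 (k * c2) 0)
  (va 0 0 (k * c3)); try exact: ImO_zorn; try by rewrite odot_zorn; lra.
  rewrite cross_zorn odot_zorn; transitivity (k ^+ 3 * (c1 * c2 * c3) / 2); first by field.
  by rewrite kc mul1r.
have hG' := hexmap_post psi hG.
have fx u r : G u = r *: psi u -> fixes (fun u => g2_inv psi (G u)) u.
  by move=> e; exists r; rewrite e linearZ /= g2_Kinv.
have [l1 g1] := G1; have [l2 g2] := G2; have [l3 g3] := G3.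
have H1 : fixes (fun u => g2_inv psi (G u)) (e1 R).
  apply: (fx _ (l1 / (k * c1))); rewrite g1 p1 !zornZ.
  by congr zorn; field; rewrite k0 c10.
have H2 : fixes (fun u => g2_inv psi (G u)) (e2 R).
  apply: (fx _ (l2 / (k * c2))); rewrite g2 p2 !zornZ.
  by congr zorn; field; rewrite k0 c20.
have H3 : fixes (fun u => g2_inv psi (G u)) (e3 R).
  apply: (fx _ (l3 / (k * c3))); rewrite g3 p3 !zornZ.
  by congr zorn; field; rewrite k0 c30.
have H4 : fixes (fun u => g2_inv psi (G u)) (va 1 1 1).
  apply: (fx _ k^-1); rewrite E g2_zorn p1 p2 p3 !scale0r !addr0 !zornZ !zornD.
  by rewrite zornZ; congr zorn; field.
have [HA HB] := plane_fixed hG' H1 H2 H3 H4.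
by exists psi => u nu; exact: (all_fixed hG' HA HB).
Qed.

(** The images of e1, e2, e3 are pairwise orthogonal with nonzero triple product;
rescaling one of them gives a triple to which g2_triple applies. *)
Lemma frame_of_iso (G : Oct R -> Oct R) : hexmap G ->
  exists psi, [/\ fixes (fun u => g2_inv psi (G u)) (e1 R),
    fixes (fun u => g2_inv psi (G u)) (e2 R) &
    fixes (fun u => g2_inv psi (G u)) (e3 R)].
Proof.
move=> hG; have [Gn Go Gc _] := hG.
have n1 : nul (e1 R) by exact: nul_e1.
have n2 : nul (e2 R) by apply/nul_va => -[_ /eqP]; rewrite oner_eq0.
have n3 : nul (e3 R) by apply/nul_va => -[_ _ /eqP]; rewrite oner_eq0.
have m3 : nul (f3 R) by apply/nul_vb => -[_ _ /eqP]; rewrite oner_eq0.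
have N1 := Gn _ n1; have N2 := Gn _ n2; have N3 := Gn _ n3; have M3 := Gn _ m3.
have [h1 nn1 _] := N1; have [h2 nn2 _] := N2; have [h3 nn3 _] := N3.
have o12 : odot (G (e1 R)) (G (e2 R)) = 0 by apply/Go => //; rewrite odot_zorn; lra.
have o23 : odot (G (e2 R)) (G (e3 R)) = 0 by apply/Go => //; rewrite odot_zorn; lra.
have o31 : odot (G (e3 R)) (G (e1 R)) = 0 by apply/Go => //; rewrite odot_zorn; lra.
have c0 : cross (G (e1 R)) (G (e2 R)) != 0.
  apply/eqP => /Gc; rewrite cross_e12 => /(_ n1 n2) e.
  by have [_ _] := m3; rewrite e eqxx.
have f31 : cross (G (f3 R)) (G (e1 R)) = 0.
  by apply/Gc => //; rewrite cross_zorn -zorn0; congr zorn; lra.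
have f32 : cross (G (f3 R)) (G (e2 R)) = 0.
  by apply/Gc => //; rewrite cross_zorn -zorn0; congr zorn; lra.
have /vlineP [l El] := common_neighbor_uniq N1 N2 M3 o12 c0 f31 f32.
pose v := odot (cross (G (e1 R)) (G (e2 R))) (G (e3 R)).
have v0 : v != 0.
  apply/eqP => v0; have : odot (G (f3 R)) (G (e3 R)) = 0.
    by rewrite El odotZl -/v v0 mulr0.
  by move=> /Go; rewrite odotC odot_vab => /(_ m3 n3); lra.
have [||||||||||psi [p1 p2 p3]] := @g2_triple R ((2 * v)^-1 *: G (e1 R)) (G (e2 R)) (G (e3 R));
  rewrite ?odotZZ ?odotZl ?odotZr ?nn1 ?o12 ?o31 ?mulr0 //; first exact: ImOZ.
  by rewrite crossZl odotZl -/v; field.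
exists psi; split.
- exists (2 * v); rewrite -[RHS](g2_Kinv psi) linearZ /= p1 scalerA divff ?scale1r //.
  by rewrite mulf_neq0 // pnatr_eq0.
- by exists 1; rewrite -p2 g2_Kinv scale1r.
- by exists 1; rewrite -p3 g2_Kinv scale1r.
Qed.

Lemma iso_g2 (phi : Ein R -> Ein R) : d3_isometry phi ->
  exists psi, phi = g2_act psi.
Proof.
move=> I; have hG := vector_map_hexmap I.
have [psi1 [F1 F2 F3]] := frame_of_iso hG.
have [psi2 H] := fixesA_of_frame (hexmap_post psi1 hG) F1 F2 F3.
have [chi E] := g2_comp psi1 psi2.
exists chi; apply/funext => x.
have nx := nul_rep x; have [k e] := H _ nx.
apply: Ein_eq; rewrite -line_rep /line /= line_rep limg_line /=.
apply/vlineP; exists k; rewrite E.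
rewrite -(vector_mapE phi nx (line_rep x)).
rewrite -[LHS](g2_invK psi1) -[g2_inv psi1 _](g2_invK psi2) /= e.
by rewrite !linearZ.
Qed.

Lemma G2'_eq (psi1 psi2 : G2' R) : (forall x, psi1 x = psi2 x) -> psi1 = psi2.
Proof.
case: psi1 psi2 => [A1 b1 m1] [A2 b2 m2] /= h.
have E : A1 = A2 by apply/lfunP.
by subst A2; congr MkG2'; exact: Prop_irrelevance.
Qed.

(** Let s be the quotient of the two automorphisms: s u = k(u) u on null vectors.
The vector e1 + e2 + e3 makes the scalars of e1, e2, e3 equal, and e1 + f2 with f2 =
e3 x e1 makes that common scalar equal to its square. *)
Lemma F_inj : injective (@F R).
Proof.
move=> psi1 psi2 /(congr1 (@diff_fun R)) /= act.
pose s u := g2_inv psi2 (psi1 u).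
have sP u : nul u -> exists k, s u = k *: u.
  move=> nu; have [x lx] := ex_pt nu.
  have := congr1 (fun f => line (f x)) act; rewrite /line /= lx !limg_line => e.
  have : psi1 u \in <[psi2 u]>%VS by rewrite -e memv_line.
  by move=> /vlineP [k E]; exists k; rewrite /s E linearZ /= g2_Kinv.
have sD u v : s (u + v) = s u + s v by rewrite /s !linearD.
have sZ k u : s (k *: u) = k *: s u by rewrite /s !linearZ.
have sX u v : ImO u -> ImO v -> s (cross u v) = cross (s u) (s v).
  by move=> hu hv; rewrite /s !g2_cross //; exact: g2_ImO.
have n1 : nul (e1 R) by exact: nul_e1.
have n2 : nul (e2 R) by apply/nul_va => -[_ /eqP]; rewrite oner_eq0.
have n3 : nul (e3 R) by apply/nul_va => -[_ _ /eqP]; rewrite oner_eq0.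
have n111 : nul (va 1 1 1 : Oct R) by apply/nul_va => -[/eqP]; rewrite oner_eq0.
have n12 : nul (zorn 1 0 0 0 0 1 0 : Oct R).
  split; [exact: ImO_zorn|rewrite odot_zorn; lra|].
  by apply/zorn_neq0 => -[[/eqP]]; rewrite oner_eq0.
have [k1 E1] := sP _ n1; have [k2 E2] := sP _ n2; have [k3 E3] := sP _ n3.
have [l El] := sP _ n111; have [m Em] := sP _ n12.
have S z1 z2 z3 c y1 y2 y3 : s (zorn z1 z2 z3 c y1 y2 y3) =
   z1 *: s (e1 R) + z2 *: s (e2 R) + z3 *: s (e3 R) + c *: s (hh R)
   + y1 *: s (f1 R) + y2 *: s (f2 R) + y3 *: s (f3 R).
  by rewrite zorn_std !sD !sZ.
have F2 : s (f2 R) = (k3 * k1) *: f2 R.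
  by rewrite -cross_e31 sX ?E3 ?E1 ?crossZZ //; exact: ImO_zorn.
move: El; rewrite S E1 E2 E3 !scale0r !addr0 !zornZ !zornD => /zorn_inj [[a1 a2 a3] _].
move: Em; rewrite S E1 F2 !scale0r !addr0 !zornZ !zornD => /zorn_inj [[b1 _ _] [_ _ b2 _]].
have k0 : k1 != 0.
  apply/eqP => k0; have [_ _ /eqP] := nul_g2 (g2_inv psi2) (nul_g2 psi1 n1).
  by apply; rewrite -/(s _) E1 k0 scale0r.
have k11 : k1 = 1.
  have k31 : k3 = k1 by lra.
  have : k1 * k1 = k1 by move: b2; rewrite k31 => b2; lra.
  by move=> e; apply: (mulfI k0); rewrite e mulr1.
have s1 : s (e1 R) = e1 R by rewrite E1 k11 scale1r.
have s2 : s (e2 R) = e2 R by rewrite E2 (_ : k2 = 1) ?scale1r //; lra.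
have s3 : s (e3 R) = e3 R by rewrite E3 (_ : k3 = 1) ?scale1r //; lra.
have t1 : s (f1 R) = f1 R by rewrite -cross_e23 sX ?s2 ?s3 //; exact: ImO_zorn.
have t2 : s (f2 R) = f2 R by rewrite -cross_e31 sX ?s1 ?s3 //; exact: ImO_zorn.
have t3 : s (f3 R) = f3 R by rewrite -cross_e12 sX ?s1 ?s2 //; exact: ImO_zorn.
have sh : s (hh R) = hh R.
  have -> : hh R = (-2) *: cross (e1 R) (f1 R) by rewrite cross_zorn zornZ; congr zorn; lra.
  by rewrite sZ sX ?s1 ?t1 //; exact: ImO_zorn.
have sid u : s u = u.
  rewrite (im_partE u); have := ImO_im_part u; move: (im_part u) (odot u _) => w r hw.
  rewrite sD sZ {1}/s !g2_one; congr (_ + _).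
  have [z1 [z2 [z3 [z4 [z5 [z6 [z7 ->]]]]]]] := ImO_zornP hw.
  by rewrite S s1 s2 s3 t1 t2 t3 sh -zorn_std.
by apply: G2'_eq => u; rewrite -[LHS](g2_invK psi2) -/(s u) sid.
Qed.

End FundamentalTheorem.

(** * Derivatives of curves *)

Section Curves.
Variable R : realType.
Implicit Types u v w p : Oct R.

Definition bl (i : 'I_4) : Oct R := (delta_mx 0 i, 0).
Definition br (i : 'I_4) : Oct R := (0, delta_mx 0 i).

Lemma oct_sum u : u = \sum_(i < 4) u.1 0 i *: bl i + \sum_(i < 4) u.2 0 i *: br i.
Proof.
case: u => a b /=.
rewrite [LHS](_ : _ = (a, 0) + (0, b)); last first.
  by congr pair; rewrite ?addr0 ?add0r.
rewrite {1}[a]row_sum_delta {1}[b]row_sum_delta; congr (_ + _).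
  by elim/big_rec2: _ => // i u v _ <-; congr pair; rewrite /= scaler0 addr0.
by elim/big_rec2: _ => // i u v _ <-; congr pair; rewrite /= scaler0 addr0.
Qed.

Lemma cvg_near {T : Type} {F : set_system T} {FF : Filter F} (V : normedModType R)
  (f g : T -> V) (l : V) :
  (\forall t \near F, f t = g t) -> f t @[t --> F] --> l -> g t @[t --> F] --> l.
Proof.
move=> e; apply: cvg_trans; apply: near_eq_cvg.
by apply: filterS e => t ->.
Qed.

Section Filter.
Context {T : Type} (F : set_system T) {FF : Filter F}.

Lemma cvg_bigsum (V : normedModType R) (c : 'I_4 -> T -> V) (d : 'I_4 -> V) :
  (forall i, c i t @[t --> F] --> d i) ->
  \sum_(i < 4) c i t @[t --> F] --> \sum_(i < 4) d i.
Proof.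
move=> h; apply: (@cvg_big V 'I_4 +%R 0 xpredT) => //; exact: add_continuous.
Qed.

Lemma cvg_coord (c : T -> Oct R) (d : Oct R) : c t @[t --> F] --> d ->
  (forall i, (c t).1 0 i @[t --> F] --> d.1 0 i) /\
  (forall i, (c t).2 0 i @[t --> F] --> d.2 0 i).
Proof.
move=> h; split=> i.
  have h1 : (c t).1 @[t --> F] --> d.1 by apply: cvg_comp h _; exact: cvg_fst.
  exact: (cvg_comp _ _ h1 (@coord_continuous R 1 4 0 i d.1)).
have h1 : (c t).2 @[t --> F] --> d.2 by apply: cvg_comp h _; exact: cvg_snd.
exact: (cvg_comp _ _ h1 (@coord_continuous R 1 4 0 i d.2)).
Qed.

Lemma coord_cvg (c : T -> Oct R) (d : Oct R) :
  (forall i, (c t).1 0 i @[t --> F] --> d.1 0 i) ->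
  (forall i, (c t).2 0 i @[t --> F] --> d.2 0 i) -> c t @[t --> F] --> d.
Proof.
move=> h1 h2; rewrite [d]oct_sum.
rewrite (_ : (fun t => c t) = fun t => \sum_(i < 4) (c t).1 0 i *: bl i + \sum_(i < 4) (c t).2 0 i *: br i);
  last by apply/funext => t; exact: oct_sum.
apply: cvgD; apply: cvg_bigsum => i; apply: cvgZr_tmp; [exact: h1|exact: h2].
Qed.

Lemma lin_cvg (V : normedModType R) (L : Oct R -> V) :
  (forall x y, L (x + y) = L x + L y) -> (forall k x, L (k *: x) = k *: L x) ->
  forall (c : T -> Oct R) (d : Oct R), c t @[t --> F] --> d -> L (c t) @[t --> F] --> L d.
Proof.
move=> LD LZ c d /cvg_coord [h1 h2].
have L0 : L 0 = 0 by rewrite -(scale0r 0) LZ scale0r.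
have LS (g : 'I_4 -> Oct R) : L (\sum_(i < 4) g i) = \sum_(i < 4) L (g i).
  by elim/big_rec2: _ => // i x y _ <-; rewrite LD.
have LE x : L x = \sum_(i < 4) x.1 0 i *: L (bl i) + \sum_(i < 4) x.2 0 i *: L (br i).
  rewrite {1}[x]oct_sum LD !LS; congr (_ + _); apply: eq_bigr => i _; exact: LZ.
rewrite [L d]LE (_ : (fun t => L (c t)) = fun t => \sum_(i < 4) (c t).1 0 i *: L (bl i)
  + \sum_(i < 4) (c t).2 0 i *: L (br i)); last by apply/funext => t; exact: LE.
apply: cvgD; apply: cvg_bigsum => i; apply: cvgZr_tmp; [exact: h1|exact: h2].
Qed.

Lemma bil_cvg (V : normedModType R) (B : Oct R -> Oct R -> V) :
  (forall x y z, B (x + y) z = B x z + B y z) -> (forall k x y, B (k *: x) y = k *: B x y) ->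
  (forall x y z, B x (y + z) = B x y + B x z) -> (forall k x y, B x (k *: y) = k *: B x y) ->
  forall (c c' : T -> Oct R) (d d' : Oct R), c t @[t --> F] --> d -> c' t @[t --> F] --> d' ->
  B (c t) (c' t) @[t --> F] --> B d d'.
Proof.
move=> BDl BZl BDr BZr c c' d d' /cvg_coord [h1 h2] h'.
have B0 y : B 0 y = 0 by rewrite -(scale0r 0) BZl scale0r.
have BS y (g : 'I_4 -> Oct R) : B (\sum_(i < 4) g i) y = \sum_(i < 4) B (g i) y.
  by elim/big_rec2: _ => // i u v _ <-; rewrite BDl.
have BE x y : B x y = \sum_(i < 4) x.1 0 i *: B (bl i) y + \sum_(i < 4) x.2 0 i *: B (br i) y.
  rewrite {1}[x]oct_sum BDl !BS; congr (_ + _); apply: eq_bigr => i _; exact: BZl.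
rewrite [B d d']BE (_ : (fun t => B (c t) (c' t)) = fun t => \sum_(i < 4) (c t).1 0 i *: B (bl i) (c' t)
  + \sum_(i < 4) (c t).2 0 i *: B (br i) (c' t)); last by apply/funext => t; exact: BE.
apply: cvgD; apply: cvg_bigsum => i; apply: cvgZ => //;
  by apply: (lin_cvg (BDr _) _ h') => k; exact: BZr.
Qed.
End Filter.

(** The derivative at 0 of a curve. Working with a relation avoids differentiability
side conditions in the product rules. *)
Definition der (V : normedModType R) (c : R -> V) (d : V) :=
  (fun h => h^-1 *: (c h - c 0)) @ (0 : R)^' --> d.

Section Der.
Variable V : normedModType R.
Implicit Types (c : R -> V) (d : V).

Lemma der_unique c d d' : der c d -> der c d' -> d = d'.
Proof. exact: cvg_unique. Qed.

Lemma near0N : \forall h \near (0 : R)^', h != 0.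
Proof. exact: nbhs_dnbhs_neq. Qed.

Lemma der_cvg c d : der c d -> c h @[h --> (0 : R)^'] --> c 0.
Proof.
move=> h; have : h0 *: (h0^-1 *: (c h0 - c 0)) + c 0 @[h0 --> (0 : R)^'] --> 0 *: d + c 0.
  apply: cvgD; last exact: cvg_cst.
  by apply: cvgZ => //; apply: cvg_trans (@nbhs_dnbhs _ (0 : R)) _.
rewrite scale0r add0r; apply: cvg_near; near=> t.
rewrite scalerA divff ?scale1r ?subrK //.
by near: t; exact: near0N.
Unshelve. all: by end_near. Qed.

Lemma der_near c c' d : (\forall h \near (0 : R), c h = c' h) -> der c d -> der c' d.
Proof.
move=> e h; apply: cvg_near h.
have e0 := nbhs_singleton e; rewrite /= in e0.
near=> t; rewrite -e0; congr (_ *: (_ - _)).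
by near: t; exact: nbhs_dnbhs e.
Unshelve. all: by end_near. Qed.

Lemma der_cst d : der (fun=> d) 0.
Proof.
rewrite /der (_ : (fun h => _) = fun=> 0); first exact: cvg_cst.
by apply/funext => h; rewrite subrr scaler0.
Qed.

Lemma derD c c' d d' : der c d -> der c' d' -> der (fun s => c s + c' s) (d + d').
Proof.
move=> h h'; apply: cvg_near (cvgD h h').
near=> t; rewrite /= -scalerDr; congr (_ *: _).
by rewrite opprD addrACA.
Unshelve. all: by end_near. Qed.

Lemma derZ (k : R) c d : der c d -> der (fun s => k *: c s) (k *: d).
Proof.
move=> h; have : k *: (t^-1 *: (c t - c 0)) @[t --> (0 : R)^'] --> k *: d.
  exact: cvgZl_tmp.
apply: cvg_near; near=> t.
by rewrite -scalerBr !scalerA mulrC.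
Unshelve. all: by end_near. Qed.

Lemma der_idZ c d : c t @[t --> (0 : R)^'] --> d -> der (fun s => s *: c s) d.
Proof.
apply: cvg_near; near=> t.
rewrite scale0r subr0 scalerA mulVf ?scale1r //.
by near: t; exact: near0N.
Unshelve. all: by end_near. Qed.

Lemma der_zero c d : (\forall h \near (0 : R), c h = 0) -> der c d -> d = 0.
Proof.
move=> h /(der_near h) h'; exact: der_unique h' (der_cst 0).
Qed.
End Der.

Lemma der_lin (V : normedModType R) (L : Oct R -> V) :
  (forall x y, L (x + y) = L x + L y) -> (forall k x, L (k *: x) = k *: L x) ->
  forall c d, der c d -> der (fun s => L (c s)) (L d).
Proof.
move=> LD LZ c d h; have h1 := lin_cvg LD LZ h; apply: cvg_near (h1 _); near=> t; rewrite LZ LD; congr (_ *: (_ + _)).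
by rewrite -scaleN1r LZ scaleN1r.
Unshelve. all: by end_near. Qed.

Lemma der_bil (V : normedModType R) (B : Oct R -> Oct R -> V) :
  (forall x y z, B (x + y) z = B x z + B y z) -> (forall k x y, B (k *: x) y = k *: B x y) ->
  (forall x y z, B x (y + z) = B x y + B x z) -> (forall k x y, B x (k *: y) = k *: B x y) ->
  forall c c' d d', der c d -> der c' d' ->
  der (fun s => B (c s) (c' s)) (B d (c' 0) + B (c 0) d').
Proof.
move=> BDl BZl BDr BZr c c' d d' h h'.
have h1 : B (t^-1 *: (c t - c 0)) (c' t) @[t --> (0 : R)^'] --> B d (c' 0).
  by apply: bil_cvg => //; exact: der_cvg h'.
have h2 : B (c 0) (t^-1 *: (c' t - c' 0)) @[t --> (0 : R)^'] --> B (c 0) d'.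
  by apply: bil_cvg => //; exact: cvg_cst.
apply: cvg_near (cvgD h1 h2); near=> t.
rewrite /= BZl BZr -scalerDr; congr (_ *: _).
have BNl x y : B (- x) y = - B x y by rewrite -scaleN1r BZl scaleN1r.
have BNr x y : B x (- y) = - B x y by rewrite -scaleN1r BZr scaleN1r.
by rewrite BDl BNl BDr BNr addrA subrK.
Unshelve. all: by end_near. Qed.

Lemma der_cross c c' d d' : der c d -> der c' d' ->
  der (fun s => cross (c s) (c' s)) (cross d (c' 0) + cross (c 0) d').
Proof.
by apply: der_bil; [exact: crossDl|exact: crossZl|exact: crossDr|exact: crossZr].
Qed.

Lemma der_odot c c' d d' : der c d -> der c' d' ->
  der (fun s => odot (c s) (c' s) : R^o) (odot d (c' 0) + odot (c 0) d').
Proof.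
apply: (@der_bil R^o (@odot R)); [exact: odotDl|exact: odotZl|exact: odotDr|exact: odotZr].
Qed.

End Curves.

(** * Mean value estimates *)

Section MeanValue.
Variable R : realType.
Implicit Types u v w p r : Oct R.

Lemma der_is_derive (phi : R -> R) (t d : R) :
  der (fun s => phi (t + s) : R^o) d -> is_derive (t : R^o) (1 : R^o) (phi : R^o -> R^o) d.
Proof.
move=> h.
have h1 : h0^-1 *: (((phi : R^o -> R^o) \o shift (t : R^o)) (h0 *: (1 : R^o)) - phi t)
    @[h0 --> (0 : R)^'] --> (d : R^o).
  apply: cvg_near h; near=> s; rewrite /= addr0; congr (_ *: (phi _ - _)).
  by rewrite [s *: _]mulr1 addrC.
split; first by apply/cvg_ex; exists d.
exact: cvg_lim h1.
Unshelve. all: by end_near. Qed.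

Lemma mvt0 (phi dphi : R -> R) (a : R) :
  (forall t, `|t| <= `|a| -> der (fun s => phi (t + s) : R^o) (dphi t)) ->
  exists2 x, `|x| <= `|a| & phi a - phi 0 = a * dphi x.
Proof.
move=> h.
have D t : `|t| <= `|a| -> is_derive (t : R^o) (1 : R^o) (phi : R^o -> R^o) (dphi t).
  by move=> /h; exact: der_is_derive.
have C (b c : R) : (forall t, t \in `[b, c] -> `|t| <= `|a|) ->
    {within `[b, c], continuous phi}.
  move=> H; apply: derivable_within_continuous => x /H /D [hx _].
  exact: hx.
have [a0|a0] := leP 0 a.
  have S t : t \in `[0, a] -> `|t| <= `|a|.
    by rewrite in_itv /= => /andP [t0 ta]; rewrite !ger0_norm.
  have [|x xI e] := @MVT_segment R phi dphi _ _ a0 _ (C _ _ S).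
    by move=> x xI; apply: D; apply: S; exact: subset_itv_oo_cc xI.
  by exists x; [exact: S|rewrite e subr0 mulrC].
have S t : t \in `[a, 0] -> `|t| <= `|a|.
  rewrite in_itv /= => /andP [t0 ta]; rewrite !ler0_norm //; last exact: ltW.
  by rewrite lerN2.
have [|x xI e] := @MVT_segment R phi dphi _ _ (ltW a0) _ (C _ _ S).
  by move=> x xI; apply: D; apply: S; exact: subset_itv_oo_cc xI.
by exists x; [exact: S|rewrite -opprB e sub0r mulrN opprK mulrC].
Qed.

Lemma mvt_line (F Fr : Oct R -> R) q r (a : R) :
  (forall t, `|t| <= `|a| -> der (fun s => F (q + t *: r + s *: r) : R^o) (Fr (q + t *: r))) ->
  exists2 x, `|x| <= `|a| & F (q + a *: r) - F q = a * Fr (q + x *: r).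
Proof.
move=> h; have [t /h|x xa e] := @mvt0 (fun t => F (q + t *: r)) (fun t => Fr (q + t *: r)) a.
  by congr der; apply/funext => s; rewrite scalerDl addrA.
by exists x => //; rewrite -e scale0r addr0.
Qed.

Lemma near_box (N : set (Oct R)) p r : nbhs p N ->
  exists2 e : R, 0 < e & forall q (a : R), `|p - q| < e -> `|a| < e -> N (q + a *: r).
Proof.
move=> /nbhs_ballP [d /= d0 dN].
have r0 : 0 < 2 * (`|r| + 1) by rewrite mulr_gt0 // ltr_pwDr.
pose e := Num.min (d / 2) (d / (2 * (`|r| + 1))).
exists e; first by rewrite lt_min !divr_gt0.
move=> q a; rewrite !lt_min => /andP [pq _] /andP [_ ar]; apply: dN.
rewrite -ball_normE /ball_ /= opprD addrA (le_lt_trans (ler_normB _ _)) //.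
rewrite normrZ [ltRHS]splitr ltr_leD //.
apply: le_trans (_ : `|a| * (`|r| + 1) <= _).
  by rewrite ler_wpM2l // lerDl.
rewrite -ler_pdivlMr; last by rewrite ltr_pwDr.
by apply: ltW; apply: lt_le_trans ar _; rewrite -mulrA -invfM.
Qed.

Section Scalar.
Variables (F Fr : Oct R -> R) (U : set (Oct R)) (p r : Oct R).
Hypotheses (oU : open U) (Up : U p).
Hypothesis dF : forall x, U x -> der (fun s => F (x + s *: r) : R^o) (Fr x).
Hypothesis cF : {for p, continuous (Fr : Oct R -> R^o)}.

(** Continuity of the derivative in direction r makes difference quotients converge
uniformly, which allows both the base point and the step to vary. *)
Lemma slope_cvg_scalar (q : R -> Oct R) (a : R -> R) :
  q s @[s --> (0 : R)^'] --> p -> a s @[s --> (0 : R)^'] --> (0 : R) ->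
  (\forall s \near (0 : R)^', a s != 0) ->
  (a s)^-1 * (F (q s + a s *: r) - F (q s)) @[s --> (0 : R)^'] --> Fr p.
Proof.
move=> qp a0 an; apply/cvgrPdist_lt => eps eps0.
have N : nbhs p [set x | U x /\ `|Fr p - Fr x| < eps].
  apply: filterI; first exact: open_nbhs_nbhs.
  by move/cvgrPdist_lt: cF; apply.
have [e e0 box] := near_box r N.
near=> s.
have pq : `|p - q s| < e by near: s; move/cvgrPdist_lt: qp; apply.
have ae : `|a s| < e.
  have : `|0 - a s| < e by near: s; move/cvgrPdist_lt: a0; apply.
  by rewrite sub0r normrN.
have as0 : a s != 0 by near: s.
have [t ta|x xa e1] := @mvt_line F Fr (q s) r (a s).
  by apply: dF; have [] := box _ _ pq (le_lt_trans ta ae).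
rewrite e1 mulKf //.
by have [] := box _ _ pq (le_lt_trans xa ae).
Unshelve. all: by end_near. Qed.
End Scalar.

Lemma coord1_lin i : (forall x y : Oct R, (x + y).1 0 i = x.1 0 i + y.1 0 i) /\
  (forall k (x : Oct R), (k *: x).1 0 i = k * x.1 0 i).
Proof. by split=> *; rewrite /= mxE. Qed.
Lemma coord2_lin i : (forall x y : Oct R, (x + y).2 0 i = x.2 0 i + y.2 0 i) /\
  (forall k (x : Oct R), (k *: x).2 0 i = k * x.2 0 i).
Proof. by split=> *; rewrite /= mxE. Qed.

Lemma coords_cvg (c : R -> Oct R) (d : Oct R) :
  (forall L : Oct R -> R^o, (forall x y, L (x + y) = L x + L y) ->
    (forall k x, L (k *: x) = k *: L x) -> L (c s) @[s --> (0 : R)^'] --> L d) ->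
  c s @[s --> (0 : R)^'] --> d.
Proof.
move=> h; apply: coord_cvg => i.
  by have [l1 l2] := coord1_lin i; exact: (h (fun x => x.1 0 i)).
by have [l1 l2] := coord2_lin i; exact: (h (fun x => x.2 0 i)).
Qed.

Lemma lin_cont (L : Oct R -> R^o) (f : Oct R -> Oct R) p :
  (forall x y, L (x + y) = L x + L y) -> (forall k x, L (k *: x) = k *: L x) ->
  {for p, continuous f} -> {for p, continuous (fun x => L (f x))}.
Proof. by move=> LD LZ h; exact: (lin_cvg LD LZ h). Qed.

Section Vect.
Variables (f fr : Oct R -> Oct R) (U : set (Oct R)) (p r : Oct R).
Hypotheses (oU : open U) (Up : U p).
Hypothesis df : forall x, U x -> der (fun s => f (x + s *: r)) (fr x).
Hypothesis cf : {for p, continuous fr}.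

Lemma slope_cvg (q : R -> Oct R) (a : R -> R) :
  q s @[s --> (0 : R)^'] --> p -> a s @[s --> (0 : R)^'] --> (0 : R) ->
  (\forall s \near (0 : R)^', a s != 0) ->
  (a s)^-1 *: (f (q s + a s *: r) - f (q s)) @[s --> (0 : R)^'] --> fr p.
Proof.
move=> qp a0 an; apply: coords_cvg => L LD LZ.
have LB x y : L (x - y) = L x - L y by rewrite LD -scaleN1r LZ scaleN1r.
have := @slope_cvg_scalar (fun x => L (f x)) (fun x => L (fr x)) U p r oU Up _ _ q a qp a0 an.
move=> H; have {}H := H _ (lin_cont LD LZ cf).
apply: cvg_near (H _).
  by near=> s; rewrite LZ LB.
by move=> x Ux; apply: (der_lin LD LZ); exact: df.
Unshelve. all: by end_near. Qed.
End Vect.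

Lemma cvg_line p v : p + s *: v @[s --> (0 : R)^'] --> p.
Proof.
have : p + s *: v @[s --> (0 : R)^'] --> p + 0 *: v.
  apply: cvgD; first exact: cvg_cst.
  by apply: cvgZr_tmp; apply: cvg_trans (@nbhs_dnbhs _ (0 : R)) _.
by rewrite scale0r addr0.
Qed.

Lemma cvg_id0 : s @[s --> (0 : R)^'] --> (0 : R).
Proof. by apply: cvg_trans (@nbhs_dnbhs _ (0 : R)) _. Qed.

(** The second difference quotient converges to the mixed derivative, by two
applications of the mean value theorem. Its symmetry in v and w gives schwarz. *)
Lemma second_diff (F Fw Fvw : Oct R -> R) (U : set (Oct R)) p v w :
  open U -> U p ->
  (forall x, U x -> der (fun s => F (x + s *: w) : R^o) (Fw x)) ->
  (forall x, U x -> der (fun s => Fw (x + s *: v) : R^o) (Fvw x)) ->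
  {for p, continuous (Fvw : Oct R -> R^o)} ->
  s^-1 * (s^-1 * (F (p + s *: v + s *: w) - F (p + s *: v) - (F (p + s *: w) - F p)))
    @[s --> (0 : R)^'] --> Fvw p.
Proof.
move=> oU Up d1 d2 c2; apply/cvgrPdist_lt => eps eps0.
have N : nbhs p [set x | U x /\ `|Fvw p - Fvw x| < eps].
  apply: filterI; first exact: open_nbhs_nbhs.
  by move/cvgrPdist_lt: c2; apply.
have [e e0 box] := near_box v N.
have N2 : nbhs p [set x | `|p - x| < e].
  have /cvgrPdist_lt : x @[x --> p] --> p by exact: cvg_id.
  by apply.
have [e' e'0 box'] := near_box w N2.
near=> s.
have s0 : s != 0 by near: s; exact: nbhs_dnbhs_neq.
have se : `|s| < e by near: s; exact: dnbhs0_lt.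
have se' : `|s| < e' by near: s; exact: dnbhs0_lt.
have pp : `|p - p| < e' by rewrite subrr normr0.
have bx a b : `|a| <= `|s| -> `|b| <= `|s| ->
    U (p + a *: w + b *: v) /\ `|Fvw p - Fvw (p + a *: w + b *: v)| < eps.
  move=> ha hb; apply: box; last exact: le_lt_trans hb se.
  by apply: box' => //; exact: le_lt_trans ha se'.
have sB (a b c d : R) : a - b - (c - d) = (a - c) - (b - d) by ring.
have [t ts|x xs e1] := @mvt0 (fun t => F (p + s *: v + t *: w) - F (p + t *: w))
   (fun t => Fw (p + s *: v + t *: w) - Fw (p + t *: w)) s.
  have U1 : U (p + s *: v + t *: w) by rewrite addrAC; have [] := bx t s ts (lexx _).
  have U2 : U (p + t *: w).
    by have [] := bx t 0 ts _; rewrite ?normr0 // scale0r addr0.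
  have := derD (d1 _ U1) (@derZ _ _ (-1) _ _ (d1 _ U2)).
  rewrite scaleN1r; congr der; apply/funext => h.
  by rewrite scaleN1r !scalerDl !addrA.
have [t ts|y ys e2] := @mvt_line Fw Fvw (p + x *: w) v s.
  by apply: d2; have [] := bx x t xs ts.
rewrite sB; move: e1; rewrite !scale0r !addr0 => ->.
rewrite mulKf // [p + s *: v + _]addrAC e2 mulKf //.
by have [] := bx x y xs ys.
Unshelve. all: by end_near. Qed.

End MeanValue.

(** * Second-order directional derivatives *)

Section TwiceDifferentiable.
Variable R : realType.
Implicit Types u v w p r x : Oct R.

Lemma derivable_der (f : Oct R -> Oct R) x v : derivable f x v ->
  der (fun s => f (x + s *: v)) ('D_v f x).
Proof.
move=> h; have h1 : h0^-1 *: ((f \o shift x) (h0 *: v) - f x) @[h0 --> (0 : R)^'] --> 'D_v f x.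
  exact: h.
apply: cvg_near h1; near=> s; rewrite scale0r addr0 /=.
by rewrite [s *: v + x]addrC.
Unshelve. all: by end_near. Qed.

(** Twice continuous differentiability, stated by directional derivatives as they
occur in Ck_on. *)
Definition C2 (U : set (Oct R)) (f : Oct R -> Oct R) := open U /\
  forall x, U x -> forall v w,
  [/\ der (fun s => f (x + s *: v)) ('D_v f x),
      der (fun s => 'D_v f (x + s *: w)) ('D_w ('D_v f) x),
      {for x, continuous ('D_v f)} & {for x, continuous ('D_w ('D_v f))}].

Lemma C2_of_Cinf U f : open U -> Cinf_on U f -> C2 U f.
Proof.
move=> oU h; split; [exact: oU|move=> x Ux v w].
have [d1 h1] := h 1%N; have [_ h2] := h 2%N; have [d2 h3] := h2 v.
split.
- by apply: derivable_der; exact: d1.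
- by apply: derivable_der; exact: d2.
- exact: h1.
- exact: h3.
Qed.

Variables (U : set (Oct R)) (f : Oct R -> Oct R).
Hypothesis hf : C2 U f.

Let oU : open U. Proof. by case: hf. Qed.

Lemma C2_d1 x v : U x -> der (fun s => f (x + s *: v)) ('D_v f x).
Proof. by move=> Ux; have [_ /(_ x Ux v v) []] := hf. Qed.
Lemma C2_d2 x v w : U x -> der (fun s => 'D_v f (x + s *: w)) ('D_w ('D_v f) x).
Proof. by move=> Ux; have [_ /(_ x Ux v w) []] := hf. Qed.
Lemma C2_c1 x v : U x -> {for x, continuous ('D_v f)}.
Proof. by move=> Ux; have [_ /(_ x Ux v v) []] := hf. Qed.
Lemma C2_c2 x v w : U x -> {for x, continuous ('D_w ('D_v f))}.
Proof. by move=> Ux; have [_ /(_ x Ux v w) []] := hf. Qed.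

Arguments C2_d1 [x] v _.
Arguments C2_c1 [x] v _.
Arguments C2_d2 [x] v w _.
Arguments C2_c2 [x] v w _.

Lemma derD_gen (F Fv Fw : Oct R -> Oct R) x v w : U x ->
  der (fun s => F (x + s *: v)) (Fv x) ->
  (forall y, U y -> der (fun s => F (y + s *: w)) (Fw y)) ->
  {for x, continuous Fw} ->
  der (fun s => F (x + s *: (v + w))) (Fv x + Fw x).
Proof.
move=> Ux dv dw cw.
have h := slope_cvg oU Ux dw cw (@cvg_line R x v) (@cvg_id0 R) (@near0N R).
apply: cvg_near (cvgD dv h); near=> s.
rewrite /= !scale0r !addr0 -scalerDr; congr (_ *: _).
by rewrite scalerDr [x + (_ + _)]addrA [LHS]addrC addrA subrK.
Unshelve. all: by end_near. Qed.

Lemma D_add x v w : U x -> 'D_(v + w) f x = 'D_v f x + 'D_w f x.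
Proof.
move=> Ux; apply: (der_unique (C2_d1 (v + w) Ux)).
apply: (@derD_gen f ('D_v f) ('D_w f) x v w Ux (C2_d1 v Ux)) => [y Uy|].
  exact: C2_d1.
exact: C2_c1.
Qed.

Lemma D_scale x k v : U x -> 'D_(k *: v) f x = k *: 'D_v f x.
Proof.
move=> Ux; have [->|k0] := eqVneq k 0.
  rewrite !scale0r; apply: (der_unique (C2_d1 0 Ux)).
  rewrite (_ : (fun s => _) = fun=> f x); first exact: der_cst.
  by apply/funext => s; rewrite scaler0 addr0.
apply: (der_unique (C2_d1 (k *: v) Ux)).
have c0 : s * k @[s --> (0 : R)^'] --> (0 : R).
  have : s * k @[s --> (0 : R)^'] --> 0 * k by apply: cvgM; [exact: cvg_id0|exact: cvg_cst].
  by rewrite mul0r.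
have hn : \forall s \near (0 : R)^', s * k != 0.
  near=> s; rewrite mulf_neq0 //; near: s; exact: near0N.
have h : (s * k)^-1 *: (f (x + (s * k) *: v) - f x) @[s --> (0 : R)^'] --> 'D_v f x.
  apply: (@slope_cvg _ f ('D_v f) U x v oU Ux _ _ (fun=> x) (fun s => s * k)).
  - by move=> y Uy; exact: C2_d1.
  - exact: C2_c1.
  - exact: cvg_cst.
  - exact: c0.
  - exact: hn.
have {}h : k *: ((s * k)^-1 *: (f (x + (s * k) *: v) - f x)) @[s --> (0 : R)^']
    --> k *: 'D_v f x by exact: cvgZl_tmp.
apply: cvg_near h; near=> s.
have s0 : s != 0 by near: s; exact: near0N.
rewrite /= scale0r addr0 !scalerA; congr (_ *: _).
by rewrite invfM mulrCA divff ?mulr1.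
Unshelve. all: by end_near. Qed.

(** Null curves p + s v + s^2 r are parabolas; their second-order part does not
contribute to a first derivative. *)
Lemma der_quad (F Fv Fr : Oct R -> Oct R) x v r : U x ->
  der (fun s => F (x + s *: v)) (Fv x) ->
  (forall y, U y -> der (fun s => F (y + s *: r)) (Fr y)) ->
  {for x, continuous Fr} ->
  der (fun s => F (x + s *: v + (s * s) *: r)) (Fv x).
Proof.
move=> Ux dv dr cr.
have c0 : s * s @[s --> (0 : R)^'] --> (0 : R).
  have : s * s @[s --> (0 : R)^'] --> (0 : R) * 0 by apply: cvgM; exact: cvg_id0.
  by rewrite mul0r.
have hn : \forall s \near (0 : R)^', s * s != 0.
  near=> s; rewrite mulf_neq0 //; near: s; exact: near0N.
have h : (s * s)^-1 *: (F (x + s *: v + (s * s) *: r) - F (x + s *: v)) @[s --> (0 : R)^']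
    --> Fr x by apply: (slope_cvg oU Ux dr cr) => //; exact: cvg_line.
have h2 : s *: ((s * s)^-1 *: (F (x + s *: v + (s * s) *: r) - F (x + s *: v)))
    @[s --> (0 : R)^'] --> 0 *: Fr x by apply: cvgZ => //; exact: cvg_id0.
rewrite scale0r in h2.
have h3 : s^-1 *: (F (x + s *: v) - F (x + 0 *: v)) +
    s *: ((s * s)^-1 *: (F (x + s *: v + (s * s) *: r) - F (x + s *: v)))
    @[s --> (0 : R)^'] --> Fv x.
  by rewrite -[Fv x]addr0; apply: cvgD; [exact: dv|exact: h2].
apply: cvg_near h3; near=> s.
have s0 : s != 0 by near: s; exact: near0N.
rewrite /= mulr0 !scale0r !addr0 scalerA invfM mulrA divff // mul1r -scalerDr.
by congr (_ *: _); rewrite [LHS]addrC addrA subrK.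
Unshelve. all: by end_near. Qed.

Lemma der_f_quad x v r : U x -> der (fun s => f (x + s *: v + (s * s) *: r)) ('D_v f x).
Proof.
move=> Ux; apply: (@der_quad f ('D_v f) ('D_r f) x v r Ux (C2_d1 v Ux)) => [y Uy|]; last exact: (C2_c1 r Ux).
exact: C2_d1.
Qed.

Lemma der_D_quad x a v r : U x ->
  der (fun s => 'D_a f (x + s *: v + (s * s) *: r)) ('D_v ('D_a f) x).
Proof.
move=> Ux; apply: (@der_quad ('D_a f) ('D_v ('D_a f)) ('D_r ('D_a f)) x v r Ux (C2_d2 a v Ux)) => [y Uy|]; last exact: (C2_c2 a r Ux).
exact: C2_d2.
Qed.

Arguments der_D_quad [x] a v r _.

Lemma near_quad x v r : U x -> \forall s \near (0 : R), U (x + s *: v + (s * s) *: r).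
Proof.
move=> Ux.
have : x + s *: v + (s * s) *: r @[s --> (0 : R)] --> x + 0 *: v + (0 * 0) *: r.
  by apply: cvgD; [apply: cvgD; [exact: cvg_cst|apply: cvgZr_tmp; exact: cvg_id]
    |apply: cvgZr_tmp; apply: cvgM; exact: cvg_id].
rewrite mul0r !scale0r !addr0 => /(_ U); apply.
exact: open_nbhs_nbhs.
Qed.

Lemma der_Dvar_quad x a b c v r : U x ->
  der (fun s => 'D_(a + s *: b + (s * s) *: c) f (x + s *: v + (s * s) *: r))
      ('D_v ('D_a f) x + 'D_b f x).
Proof.
move=> Ux.
have hb : der (fun s => s *: 'D_b f (x + s *: v + (s * s) *: r)) ('D_b f x).
  apply: der_idZ; have := der_cvg (der_D_quad b v r Ux).
  by rewrite mulr0 !scale0r !addr0.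
have hc : der (fun s => s *: (s *: 'D_c f (x + s *: v + (s * s) *: r))) 0.
  apply: der_idZ; rewrite -(scale0r ('D_c f (x + 0 *: v + (0 * 0) *: r))).
  by apply: cvgZ; [exact: cvg_id0|exact: der_cvg (der_D_quad c v r Ux)].
have h := derD (derD (der_D_quad a v r Ux) hb) hc; rewrite addr0 in h.
apply: der_near h.
near=> s; have Us : U (x + s *: v + (s * s) *: r) by near: s; exact: near_quad.
by rewrite !D_add // !D_scale // scalerA.
Unshelve. all: by end_near. Qed.

(** Both mixed derivatives are the limit of the same second difference quotient. *)
Lemma schwarz x v w : U x -> 'D_v ('D_w f) x = 'D_w ('D_v f) x.
Proof.
move=> Ux.
have S L : (forall x y, L (x + y) = L x + L y) -> (forall k x, L (k *: x) = k *: L x) ->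
    forall v w, s^-1 * (s^-1 * (L (f (x + s *: v + s *: w)) - L (f (x + s *: v))
      - (L (f (x + s *: w)) - L (f x)))) @[s --> (0 : R)^'] --> (L ('D_v ('D_w f) x) : R^o).
  move=> LD LZ {}v {}w; apply: (@second_diff _ (fun y => L (f y))
    (fun y => L ('D_w f y)) (fun y => L ('D_v ('D_w f) y)) U) => //.
  - by move=> y Uy; apply: (der_lin LD LZ); exact: C2_d1.
  - by move=> y Uy; apply: (der_lin LD LZ); exact: C2_d2.
  - by apply: (lin_cont LD LZ); exact: C2_c2.
have E L : (forall x y, L (x + y) = L x + L y) -> (forall k x, L (k *: x) = k *: L x) ->
    L ('D_v ('D_w f) x) = L ('D_w ('D_v f) x) :> R^o.
  move=> LD LZ; have h1 := S L LD LZ v w; have h2 := S L LD LZ w v.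
  have h3 : s^-1 * (s^-1 * (L (f (x + s *: v + s *: w)) - L (f (x + s *: v))
      - (L (f (x + s *: w)) - L (f x)))) @[s --> (0 : R)^'] --> (L ('D_w ('D_v f) x) : R^o);
    last exact: (cvg_unique _ h1 h3).
  apply: cvg_near h2; near=> s.
  congr (_ * (_ * _)); rewrite [x + s *: w + _]addrAC.
  move: (L (f (x + s *: v + s *: w))) (L (f (x + s *: v))) (L (f (x + s *: w))) (L (f x)).
  by move=> a b c d; ring.
apply: octP; [exact: (E (fun x => x.1 0 0) (coord1_lin _ 0).1 (coord1_lin _ 0).2)
|exact: (E (fun x => x.1 0 1) (coord1_lin _ 1).1 (coord1_lin _ 1).2)
|exact: (E (fun x => x.1 0 2) (coord1_lin _ 2).1 (coord1_lin _ 2).2)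
|exact: (E (fun x => x.1 0 3) (coord1_lin _ 3).1 (coord1_lin _ 3).2)
|exact: (E (fun x => x.2 0 0) (coord2_lin _ 0).1 (coord2_lin _ 0).2)
|exact: (E (fun x => x.2 0 1) (coord2_lin _ 1).1 (coord2_lin _ 1).2)
|exact: (E (fun x => x.2 0 2) (coord2_lin _ 2).1 (coord2_lin _ 2).2)
|exact: (E (fun x => x.2 0 3) (coord2_lin _ 3).1 (coord2_lin _ 3).2)].
Unshelve. all: by end_near. Qed.
End TwiceDifferentiable.

(** * Second-order jets of tangential maps *)

Section JetAlgebra.
Variable R : realType.
Implicit Types u v w p r x : Oct R.
Implicit Type psi : G2' R.

(** Here g, W, N, K, Z stand for the value of a map at e1 and its derivatives in the
directions f2, f3, h, e3, and X1, X2, Y involve second derivatives, with the first-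
order relations that hold when incident pairs are preserved. The conclusion says
that Z has the same products with g, W, N as e3 has with e1, f2, f3, up to scaling.
*)
Lemma jet_algebra (g W N K Z X1 X2 Y : Oct R) (m : R) :
  nul g -> ImO W -> ImO N -> ImO K -> ImO Z -> ImO X1 -> ImO X2 -> ImO Y ->
  cross g W = 0 -> cross g N = 0 -> cross W N = m *: g -> m != 0 ->
  cross g K = (- m) *: g -> cross g X1 = (- m) *: g -> cross g X2 = 0 ->
  cross W K + cross g (Y + 2 *: Z) = - (cross X2 N + cross W X1) ->
  cross K W + cross g (Y - Z) = 0 ->
  [/\ odot g Z = 0, odot W Z = 0 & odot N Z = m ^+ 2 / 2].
Proof.
move=> ng hW hN hK hZ hX1 hX2 hY gW gN WN m0 gK gX1 gX2 e4 e5.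
have [hg nng g0] := ng.
have [gW0 WW] := Ann_perp hg hW g0 nng gW; have [gN0 NN] := Ann_perp hg hN g0 nng gN.
have NW : cross N W = (- m) *: g by rewrite crossC // WN scaleNr.
have Kg : cross K g = m *: g by rewrite crossC // gK scaleNr opprK.
have Wg : cross W g = 0 by rewrite crossC // gW oppr0.
have Ng : cross N g = 0 by rewrite crossC // gN oppr0.
have WNo : odot W N = 0 by exact: (Ann_iso ng).
have smg0 k : k *: g = 0 -> k = 0.
  by move=> /eqP; rewrite scaler_eq0 (negbTE g0) orbF => /eqP.
have gK0 : odot g K = 0.
  have := null_cross hg hK nng; rewrite gK crossZr crossxx // scaler0.
  by move=> /esym/smg0.
have WK0 : odot W K = 0.
  have := cross_cross hW hK hg.
  rewrite Wg Kg crossZr Wg scaler0 cross0r addr0 (odotC W g) gW0 (odotC K g) gK0.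
  by rewrite !scale0r !add0r => /esym/smg0 => h; lra.
have NK0 : odot N K = 0.
  have := cross_cross hN hK hg.
  rewrite Ng Kg crossZr Ng scaler0 cross0r addr0 (odotC N g) gN0 (odotC K g) gK0.
  by rewrite !scale0r !add0r => /esym/smg0 => h; lra.
have hKW := ImO_cross K W.
have gKW : cross g (cross K W) = 0.
  have := cross_cross hg hK hW.
  by rewrite gW cross0r addr0 gW0 (odotC K W) WK0 gK0 mulr0 oppr0 !scale0r !addr0.
have [x [y [z eKW]]] := Ann_span ng hW hN hKW gW gN gKW WN m0.
have z0 : z = 0.
  have : cross W (cross K W) = 0.
    by rewrite (crossC hK hW) crossNr null_cross // WK0 scale0r oppr0.
  rewrite eKW !crossDr !crossZr Wg crossxx // WN !scaler0 !add0r scalerA.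
  by move=> /smg0/eqP; rewrite mulf_eq0 (negbTE m0) orbF => /eqP.
have ym : y = - m.
  have := cross_cross hK hN hW.
  rewrite NW eKW z0 scale0r addr0 !crossDr !crossZr Kg Ng NW scaler0 add0r.
  rewrite (odotC K W) WK0 (odotC N W) WNo (odotC K N) NK0 mulr0 oppr0 !scale0r !addr0.
  rewrite !scalerA -scalerDl => /smg0 h; apply: (mulfI m0); lra.
have [a ea] : exists a, cross X2 N = a *: g by exact: (Ann_cross ng).
have [b eb] : exists b, cross W (X1 - K) = b *: g.
  apply: (Ann_cross ng) => //; first exact: ImOB.
  by rewrite crossDr crossNr gX1 gK subrr.
have gZ : cross g Z = (- m) *: W + (x - (a + b) / 3) *: g.
  have WX1 : cross W X1 = b *: g + cross W K.
    by rewrite -eb -crossDr subrK.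
  have WK : cross W K = - cross K W by rewrite crossC.
  move: e4 e5; rewrite !crossDr crossNr crossZr WX1 ea WK eKW z0 scale0r addr0 ym.
  move: (cross g Y) (cross g Z) => P Q e4 e5.
  have -> : Q = 3^-1 *: ((- (x *: g + - m *: W) + (P + 2 *: Q)) - (x *: g + - m *: W + (P - Q)))
       + (2 / 3) *: (x *: g + - m *: W).
    by apply: linear_ext => L LD LZ LN L0; rewrite !(LD, LZ, LN, L0); field.
  by rewrite e4 e5; apply: linear_ext => L LD LZ LN L0; rewrite !(LD, LZ, LN, L0); field.
have gZ0 : odot g Z = 0.
  have := null_cross hg hZ nng; rewrite gZ crossDr !crossZr gW crossxx // !scaler0 addr0.
  by move=> /esym/smg0.
have Zg : cross Z g = m *: W - (x - (a + b) / 3) *: g.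
  by rewrite crossC // gZ opprD -scaleNr opprK.
split=> //.
- have := cross_cross hW hZ hg.
  rewrite Wg cross0r addr0 (odotC W g) gW0 (odotC Z g) gZ0 !scale0r !add0r.
  rewrite Zg crossDr crossNr !crossZr crossxx // Wg !scaler0 oppr0 addr0.
  by move=> /esym/smg0 h; lra.
- have := cross_cross hN hZ hg.
  rewrite Ng cross0r addr0 (odotC N g) gN0 (odotC Z g) gZ0 !scale0r !add0r.
  rewrite Zg crossDr crossNr !crossZr NW Ng !scaler0 oppr0 addr0 scalerA.
  move=> /eqP; rewrite -subr_eq0 -scalerBl => /eqP/smg0 h.
  by rewrite expr2; lra.
Qed.

(** A lift preserving annihilators infinitesimally: it maps null vectors to null
vectors, Ann(p) into Ann(f p), and independent directions of Ann(p) / p to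
independent ones. *)
Definition tangential (U : set (Oct R)) (f : Oct R -> Oct R) :=
  [/\ C2 U f,
      forall p, U p -> nul p -> nul (f p),
      forall p w, U p -> nul p -> ImO w -> cross p w = 0 ->
        ImO ('D_w f p) /\ cross (f p) ('D_w f p) = 0 &
      forall p w n, U p -> nul p -> ImO w -> ImO n -> cross p w = 0 ->
        cross p n = 0 -> cross w n != 0 -> cross ('D_w f p) ('D_n f p) != 0].

Lemma der_ImO (c : R -> Oct R) d : (\forall s \near (0 : R), ImO (c s)) -> der c d -> ImO d.
Proof.
move=> h dc; apply: (@der_zero R R^o (fun s => odot (c s) (oone R))).
  by near=> s; exact: (near h).
by apply: (@der_lin R R^o (fun x => odot x (oone R))) dc; [move=> *; exact: odotDl|move=> *; exact: odotZl].
Unshelve. all: by end_near. Qed.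

End JetAlgebra.

Section JetGeometry.
Variable R : realType.
Implicit Types u v w p r x : Oct R.
Implicit Type psi : G2' R.

(** The root subgroup that moves e1 along the annihilator line through f2. It
transports identities at e1 to all points of the line, so that they can be
differentiated. *)
Lemma g2_shear (t : R) : exists tau : G2' R,
  [/\ tau (e1 R) = e1 R + t *: f2 R, tau (f2 R) = f2 R, tau (e3 R) = e3 R,
      tau (f3 R) = f3 R + t *: hh R + (t * t) *: e3 R &
      tau (hh R) = hh R + t *: (2 *: e3 R)].
Proof.
have [||||||||||tau [t1 t2 t3]] := @g2_triple R (zorn 1 0 0 0 0 t 0)
   (zorn 0 1 0 0 (- t) 0 0) (e3 R); try exact: ImO_zorn;
   try by rewrite odot_zorn; lra.
  by rewrite cross_zorn odot_zorn; lra.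
exists tau.
have tf2 : tau (f2 R) = f2 R by rewrite g2_f2 t3 t1 cross_zorn; congr zorn; lra.
have tf1 : tau (f1 R) = zorn 0 0 0 0 1 0 0 by rewrite g2_f1 t2 t3 cross_zorn; congr zorn; lra.
split=> //.
- by rewrite t1 zornZ zornD; congr zorn; ring.
- by rewrite g2_f3 t1 t2 cross_zorn !zornZ !zornD; congr zorn; field.
- by rewrite g2_hh t1 tf1 cross_zorn !zornZ !zornD; congr zorn; field.
Qed.

(** The derivatives of a tangential map that are used, with D v for the first and B
v w for the second directional derivatives. Keeping them as abstract operators
isolates the second-order argument from the analysis. *)
Record jets (U : set (Oct R)) (f : Oct R -> Oct R) (D : Oct R -> Oct R -> Oct R)
    (B : Oct R -> Oct R -> Oct R -> Oct R) : Prop := Jets {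
  j_near : forall x v r, U x -> \forall s \near (0 : R), U (x + s *: v + (s * s) *: r);
  j_f : forall x v r, U x -> der (fun s => f (x + s *: v + (s * s) *: r)) (D v x);
  j_D : forall x a v r, U x ->
    der (fun s => D a (x + s *: v + (s * s) *: r)) (B a v x);
  j_var : forall x a b c v r, U x ->
    der (fun s => D (a + s *: b + (s * s) *: c) (x + s *: v + (s * s) *: r))
        (B a v x + D b x);
  j_scale : forall x k v, U x -> D (k *: v) x = k *: D v x;
  j_sym : forall x v w, U x -> B v w x = B w v x;
  j_nul : forall p, U p -> nul p -> nul (f p);
  j_tan : forall p w, U p -> nul p -> ImO w -> cross p w = 0 ->
    ImO (D w p) /\ cross (f p) (D w p) = 0;
  j_ind : forall p w n, U p -> nul p -> ImO w -> ImO n -> cross p w = 0 ->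
    cross p n = 0 -> cross w n != 0 -> cross (D w p) (D n p) != 0 }.

Arguments j_f [U f D B] _ [x] v r _.
Arguments j_D [U f D B] _ [x] a v r _.
Arguments j_var [U f D B] _ [x] a b c v r _.
Arguments j_scale [U f D B] _ [x] k v _.
Arguments j_sym [U f D B] _ [x] v w _.

Lemma tangential_jets U f : tangential U f ->
  jets U f (fun v => 'D_v f) (fun v w => 'D_w ('D_v f)).
Proof.
move=> [hC fn fD fI]; split.
- by move=> x v r; exact: (near_quad hC).
- by move=> x v r; exact: (der_f_quad hC).
- by move=> x a v r; exact: (der_D_quad hC).
- by move=> x a b c v r; exact: (der_Dvar_quad hC).
- by move=> x k v; exact: (D_scale hC).
- by move=> x v w; exact: (schwarz hC).
- exact: fn.
- exact: fD.
- exact: fI.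
Qed.

Section Jet.
Variables (U : set (Oct R)) (f : Oct R -> Oct R) (D : Oct R -> Oct R -> Oct R)
  (B : Oct R -> Oct R -> Oct R -> Oct R).
Hypothesis hC : jets U f D B.

Let fn p : U p -> nul p -> nul (f p). Proof. exact: (j_nul hC). Qed.
Let fD p w : U p -> nul p -> ImO w -> cross p w = 0 ->
  ImO (D w p) /\ cross (f p) (D w p) = 0.
Proof. exact: (j_tan hC). Qed.

(** If p(s) x w(s) = 0 along a parabola of incident pairs, then f(p) x D(w)(p) = 0
and D(w)(p) is null along the curve; the conclusions are the derivatives at s = 0.
*)
Lemma first_order x v r (a b c : Oct R) : U x ->
  (forall s, nul (x + s *: v + (s * s) *: r)) ->
  (forall s, ImO (a + s *: b + (s * s) *: c)) ->
  (forall s, cross (x + s *: v + (s * s) *: r) (a + s *: b + (s * s) *: c) = 0) ->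
  [/\ ImO (D v x), ImO (B a v x + D b x),
      cross (D v x) (D a x) + cross (f x) (B a v x + D b x) = 0 &
      odot (D a x) (B a v x + D b x) = 0].
Proof.
move=> Ux hn hI hc.
have d1 := j_f hC v r Ux.
have d2 := j_var hC a b c v r Ux.
have E0 : x + 0 *: v + (0 * 0) *: r = x by rewrite mulr0 !scale0r !addr0.
have E1 : a + 0 *: b + (0 * 0) *: c = a by rewrite mulr0 !scale0r !addr0.
split.
- apply: der_ImO d1; near=> s.
  suff [] : nul (f (x + s *: v + (s * s) *: r)) by [].
  by apply: fn => //; near: s; exact: (j_near hC).
- apply: der_ImO d2; near=> s.
  apply: (fD _ (hn s) (hI s) (hc s)).1; near: s; exact: (j_near hC).
- have := der_cross d1 d2; rewrite E0 E1; apply: der_zero; near=> s.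
  apply: (fD _ (hn s) (hI s) (hc s)).2; near: s; exact: (j_near hC).
- have : der (fun s => odot (D (a + s *: b + (s * s) *: c) (x + s *: v + (s * s) *: r))
     (D (a + s *: b + (s * s) *: c) (x + s *: v + (s * s) *: r)) : R^o) 0.
    apply: der_near (der_cst (0 : R^o)); near=> s.
    have Us : U (x + s *: v + (s * s) *: r) by near: s; exact: (j_near hC).
    have [h1 h2] := fD Us (hn s) (hI s) (hc s).
    have [hf nf f0] := fn Us (hn s).
    by have [_ ->] := Ann_perp hf h1 f0 nf h2.
  move=> h; have := der_unique (der_odot d2 d2) h.
  rewrite E0 E1 odotC -mulr2n => /eqP; rewrite mulrn_eq0 /= => /eqP.
  by [].
Unshelve. all: by end_near. Qed.

Lemma first_order_g2 psi x v r (a b c : Oct R) : U (psi x) ->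
  (forall s, nul (x + s *: v + (s * s) *: r)) ->
  (forall s, ImO (a + s *: b + (s * s) *: c)) ->
  (forall s, cross (x + s *: v + (s * s) *: r) (a + s *: b + (s * s) *: c) = 0) ->
  [/\ ImO (D (psi v) (psi x)), ImO (B (psi a) (psi v) (psi x) + D (psi b) (psi x)),
      cross (D (psi v) (psi x)) (D (psi a) (psi x)) +
      cross (f (psi x)) (B (psi a) (psi v) (psi x) + D (psi b) (psi x)) = 0 &
      odot (D (psi a) (psi x)) (B (psi a) (psi v) (psi x) + D (psi b) (psi x)) = 0].
Proof.
move=> Ux hn hI hc.
have E (y z w : Oct R) s : psi y + s *: psi z + (s * s) *: psi w = psi (y + s *: z + (s * s) *: w).
  by rewrite !linearD !linearZ.
apply: (@first_order _ _ (psi r) _ _ (psi c) Ux) => s; rewrite ?E.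
- exact: nul_g2.
- exact: g2_ImO.
- by rewrite -g2_cross ?hc ?linear0 //; have [] := hn s.
Qed.

Local Notation E1 psi := (psi (e1 R)).
Local Notation E2 psi := (psi (e2 R)).
Local Notation E3 psi := (psi (e3 R)).
Local Notation F1 psi := (psi (f1 R)).
Local Notation F2 psi := (psi (f2 R)).
Local Notation F3 psi := (psi (f3 R)).
Local Notation HH psi := (psi (hh R)).

Let D0 psi x : U x -> D (psi (0 : Oct R)) x = 0.
Proof.
by move=> Ux; have := j_scale hC 0 0 Ux; rewrite !scale0r linear0.
Qed.

Let nul1 (a2 a3 c b1 b2 b3 : R) : a2 * b2 + a3 * b3 + b1 = c * c ->
  nul (zorn 1 a2 a3 c b1 b2 b3).
Proof.
move=> h; split; [exact: ImO_zorn|rewrite odot_zorn; lra|].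
by apply/zorn_neq0 => -[[/eqP]]; rewrite oner_eq0.
Qed.

(** Each of the curves below moves the point e1 in one of the directions f2, f3, h,
e3 together with an incident vector, and gives an equation on the 2-jet. *)
Lemma curve_f2 psi : U (E1 psi) ->
  ImO (B (F3 psi) (F2 psi) (E1 psi) + D (HH psi) (E1 psi)) /\
  cross (D (F2 psi) (E1 psi)) (D (F3 psi) (E1 psi)) +
  cross (f (E1 psi)) (B (F3 psi) (F2 psi) (E1 psi) + D (HH psi) (E1 psi)) = 0.
Proof.
move=> Ux; have [|||_ h1 h2 _] // := @first_order_g2 psi (e1 R) (f2 R) 0 (f3 R) (hh R) (e3 R) Ux;
  move=> s; rewrite ?scaler0 ?addr0 !zornZ !zornD; last by rewrite cross_zorn -zorn0; congr zorn; field.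
  by rewrite !(mulr0, mulr1, addr0, add0r); apply: nul1; ring.
exact: ImO_zorn.
Qed.

Lemma curve_f2_f2 psi : U (E1 psi) ->
  ImO (B (F2 psi) (F2 psi) (E1 psi)) /\
  cross (f (E1 psi)) (B (F2 psi) (F2 psi) (E1 psi)) = 0.
Proof.
move=> Ux; have [|||h0 h1 h2 _] := @first_order_g2 psi (e1 R) (f2 R) 0 (f2 R) 0 0 Ux.
- move=> s; rewrite ?scaler0 ?addr0 !zornZ !zornD !(mulr0, mulr1, addr0, add0r).
  by apply: nul1; ring.
- by move=> s; rewrite !scaler0 !addr0; exact: ImO_zorn.
- by move=> s; rewrite ?scaler0 ?addr0 !zornZ !zornD cross_zorn -zorn0; congr zorn; field.
move: h1 h2; rewrite (D0 psi Ux) addr0 crossxx // add0r.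
by [].
Qed.

Lemma curve_f3 psi : U (E1 psi) ->
  cross (D (F3 psi) (E1 psi)) (D (F2 psi) (E1 psi)) +
  cross (f (E1 psi)) (B (F2 psi) (F3 psi) (E1 psi) - D (HH psi) (E1 psi)) = 0.
Proof.
move=> Ux; have [|||_ h1 + _] := @first_order_g2 psi (e1 R) (f3 R) 0 (f2 R) ((-1) *: hh R) (e2 R) Ux.
- move=> s; rewrite ?scaler0 ?addr0 !zornZ !zornD !(mulr0, mulr1, addr0, add0r).
  by apply: nul1; ring.
- by move=> s; rewrite !zornZ !zornD; exact: ImO_zorn.
- by move=> s; rewrite ?scaler0 ?addr0 !zornZ !zornD cross_zorn -zorn0; congr zorn; field.
by rewrite linearZ /= (j_scale hC) // scaleN1r.
Qed.

Lemma curve_h psi : U (E1 psi) ->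
  [/\ ImO (D (HH psi) (E1 psi)),
   ImO (B (F2 psi) (HH psi) (E1 psi) - D (E3 psi) (E1 psi)) &
  cross (D (HH psi) (E1 psi)) (D (F2 psi) (E1 psi)) +
  cross (f (E1 psi)) (B (F2 psi) (HH psi) (E1 psi) - D (E3 psi) (E1 psi)) = 0].
Proof.
move=> Ux; have [|||h0 + + _] := @first_order_g2 psi (e1 R) (hh R) (f1 R) (f2 R) ((-1) *: e3 R) 0 Ux.
- move=> s; rewrite ?scaler0 ?addr0 !zornZ !zornD !(mulr0, mulr1, addr0, add0r).
  by apply: nul1; ring.
- by move=> s; rewrite ?scaler0 ?addr0 !zornZ !zornD; exact: ImO_zorn.
- by move=> s; rewrite ?scaler0 ?addr0 !zornZ !zornD cross_zorn -zorn0; congr zorn; field.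
by rewrite linearZ /= (j_scale hC) // scaleN1r => h1 h2.
Qed.

Lemma curve_e3 psi : U (E1 psi) ->
  ImO (D (E3 psi) (E1 psi)) /\
  odot (D (F2 psi) (E1 psi)) (B (F2 psi) (E3 psi) (E1 psi)) = 0.
Proof.
move=> Ux; have [|||h0 h1 _ +] := @first_order_g2 psi (e1 R) (e3 R) 0 (f2 R) 0 0 Ux.
- move=> s; rewrite ?scaler0 ?addr0 !zornZ !zornD !(mulr0, mulr1, addr0, add0r).
  by apply: nul1; ring.
- by move=> s; rewrite ?scaler0 ?addr0 ?zornZ ?zornD; exact: ImO_zorn.
- by move=> s; rewrite ?scaler0 ?addr0 !zornZ !zornD cross_zorn -zorn0; congr zorn; field.
by rewrite (D0 psi Ux) addr0.
Qed.

Let frame psi : [/\ nul (E1 psi), ImO (F2 psi), ImO (F3 psi) & cross (F2 psi) (F3 psi) != 0]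
  /\ cross (E1 psi) (F2 psi) = 0 /\ cross (E1 psi) (F3 psi) = 0.
Proof.
have [t1 t2 t3] := g2_table psi; have n1 := nul_g2 psi (nul_e1 R).
split; last by [].
by split; rewrite ?t3; [|apply: g2_ImO; exact: ImO_zorn|apply: g2_ImO; exact: ImO_zorn|case: n1].
Qed.

(** The commutator of two directions of the distribution: subtracting the relations
of the curves in the directions f2 and f3 removes the second derivatives by
symmetry. *)
Lemma jet_K psi : U (E1 psi) ->
  cross (f (E1 psi)) (D (HH psi) (E1 psi)) =
  - cross (D (F2 psi) (E1 psi)) (D (F3 psi) (E1 psi)).
Proof.
move=> Ux; have [[n1 h2 h3 _] [c2 c3]] := frame psi.
have [_ e1] := curve_f2 Ux; have := curve_f3 Ux.
have [iW _] := fD Ux n1 h2 c2; have [iN _] := fD Ux n1 h3 c3.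
rewrite (j_sym hC (F2 psi) (F3 psi) Ux) (crossC iN iW).
move: e1; rewrite !crossDr crossNr.
move: (cross (D (F2 psi) (E1 psi)) _) (cross (f (E1 psi)) (B (F3 psi) (F2 psi) (E1 psi)))
  (cross (f (E1 psi)) (D (HH psi) (E1 psi))).
move=> P Q C h1 h2'.
have -> : C = 2^-1 *: ((P + (Q + C)) - (- P + (Q - C))) - P.
  by apply: linear_ext => L LD LZ LN L0; rewrite !(LD, LZ, LN, L0); field.
by rewrite h1 h2' subrr scaler0 sub0r.
Qed.

Lemma E1_shear psi t : psi (e1 R + t *: f2 R) = E1 psi + t *: F2 psi + (t * t) *: 0.
Proof. by rewrite linearD linearZ scaler0 addr0. Qed.

(** The identity jet_K holds at all points of the line e1 + t f2; this is its
derivative. *)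
Lemma jet_K' psi : U (E1 psi) ->
  ImO (B (HH psi) (F2 psi) (E1 psi) + 2 *: D (E3 psi) (E1 psi)) /\
  cross (D (F2 psi) (E1 psi)) (D (HH psi) (E1 psi)) +
  cross (f (E1 psi)) (B (HH psi) (F2 psi) (E1 psi) + 2 *: D (E3 psi) (E1 psi)) =
  - (cross (B (F2 psi) (F2 psi) (E1 psi)) (D (F3 psi) (E1 psi)) +
     cross (D (F2 psi) (E1 psi))
       (B (F3 psi) (F2 psi) (E1 psi) + D (HH psi) (E1 psi))).
Proof.
move=> Ux.
pose c t := E1 psi + t *: F2 psi + (t * t) *: (0 : Oct R).
have c0 : c 0 = E1 psi by rewrite /c mulr0 !scale0r !addr0.
have key t : U (c t) ->
   ImO (D (HH psi + t *: (2 *: E3 psi) + (t * t) *: 0) (c t)) /\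
   cross (f (c t)) (D (HH psi + t *: (2 *: E3 psi) + (t * t) *: 0) (c t)) =
   - cross (D (F2 psi) (c t)) (D (F3 psi + t *: HH psi + (t * t) *: E3 psi) (c t)).
  move=> Uc; have [tau [t1 t2 t3 t4 t5]] := g2_shear t.
  have [chi E] := g2_comp psi tau.
  have X1 : chi (e1 R) = c t by rewrite E t1 E1_shear.
  have Uchi : U (chi (e1 R)) by rewrite X1.
  have := jet_K Uchi; have [+ _ _] := curve_h Uchi.
  rewrite X1 !E t2 t4 t5 !linearD !linearZ /= linearZ /= !scaler0 !addr0.
  by [].
have d1 := j_f hC (F2 psi) 0 Ux.
have d2 := j_var hC (HH psi) (2 *: E3 psi) 0 (F2 psi) 0 Ux.
have d3 := j_D hC (F2 psi) (F2 psi) 0 Ux.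
have d4 := j_var hC (F3 psi) (HH psi) (E3 psi) (F2 psi) 0 Ux.
have nU : \forall t \near (0 : R), U (c t) by exact: (j_near hC).
split.
  rewrite -(j_scale hC) //; apply: der_ImO d2; near=> t.
  by apply: (key t _).1; near: t.
have h := derD (der_cross d1 d2) (der_cross d3 d4).
have := der_zero _ h; rewrite -!/(c _) !c0 !mulr0 !scale0r !addr0 (j_scale hC) //.
move=> H; apply/eqP; rewrite -addr_eq0; apply/eqP; apply: H.
near=> t; rewrite (key t _).2 ?addNr //; near: t; exact: nU.
Unshelve. all: by end_near. Qed.

(** The vector D(f2) f is orthogonal to D(e3) f along the line. The derivative of
this equation, together with curve_e3, says that B(f2, f2) is orthogonal to D(e3) f;
since B(f2, f2) is in the annihilator of f and D(e3) f is not orthogonal to D(f3) f,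
it has no component on D(f3) f. *)
Lemma jet_line psi : U (E1 psi) ->
  exists x y : R, B (F2 psi) (F2 psi) (E1 psi) =
    x *: f (E1 psi) + y *: D (F2 psi) (E1 psi).
Proof.
have main (chi : G2' R) : U (E1 chi) -> odot (f (E1 chi)) (D (E3 chi) (E1 chi)) = 0 /\
    odot (D (F2 chi) (E1 chi)) (D (E3 chi) (E1 chi)) = 0 /\
    odot (D (F3 chi) (E1 chi)) (D (E3 chi) (E1 chi)) != 0.
  move=> Ux; have [[n1 h2 h3 h23] [c2 c3]] := frame chi.
  have ng := fn Ux n1; have [hg _ g0] := ng.
  have [iW gW] := fD Ux n1 h2 c2; have [iN gN] := fD Ux n1 h3 c3.
  have WN0 : cross (D (F2 chi) (E1 chi)) (D (F3 chi) (E1 chi)) != 0.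
    exact: (j_ind hC).
  have [m em] := Ann_cross ng iW iN gW gN.
  have m0 : m != 0 by apply: contraNneq WN0 => m0; rewrite em m0 scale0r.
  have [iK iYZ e5] := curve_h Ux; have [iX1 eX1] := curve_f2 Ux.
  have [iX2 eX2] := curve_f2_f2 Ux; have [iZ _] := curve_e3 Ux.
  have [iY2 e4] := jet_K' Ux.
  have iY : ImO (B (HH chi) (F2 chi) (E1 chi)).
    rewrite -[X in ImO X](addrK (2 *: D (E3 chi) (E1 chi))).
    by apply: ImOB => //; exact: ImOZ.
  rewrite (j_sym hC (F2 chi) (HH chi) Ux) in e5.
  have [||z1 z2 z3] := jet_algebra ng iW iN iK iZ iX1 iX2 iY gW gN em m0 _ _ eX2 e4 e5.
  - by rewrite (jet_K Ux) em scaleNr.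
  - by apply/eqP; rewrite scaleNr -addr_eq0 addrC -em eX1.
  split; [exact: z1|split; [exact: z2|]].
  by rewrite z3 mulf_neq0 ?expf_neq0 // invr_eq0 pnatr_eq0.
move=> Ux; have [[n1 h2 h3 h23] [c2 c3]] := frame psi.
have ng := fn Ux n1.
have [iW gW] := fD Ux n1 h2 c2; have [iN gN] := fD Ux n1 h3 c3.
have WN0 : cross (D (F2 psi) (E1 psi)) (D (F3 psi) (E1 psi)) != 0.
  exact: (j_ind hC).
have [m em] := Ann_cross ng iW iN gW gN.
have m0 : m != 0 by apply: contraNneq WN0 => m0; rewrite em m0 scale0r.
have [iX2 eX2] := curve_f2_f2 Ux.
have [x [y [z e]]] := Ann_span ng iW iN iX2 gW gN eX2 em m0.
have [gZ [WZ NZ]] := main _ Ux.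
exists x, y; suff z0 : z = 0 by rewrite e z0 scale0r addr0.
pose c t := E1 psi + t *: F2 psi + (t * t) *: (0 : Oct R).
have c0 : c 0 = E1 psi by rewrite /c mulr0 !scale0r !addr0.
have d1 := j_D hC (F2 psi) (F2 psi) 0 Ux.
have d2 := j_D hC (E3 psi) (F2 psi) 0 Ux.
have H : odot (B (F2 psi) (F2 psi) (E1 psi)) (D (E3 psi) (E1 psi)) +
    odot (D (F2 psi) (E1 psi)) (B (E3 psi) (F2 psi) (E1 psi)) = 0.
  have := der_zero _ (der_odot d1 d2); rewrite -!/(c _) !c0; apply.
  near=> t.
  have Uc : U (c t) by near: t; exact: (j_near hC).
  have [tau [t1 t2 t3 t4 t5]] := g2_shear t; have [chi E] := g2_comp psi tau.
  have X1 : chi (e1 R) = c t by rewrite E t1 E1_shear.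
  have Uchi : U (chi (e1 R)) by rewrite X1.
  by have [_ [+ _]] := main _ Uchi; rewrite X1 !E t2 t3.
have [_ o3] := curve_e3 Ux.
move: H; rewrite (j_sym hC (E3 psi) (F2 psi) Ux) o3 addr0 e !odotDl !odotZl gZ WZ.
by rewrite !mulr0 !add0r => /eqP; rewrite mulf_eq0 (negbTE NZ) orbF => /eqP.
Unshelve. all: by end_near. Qed.

End Jet.
End JetGeometry.

(** * Tangential maps send annihilator lines into annihilator lines *)

Section LocalLines.
Variable R : realType.
Implicit Types u v w p : Oct R.
Implicit Type psi : G2' R.

Lemma tangential_line U f p w : tangential U f -> U p -> nul p -> ImO w ->
  cross p w = 0 -> w \notin <[p]>%VS ->
  exists x y : R, 'D_w ('D_w f) p = x *: f p + y *: 'D_w f p.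
Proof.
move=> T Up np hw pw wp; have [hp nnp p0] := np.
have [psi [psi1 psi2]] := flag_trans hp hw p0 nnp pw wp.
have := @jet_line R U f _ _ (tangential_jets T) psi; rewrite psi1 psi2; apply.
exact: Up.
Qed.

(** A direction n with w x n not 0 shows that the derivative along w is not
proportional to f p. *)
Lemma tangential_free U f p w : tangential U f -> U p -> nul p -> ImO w ->
  cross p w = 0 -> w \notin <[p]>%VS ->
  [/\ nul (f p), ImO ('D_w f p), cross (f p) ('D_w f p) = 0 &
      'D_w f p \notin <[f p]>%VS].
Proof.
move=> [C fn fD fI] Up np hw pw wp; have [hp nnp p0] := np.
have [psi [psi1 psi2]] := flag_trans hp hw p0 nnp pw wp.
have ng := fn p Up np; have [iW gW] := fD p w Up np hw pw.
split=> //; apply/negP => /vlineP [k e].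
have [t1 t2 t3] := g2_table psi.
have h3 : ImO (psi (f3 R)) by apply: g2_ImO; exact: ImO_zorn.
have pf3 : cross p (psi (f3 R)) = 0 by rewrite -psi1.
have [iN gN] := fD p _ Up np h3 pf3.
have : cross ('D_w f p) ('D_(psi (f3 R)) f p) != 0.
  by apply: fI => //; rewrite -psi2 t3 psi1.
by rewrite e crossZl gN scaler0 eqxx.
Qed.

Lemma mvt_cst (h : R -> R) (e : R) :
  (forall t, `|t| < e -> der (fun s => h (t + s) : R^o) 0) ->
  forall t, `|t| < e -> h t = h 0.
Proof.
move=> H t te.
have [s st|x xt] := @mvt0 R h (fun=> 0) t; first by apply: H; exact: le_lt_trans st te.
by rewrite mulr0 => /eqP; rewrite subr_eq0 => /eqP.
Qed.

Lemma derM (a b : R -> R) (da db : R) : der (a : R -> R^o) da -> der (b : R -> R^o) db ->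
  der (fun s => a s * b s : R^o) (da * b 0 + a 0 * db).
Proof.
move=> ha hb; have hb' : b s @[s --> (0 : R)^'] --> b 0 by exact: (der_cvg hb).
have h1 : (s^-1 * (a s - a 0)) * b s @[s --> (0 : R)^'] --> da * b 0.
  by apply: cvgM => //; exact: ha.
have h2 : a 0 * (s^-1 * (b s - b 0)) @[s --> (0 : R)^'] --> a 0 * db.
  by apply: cvgM; [exact: cvg_cst|exact: hb].
apply: cvg_near (cvgD h1 h2); near=> s.
by rewrite /= /GRing.scale /=; ring.
Unshelve. all: by end_near. Qed.

Lemma derB (a b : R -> R) (da db : R) : der (a : R -> R^o) da -> der (b : R -> R^o) db ->
  der (fun s => a s - b s : R^o) (da - db).
Proof.
move=> ha hb; have := derD ha (@derZ R R^o (-1) _ _ hb).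
by rewrite scaleN1r; congr der; apply/funext => s; rewrite scaleN1r.
Qed.

Lemma der_div (a b : R -> R) (da db : R) : der (a : R -> R^o) da -> der (b : R -> R^o) db ->
  b 0 != 0 -> der (fun s => a s / b s : R^o) ((da * b 0 - a 0 * db) / (b 0 * b 0)).
Proof.
move=> ha hb b0; have hb' : b s @[s --> (0 : R)^'] --> b 0 by exact: (der_cvg hb).
have h1 : (s^-1 * (a s - a 0)) * b 0 @[s --> (0 : R)^'] --> da * b 0.
  by apply: cvgM; [exact: ha|exact: cvg_cst].
have h2 : a 0 * (s^-1 * (b s - b 0)) @[s --> (0 : R)^'] --> a 0 * db.
  by apply: cvgM; [exact: cvg_cst|exact: hb].
have h3 : (b s * b 0)^-1 @[s --> (0 : R)^'] --> (b 0 * b 0)^-1.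
  by apply: cvgV; [rewrite mulf_neq0|apply: cvgM => //; exact: cvg_cst].
have bs0 : \forall s \near (0 : R)^', b s != 0.
  by move: hb' => /cvgr_neq0; apply.
have h4 : ((s^-1 * (a s - a 0)) * b 0 - a 0 * (s^-1 * (b s - b 0))) * (b s * b 0)^-1
    @[s --> (0 : R)^'] --> (da * b 0 - a 0 * db) * (b 0 * b 0)^-1.
  by apply: cvgM => //; apply: cvgB.
apply: cvg_near h4; near=> s.
have bs : b s != 0 by near: s.
have s0 : s != 0 by near: s; exact: near0N.
by rewrite /= /GRing.scale /=; field; rewrite s0 bs b0.
Unshelve. all: by end_near. Qed.

Lemma der_shift (V : normedModType R) (F : Oct R -> V) p w t d :
  der (fun s => F (p + t *: w + s *: w)) d ->
  der (fun s => F (p + (t + s) *: w)) d.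
Proof.
by congr der; apply/funext => s; rewrite scalerDl addrA.
Qed.

Lemma nul_shift p w t : nul p -> ImO w -> cross p w = 0 -> w \notin <[p]>%VS ->
  nul (p + t *: w).
Proof.
move=> [hp nnp p0] hw pw wp; have [pw0 ww] := Ann_perp hp hw p0 nnp pw.
split; first by apply: ImOD => //; exact: ImOZ.
  by rewrite !odotDl !odotDr !odotZl !odotZr nnp ww (odotC w) pw0; ring.
have [->|t0] := eqVneq t 0; first by rewrite scale0r addr0.
apply: contraNneq wp => /eqP; rewrite addr_eq0 => /eqP e.
by apply/vlineP; exists (- t^-1); rewrite e scalerN scaleNr opprK scalerA mulVf ?scale1r.
Qed.

Lemma shift_notin p w t : p != 0 -> w \notin <[p]>%VS -> w \notin <[p + t *: w]>%VS.
Proof.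
move=> p0 wp; apply/negP => /vlineP [k e].
have : (1 - k * t) *: w = k *: p.
  by rewrite scalerBl scale1r {1}e scalerDr scalerA addrK.
have [kt|kt] := eqVneq (1 - k * t) 0.
  rewrite kt scale0r => /esym/eqP; rewrite scaler_eq0 (negbTE p0) orbF => /eqP k0.
  by move: kt; rewrite k0 mul0r subr0 => /eqP; rewrite oner_eq0.
move=> E; move/negP: wp; apply; apply/vlineP; exists ((1 - k * t)^-1 * k).
by rewrite -scalerA -E scalerA mulVf ?scale1r.
Qed.

(** Along the line, (f, f') satisfies f'' = x f + y f'. The minors of f and f' with
respect to two linear forms all satisfy the same equation om' = y om, so their
ratios are constant, and f stays in the span of f and f' at the initial point. *)
Lemma tangential_line_local U f p w : tangential U f -> U p -> nul p -> ImO w ->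
  cross p w = 0 -> w \notin <[p]>%VS ->
  exists2 e : R, 0 < e & forall t, `|t| < e -> U (p + t *: w) /\
    f (p + t *: w) \in (<[f p]> + <['D_w f p]>)%VS.
Proof.
move=> T Up np hw pw wp; have [hp nnp p0] := np.
have [C fn fD fI] := T.
have [ng iW gW Wg] := tangential_free T Up np hw pw wp.
have [hg _ g0] := ng.
set g := f p in ng iW gW Wg hg g0 *; set W := 'D_w f p in iW gW Wg *.
have W0 : W != 0 by apply: contraNneq Wg => ->; exact: mem0v.
have gW' : g \notin <[W]>%VS.
  apply: contraNN Wg => /vlineP [k gk]; apply/vlineP; exists k^-1.
  rewrite gk scalerA mulVf ?scale1r //.
  by apply: contraNneq g0 => k0; rewrite gk k0 scale0r.
have lI v : ImO v -> forall x, x \in <[v]>%VS -> ImO x.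
  by move=> hv _ /vlineP [k ->]; exact: ImOZ.
(* The forms a and b are dual to g and W on their span, so that om a b = 1 at t = 0. *)
have [a [ha aW ag]] := dual_vector (lI _ iW) hg gW'.
have [b [hb bg bW]] := dual_vector (lI _ hg) iW Wg.
have {}aW : odot a W = 0 by apply: aW; exact: memv_line.
have {}bg : odot b g = 0 by apply: bg; exact: memv_line.
have nt t : nul (p + t *: w) by exact: nul_shift.
have ct t : cross (p + t *: w) w = 0 by rewrite crossDl crossZl pw crossxx // scaler0 addr0.
have wt t : w \notin <[p + t *: w]>%VS by exact: shift_notin.
(* om l l' is the Pluecker coordinate of (f, f') on the forms l and l'. *)
pose G l t := odot l (f (p + t *: w)); pose G' l t := odot l ('D_w f (p + t *: w)).
pose om l l' t := G l t * G' l' t - G' l t * G l' t.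
have G0 l : G l 0 = odot l g by rewrite /G scale0r addr0.
have G'0 l : G' l 0 = odot l W by rewrite /G' scale0r addr0.
have dG l t : U (p + t *: w) -> der (fun s => G l (t + s) : R^o) (G' l t).
  move=> Ut; apply: (@der_shift R^o (fun x => odot l (f x))).
  apply: (@der_lin R R^o (odot l)); [exact: odotDr|by move=> *; exact: odotZr|].
  exact: (C2_d1 C).
have dG' l t : U (p + t *: w) ->
    der (fun s => G' l (t + s) : R^o) (odot l ('D_w ('D_w f) (p + t *: w))).
  move=> Ut; apply: (@der_shift R^o (fun x => odot l ('D_w f x))).
  apply: (@der_lin R R^o (odot l)); [exact: odotDr|by move=> *; exact: odotZr|].
  exact: (C2_d2 C).
have dom t : U (p + t *: w) -> exists y, forall l l',
    der (fun s => om l l' (t + s) : R^o) (y * om l l' t).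
  move=> Ut; have [x [y e]] := tangential_line T Ut (nt t) hw (ct t) (wt t).
  exists y => l l'.
  have := derB (derM (dG l t Ut) (dG' l' t Ut)) (derM (dG' l t Ut) (dG l' t Ut)).
  congr der; rewrite e !addr0 !odotDr !odotZr -!/(G _ _) -!/(G' _ _) /om.
  by move: (G l t) (G l' t) (G' l t) (G' l' t) => *; ring.
have U0 : U (p + 0 *: w) by rewrite scale0r addr0.
have om0 : om a b 0 = 1 by rewrite /om !G0 !G'0 ag bW aW bg; ring.
have [e e0 eP] : exists2 e : R, 0 < e & forall t, `|t| < e ->
    U (p + t *: w) /\ om a b t != 0.
  have nU := near_quad C w 0 Up.
  have [y /(_ a b) /der_cvg h] := dom 0 U0.
  rewrite addr0 om0 in h.
  have hn : \forall s \near (0 : R)^', om a b (0 + s) != 0.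
    by move: h => /cvgr_neq0; apply; exact: oner_neq0.
  have hn' : \forall s \near (0 : R), s != 0 -> om a b (0 + s) != 0 by exact: hn.
  have : \forall t \near (0 : R), U (p + t *: w) /\ om a b t != 0.
    near=> t; split.
      have : U (p + t *: w + (t * t) *: 0) by near: t; exact: nU.
      by rewrite scaler0 addr0.
    have [->|t0] := eqVneq t 0; first by rewrite om0 oner_eq0.
    by rewrite -[t]add0r; move: t0; near: t; exact: hn'.
  move=> /nbhs_ballP [e /= e0 eP]; exists e => // t te; apply: eP.
  by rewrite -ball_normE /ball_ /= sub0r normrN.
exists e => // t te; have [Ut dn0] := eP t te; split=> //.
have ratio l l' s : `|s| < e -> om l l' s / om a b s = om l l' 0 / om a b 0.
  move=> se; apply: (@mvt_cst (fun s => om l l' s / om a b s) e) => // {s se} s se.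
  have [Us ds0] := eP s se; have [y hy] := dom s Us.
  have := der_div (hy l l') (hy a b); rewrite addr0 => /(_ ds0).
  by congr der; rewrite (_ : _ - _ = 0) ?mul0r //; ring.
have GE l : G l t = odot l g * G a t + odot l W * G b t.
  have r1 := ratio l b t te; have r2 := ratio a l t te.
  rewrite om0 !divr1 in r1 r2.
  have o1 : om l b 0 = odot l g by rewrite /om !G0 !G'0 bW bg; ring.
  have o2 : om a l 0 = odot l W by rewrite /om !G0 !G'0 ag aW; ring.
  rewrite -o1 -o2 -r1 -r2; apply: (mulIf dn0).
  transitivity (om l b t * G a t + om a l t * G b t).
    by rewrite /om; ring.
  by move: dn0; move: (om a b t) => d dn0; field.
have -> : f (p + t *: w) = G a t *: g + G b t *: W.
  apply/eqP; rewrite -subr_eq0; apply/eqP.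
  have [hf _ _] := fn _ Ut (nt t).
  apply: odot_nondeg => [|l hl].
    by apply: ImOB => //; apply: ImOD; exact: ImOZ.
  rewrite odotDl odotNl odotDl !odotZl !(odotC _ l) -/(G l t) GE.
  by rewrite mulrC [odot l W * _]mulrC subrr.
by apply: memv_add; apply: memvZ; exact: memv_line.
Unshelve. all: by end_near. Qed.

End LocalLines.

(** * Tangential lifts give isometries *)

Section GlobalLines.
Variable R : realType.
Implicit Types u v w p : Oct R.
Implicit Types x y z : Ein R.

Lemma chord z x : d3 z x = 1%N -> [/\ ImO (rep x - rep z),
  cross (rep z) (rep x - rep z) = 0 & rep x - rep z \notin <[rep z]>%VS].
Proof.
move=> zx; have [hz _ _] := nul_rep z; have [hx _ _] := nul_rep x.
have /eqP czx : cross (rep z) (rep x) == 0 by rewrite -d3_le1 zx.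
split; first exact: ImOB.
  by rewrite crossDr crossNr czx crossxx // subrr.
apply/negP => hh; have : x = z; last by move=> e; move: zx; rewrite e d3xx.
by apply: Ein_eq; rewrite -(subrK (rep z) (rep x)) memvD ?memv_line.
Qed.

Section Lift.
Variables (phi : Ein R -> Ein R).
Hypothesis phi_inj : injective phi.
Variables (dom : Oct R -> set (Oct R)) (lft : Oct R -> Oct R -> Oct R).
Hypothesis lift_at : forall p, nul p -> dom p p.
Hypothesis lift_lift : forall p, nul p -> local_lift phi (dom p) (lft p).
Hypothesis lift_tan : forall p, nul p -> tangential (dom p) (lft p).

(** Locally the image of the line lies in the plane Q(t) spanned by f and f' at the
point of parameter t. Two neighboring planes share two distinct points of the image,
by injectivity, so that Q is locally constant; hence it is constant. *)
Lemma line_image p w t x : nul p -> ImO w -> cross p w = 0 -> w \notin <[p]>%VS ->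
  line x = <[p + t *: w]>%VS ->
  (line (phi x) <= <[lft p p]> + <['D_w (lft p) p]>)%VS.
Proof.
move=> np hw pw wp lx.
pose q (s : R) : Oct R := p + s *: w.
have nq s : nul (q s) by exact: nul_shift.
have cq s : cross (q s) w = 0 by rewrite crossDl crossZl pw crossxx // scaler0 addr0.
have wq s : w \notin <[q s]>%VS by apply: shift_notin => //; case: np.
have qD s r : q (s + r) = q s + r *: w by rewrite /q scalerDl addrA.
have [pt lpt] : exists pt : R -> Ein R, forall s, line (pt s) = <[q s]>%VS.
  by exists (fun s => projT1 (ex_pt (nq s))) => s; case: ex_pt.
have [Q QE] : exists Q : R -> {vspace Oct R},
  forall s, Q s = (<[lft (q s) (q s)]> + <['D_w (lft (q s)) (q s)]>)%VS by eexists.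
have Qd s : (\dim (Q s) <= 2)%N.
  by rewrite QE; apply: leq_trans (dimv_add_leqif _ _) _; rewrite !dim_vline; do 2 case: (_ != 0).
have loc (s : R) : exists2 e : R, 0 < e & forall r, `|r| < e -> (line (phi (pt (s + r)%R)) <= Q s)%VS.
  rewrite QE; have [e e0 H] := tangential_line_local (lift_tan (nq s)) (lift_at (nq s)) (nq s) hw (cq s) (wq s).
  exists e => // r /H; rewrite -qD => -[Ur m].
  have [_ _ L] := lift_lift (nq s).
  have [||f1 f2] := L (pt (s + r)%R) (q (s + r)) Ur; first by rewrite lpt memv_line.
    by have [_ _ ?] := nq (s + r).
  suff -> : line (phi (pt (s + r)%R)) = <[lft (q s) (q (s + r)%R)]>%VS by rewrite -memvE.
  exact: line_of f1 f2.
have pt_inj (s r : R) : pt s = pt r -> s = r.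
  move=> e; have : q r \in <[q s]>%VS by rewrite -lpt e lpt memv_line.
  have -> : q r = q s + (r - s) *: w by rewrite -qD addrC subrK.
  move=> h; apply/eqP; rewrite eq_sym -subr_eq0; apply: contraNT (wq s) => rs.
  have : (r - s) *: w \in <[q s]>%VS.
    by rewrite -[X in X \in _](addKr (q s)) addrC memvB ?memv_line.
  by move=> /(memvZ (r - s)^-1); rewrite scalerA mulVf ?scale1r.
have two (s r : R) : s != r -> \dim (line (phi (pt s)) + line (phi (pt r)))%VS = 2%N.
  move=> sr; rewrite dimv_disjoint_sum.
    have /andP[/eqP -> _] := valP (phi (pt s)).
    by have /andP[/eqP -> _] := valP (phi (pt r)).
  rewrite !line_rep; apply/eqP; rewrite -subv0; apply/subvP => v.
  rewrite memv_cap => /andP [/vlineP [k ->] /vlineP [l e]].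
  rewrite memv0 e; have [->|l0] := eqVneq l 0; first by rewrite scale0r.
  move/eqP: sr; case; apply: pt_inj; apply: phi_inj; apply/esym/Ein_eq.
  by apply/vlineP; exists (l^-1 * k); rewrite -scalerA e scalerA mulVf ?scale1r.
have Qloc (s : R) : exists2 e : R, 0 < e & forall r, `|r| < e -> Q (s + r) = Q s.
  have [e e0 H] := loc s; exists e; first exact: e0.
  move=> r re; have [e' e'0 H'] := loc (s + r).
  (* A second parameter s + r + d, close enough for both planes to contain its image. *)
  pose d := Num.min (e' / 2) ((e - `|r|) / 2).
  have d0 : 0 < d by rewrite lt_min !divr_gt0 // subr_gt0.
  have de' : `|d| < e'.
    by rewrite gtr0_norm // gt_min; apply/orP; left; rewrite ltr_pdivrMr //; lra.
  have de : `|r + d| < e.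
    apply: le_lt_trans (ler_normD _ _) _; rewrite (gtr0_norm d0) -ltrBrDl.
    by rewrite gt_min; apply/orP; right; rewrite ltr_pdivrMr //; lra.
  have S1 := H _ re; have S2 := H _ de.
  have S3 := H' 0; rewrite normr0 addr0 in S3; have {}S3 := S3 e'0.
  have S4 := H' _ de'; rewrite -addrA in S4.
  have sd : s + r != s + (r + d) by rewrite (inj_eq (addrI s)) -subr_eq0 opprD addrA subrr sub0r oppr_eq0 gt_eqF.
  have E V : (\dim V <= 2)%N -> (line (phi (pt (s + r)%R)) <= V)%VS ->
      (line (phi (pt (s + (r + d))%R)) <= V)%VS ->
      V = (line (phi (pt (s + r)%R)) + line (phi (pt (s + (r + d))%R)))%VS.
    by move=> dV l1 l2; apply/esym/eqP; rewrite eqEdim subv_add l1 l2 two.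
  by rewrite (E (Q (s + r))) // (E (Q s)).
(* The indicator of Q s = Q 0 has derivative 0 everywhere. *)
have Q0 : Q t = Q 0.
  have := @mvt_cst R (fun s : R => (Q s == Q 0)%:R) (`|t| + 1).
  have tt : `|t| < `|t| + 1 by rewrite ltrDl.
  move=> H; have {}H := H _ t tt; apply/eqP.
  have {H} : (Q t == Q 0)%:R = (Q 0 == Q 0)%:R :> R.
    apply: H => s _; apply: der_near (der_cst ((Q s == Q 0)%:R : R^o)).
    have [e e0 He] := Qloc s; apply/nbhs_ballP; exists e => //= r.
    by rewrite -ball_normE /ball_ /= sub0r normrN => /He ->.
  by rewrite eqxx; case: (Q t == Q 0) => //= /esym/eqP; rewrite oner_eq0.
have -> : x = pt t by apply: line_inj; rewrite lx lpt.
have := Q0; rewrite (QE 0) /q scale0r addr0 => <-.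
by have [e e0 /(_ 0)] := loc t; rewrite normr0 addr0; apply.
Qed.

Lemma image_rep z x : d3 z x = 1%N ->
  exists a b : R, rep (phi x) =
    a *: lft (rep z) (rep z) + b *: 'D_(rep x - rep z) (lft (rep z)) (rep z).
Proof.
move=> zx; have [hw zw wz] := chord zx.
have : rep (phi x) \in (<[lft (rep z) (rep z)]> + <['D_(rep x - rep z) (lft (rep z)) (rep z)]>)%VS.
  apply: (subvP (line_image (t := 1) (nul_rep z) hw zw wz _)).
    by rewrite scale1r addrC subrK line_rep.
  by rewrite line_rep memv_line.
move=> /memv_addP [_ /vlineP [a ->] [_ /vlineP [b ->] e]].
by exists a, b.
Qed.

(** Distance 1 is preserved since the image of the line through z and x is in span(f
z, D(x - z) f), on which the cross product vanishes. Points at distance 2 with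
common neighbor z have independent directions at z, hence so do their images. *)
Lemma tangential_iso : d3_isometry phi.
Proof.
have lz z : line (phi z) = <[lft (rep z) (rep z)]>%VS.
  have nz := nul_rep z; have [_ _ z0] := nz; have [_ _ L] := lift_lift nz.
  have [|f1 f2] := L z (rep z) (lift_at nz) _ z0; first by rewrite line_rep memv_line.
  exact: line_of f1 f2.
have P1 z x : d3 z x = 1%N -> d3 (phi z) (phi x) = 1%N.
  move=> zx; have [hw zw wz] := chord zx; have nz := nul_rep z.
  have [ng hW gW Wg] := tangential_free (lift_tan nz) (lift_at nz) nz hw zw wz.
  have [hg _ _] := ng; have [a [b e]] := image_rep zx.
  apply/eqP; rewrite eqn_leq (d3_pt ng (nul_rep _) (lz z) (line_rep _)) e.
  rewrite crossDr !crossZr gW crossxx // !scaler0 addr0 eqxx /=.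
  by rewrite lt0n d3_eq0 (inj_eq phi_inj) -d3_eq0 zx.
apply: iso_of_12 => // x y xy.
have /d3_le2_path [z [xz zy]] : (d3 x y <= 2)%N by rewrite xy.
have zx1 : d3 z x = 1%N.
  rewrite d3C; apply/eqP; rewrite eqn_leq xz lt0n d3_eq0; apply/eqP => e.
  by move: zy; rewrite -e xy.
have zy1 : d3 z y = 1%N.
  apply/eqP; rewrite eqn_leq zy lt0n d3_eq0; apply/eqP => e.
  by move: xz; rewrite e xy.
have nz := nul_rep z; have [hz _ _] := nz.
have [hx _ _] := nul_rep x; have [hy _ _] := nul_rep y.
have [hw1 zw1 wz1] := chord zx1; have [hw2 zw2 wz2] := chord zy1.
have [ng hW1 gW1 _] := tangential_free (lift_tan nz) (lift_at nz) nz hw1 zw1 wz1.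
have [_ hW2 gW2 _] := tangential_free (lift_tan nz) (lift_at nz) nz hw2 zw2 wz2.
have [hg _ _] := ng.
have [a1 [b1 e1]] := image_rep zx1; have [a2 [b2 e2]] := image_rep zy1.
have c12 : cross ('D_(rep x - rep z) (lft (rep z)) (rep z))
    ('D_(rep y - rep z) (lft (rep z)) (rep z)) != 0.
  have [_ _ _ fI] := lift_tan nz; apply: fI => //; first exact: lift_at.
  have /eqP zx0 : cross (rep z) (rep x) == 0 by rewrite -d3_le1 zx1.
  have /eqP zy0 : cross (rep z) (rep y) == 0 by rewrite -d3_le1 zy1.
  rewrite !crossDr !crossDl !crossNr !crossNl zy0 (crossC hx hz) zx0 crossxx //.
  by rewrite !oppr0 !addr0 -d3_le1 xy.
have bn c a b W : d3 z c = 1%N -> rep (phi c) = a *: lft (rep z) (rep z) + b *: W -> b != 0.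
  move=> zc e; apply/eqP => b0; have := P1 _ _ zc.
  suff -> : phi c = phi z by rewrite d3xx.
  apply: Ein_eq; rewrite -(line_rep (phi z)) lz e b0 scale0r addr0.
  by rewrite memvZ ?memv_line.
apply/eqP; rewrite eqn_leq; apply/andP; split.
  by apply/d3_le2_path; exists (phi z); rewrite d3C !P1.
rewrite ltnNge d3_le1 e1 e2 !crossDl !crossDr !crossZl !crossZr.
rewrite crossxx // gW2 (crossC hW1 hg) gW1 oppr0 !scaler0 !add0r ?addr0.
by rewrite !scaler_eq0 (negbTE c12) (negbTE (bn _ _ _ _ zx1 e1)) (negbTE (bn _ _ _ _ zy1 e2)).
Qed.

End Lift.
End GlobalLines.

(** * Lifts of maps preserving the distribution *)

Section DistributionLifts.
Variable R : realType.
Implicit Types u v w p : Oct R.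
Implicit Types x y z : Ein R.

(** If a and b stay proportional, then (e . b) a = (e . a) b for a fixed vector e
with e . b(0) = 1, and this can be differentiated. It compares different lifts of
the same map, and derivatives in the direction of the line itself. *)
Lemma parallel_curves (a b : R -> Oct R) (da db : Oct R) (k : R) :
  der a da -> der b db -> ImO (b 0) -> b 0 != 0 -> a 0 = k *: b 0 ->
  (\forall t \near (0 : R), a t \in <[b t]>%VS) ->
  exists m : R, da = k *: db + m *: b 0.
Proof.
move=> ha hb hb0 b0 ab par.
have [|||e [_ _ eb]] := @dual_vector R 0%VS (b 0); rewrite ?memv0 //.
  by move=> v; rewrite memv0 => /eqP ->; exact: ImO0.
pose S := fun u v : Oct R => odot e u *: v.
have bil c c' d d' : der c d -> der c' d' ->
    der (fun s => S (c s) (c' s)) (S d (c' 0) + S (c 0) d').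
  apply: der_bil => [u v w|l u v|u v w|l u v]; rewrite /S.
  - by rewrite odotDr scalerDl.
  - by rewrite odotZr scalerA.
  - exact: scalerDr.
  - by rewrite !scalerA mulrC.
have h := derD (bil _ _ _ _ hb ha) (@derZ R _ (-1) _ _ (bil _ _ _ _ ha hb)).
have := der_zero _ h; rewrite /S ab odotZr eb mulr1 scale1r scaleN1r => H.
have {}H := H _.
suff E : odot e db *: (k *: b 0) + da + (- (odot e da *: b 0 + k *: db)) = 0.
  exists (odot e da - odot e db * k); apply/eqP; rewrite -subr_eq0 -[X in _ == X]E.
  by apply/eqP; rewrite scalerBl -scalerA; apply: linear_ext => L LD LZ LN L0; rewrite !(LD, LZ, LN, L0); ring.
apply: H; near=> t; have /vlineP [l ->] : a t \in <[b t]>%VS by near: t.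
by rewrite odotZr scaleN1r !scalerA mulrC subrr.
Unshelve. all: by end_near. Qed.

Lemma nz_near p v : p != 0 -> \forall t \near (0 : R), p + t *: v != 0.
Proof.
move=> p0; have : p + t *: v @[t --> (0 : R)] --> p + 0 *: v.
  by apply: cvgD; [exact: cvg_cst|apply: cvgZr_tmp; exact: cvg_id].
by rewrite scale0r addr0 => /cvgr_neq0; apply.
Qed.

Section LocalLift.
Variables (phi : Ein R -> Ein R).
Variables (U : set (Oct R)) (f : Oct R -> Oct R).
Hypothesis L : local_lift phi U f.

Lemma lift_C2 : C2 U f.
Proof. by have [oU C _] := L; exact: C2_of_Cinf. Qed.

Lemma lift_line x u : U u -> u \in line x -> u != 0 -> line (phi x) = <[f u]>%VS.
Proof.
by move=> Uu ux u0; have [_ _ /(_ x u Uu ux u0) [h1 h2]] := L; exact: line_of.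
Qed.

Lemma lift_nul p : U p -> nul p -> nul (f p).
Proof.
move=> Up np; have [x lx] := ex_pt np; have [_ _ p0] := np.
have [_ _ /(_ x p Up _ p0) [|h1 h2]] := L; first by rewrite lx memv_line.
exact: nul_in h1 h2.
Qed.
End LocalLift.

(** The tangent vector sending u in x to the class of (e . u) w. When e . a = 1 it
sends a to the class of w. *)
Definition distr_vect x (a w : Oct R) (e : Oct R) : subvs_of (line x) -> set (Oct R) :=
  fun s => coset x (odot e (vsval s) *: w).
Arguments distr_vect x a w e : clear implicits.

Lemma distr_vectP x a w e : a \in line x -> a != 0 -> ImO w -> cross a w = 0 ->
  distr (distr_vect x a w e).
Proof.
move=> ax a0 hw aw; have na := nul_in ax a0; have [ha nna _] := na.
have [ow _] := Ann_perp ha hw a0 nna aw.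
have lx v : v \in line x -> exists k : R, v = k *: a.
  by rewrite (line_of ax a0) => /vlineP.
split; first split.
- move=> s; exists (odot e (vsval s) *: w) => //; split; first exact: ImOZ.
  by move=> _ /lx [k ->]; rewrite odotZZ ow mulr0.
- move=> k s t v v' h h'; rewrite /distr_vect /coset /=.
  rewrite odotDr odotZr scalerDl -scalerA.
  rewrite (_ : _ - _ = k *: (v - odot e (vsval s) *: w) + (v' - odot e (vsval t) *: w)).
    by rewrite memvD ?memvZ.
  by rewrite scalerBr opprD addrACA.
move=> s v; rewrite /distr_vect /coset /= -(Ann_rep ax a0) => /lx [k].
move=> /eqP; rewrite subr_eq => /eqP ->; split.
  by apply: ImOD; exact: ImOZ.
by rewrite /= crossDr !crossZr crossxx // aw !scaler0 addr0.
Qed.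

Section Distr.
Variables (phi : Ein R -> Ein R).
Hypothesis P : preserves_distr phi.
Variables (U : set (Oct R)) (f : Oct R -> Oct R).
Hypothesis L : local_lift phi U f.

(** The differential of phi applied to the tangent vector that sends p to the class
of w sends f p to the class of D(w) f. *)
Lemma distr_Ann p w : U p -> nul p -> ImO w -> cross p w = 0 ->
  ImO ('D_w f p) /\ cross (f p) ('D_w f p) = 0.
Proof.
move=> Up np hw pw; have [hp _ p0] := np; have [x lx] := ex_pt np.
have px : p \in line x by rewrite lx memv_line.
have lf := lift_line L Up px p0.
have [|||e [_ _ ep]] := @dual_vector R 0%VS p; rewrite ?memv0 //.
  by move=> v; rewrite memv0 => /eqP ->; exact: ImO0.
have DX := @distr_vectP x p w e px p0 hw pw.
have [_ fx0] : f p \in line (phi x) /\ f p != 0 by have [_ _] := L; apply.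
have fx : f p \in line (phi x) by rewrite lf memv_line.
have : distr (dmap (distr_vect x p w e) : subvs_of (line (phi x)) -> _).
  by rewrite -P; exists (distr_vect x p w e).
move=> [_ /(_ (vsproj _ (f p)) ('D_w f p))]; rewrite -(Ann_rep fx fx0); apply.
exists U, f, (vsproj _ p), w, 1; rewrite !vsprojK //; split=> //.
- apply: contra_neq p0 => e0; by rewrite -(vsprojK px) e0 linear0.
- by rewrite /distr_vect /coset /= vsprojK // ep scale1r subrr mem0v.
- by rewrite !scale1r; split=> //; rewrite /coset /= subrr mem0v.
Qed.

(** Homogeneity: f(p + t p) stays in the line of f p. *)
Lemma D_self p : U p -> nul p -> exists m : R, 'D_p f p = m *: f p.
Proof.
move=> Up np; have C := lift_C2 L; have [x lx] := ex_pt np; have [_ _ p0] := np.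
have px : p \in line x by rewrite lx memv_line.
have lf := lift_line L Up px p0; have [hf _ f0] := lift_nul L Up np.
have d1 : der (fun t => f (p + t *: p)) ('D_p f p) by exact: (C2_d1 C Up).
have d2 : der (fun=> f p) (0 : Oct R) by exact: der_cst.
have [||m ->] := @parallel_curves _ _ _ _ 1 d1 d2 hf f0.
- by rewrite scale0r addr0 scale1r.
- near=> t; rewrite -lf; have [_ _ H] := L; apply: (H _ _ _ _ _).1.
  + have : U (p + t *: p + (t * t) *: 0) by near: t; exact: (near_quad C).
    by rewrite scaler0 addr0.
  + by rewrite memvD // memvZ.
  + by near: t; exact: nz_near.
- by exists m; rewrite scaler0 add0r.
Unshelve. all: by end_near. Qed.

(** Surjectivity of the differential on the distribution gives some lift f' at a
multiple of p whose derivative is V modulo the line; parallel_curves compares it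
with f. *)
Lemma distr_onto p V : U p -> nul p -> ImO V -> cross (f p) V = 0 ->
  exists w, exists m : R, [/\ ImO w, cross p w = 0 & V = 'D_w f p + m *: f p].
Proof.
move=> Up np hV fV; have C := lift_C2 L; have [x lx] := ex_pt np; have [hp _ p0] := np.
have px : p \in line x by rewrite lx memv_line.
have lf := lift_line L Up px p0; have [hf nnf f0] := lift_nul L Up np.
have fx : f p \in line (phi x) by rewrite lf memv_line.
have [|||e [_ _ ep]] := @dual_vector R 0%VS (f p); rewrite ?memv0 //.
  by move=> v; rewrite memv0 => /eqP ->; exact: ImO0.
have := @distr_vectP (phi x) (f p) V e fx f0 hV fV.
rewrite -P => -[X [_ XA] XE].
have : distr_vect (phi x) (f p) V e (vsproj _ (f p)) V.
  by rewrite /distr_vect /coset /= vsprojK // ep scale1r subrr mem0v.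
rewrite -XE => -[U' [f' [s [w [c [L' U's s0 Xw [fc]]]]]]].
rewrite /coset /= lf => /vlineP [m Ve]; rewrite vsprojK // in fc.
have c0 : c != 0 by apply: contraNneq f0 => c0; rewrite fc c0 scale0r.
have [k sk] : exists k : R, vsval s = k *: p.
  by apply/vlineP; move: (subvsP s); rewrite -lx; apply.
have k0 : k != 0.
  apply: contraNneq s0 => k0; apply/eqP/val_inj.
  by rewrite [LHS]sk k0 scale0r.
have [hw /= rw] := XA _ _ Xw.
have pw : cross p w = 0.
  have : Ann p w by rewrite (Ann_rep px p0).
  by case.
have C' := lift_C2 L'.
have d1 : der (fun t => f' (vsval s + t *: w)) ('D_w f' (vsval s)).
  exact: (C2_d1 C').
have d2 : der (fun t => f (p + t *: (k^-1 *: w))) ('D_(k^-1 *: w) f p).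
  exact: (C2_d1 C).
have [||||m' e'] := @parallel_curves _ _ _ _ c^-1 d1 d2.
- by rewrite scale0r addr0.
- by rewrite scale0r addr0.
- by rewrite !scale0r !addr0 fc scalerA mulVf ?scale1r.
- near=> t.
  have Ut : U (p + t *: (k^-1 *: w) + (t * t) *: 0) by near: t; exact: (near_quad C).
  have Ut' : U' (vsval s + t *: w + (t * t) *: 0) by near: t; exact: (near_quad C').
  move: Ut Ut'; rewrite !scaler0 !addr0 => Ut Ut'.
  have E : vsval s + t *: w = k *: (p + t *: (k^-1 *: w)).
    by rewrite scalerDr sk !scalerA mulrAC divff ?mul1r.
  (* If w is a multiple of p, the curve stays on the line of p and avoids 0 for small t. *)
  have nt : nul (p + t *: (k^-1 *: w)).
    have [wp|wp] := boolP (k^-1 *: w \in <[p]>%VS).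
      suff pt0 : p + t *: (k^-1 *: w) != 0.
        by apply: (@nul_in _ x) => //; rewrite lx; apply: memvD; [exact: memv_line|exact: memvZ].
      by near: t; exact: nz_near.
    by apply: nul_shift => //; [exact: ImOZ|rewrite crossZr pw scaler0].
  have [y ly] := ex_pt nt; have [_ _ q0] := nt.
  have qy : p + t *: (k^-1 *: w) \in line y by rewrite ly memv_line.
  rewrite -(lift_line L Ut qy q0); have [_ _ H] := L'; apply: (H _ _ Ut' _ _).1.
    by rewrite E memvZ.
  by rewrite E scaler_eq0 negb_or k0.
- rewrite scale0r addr0 in e'.
  exists (k^-1 *: w), (m + c * m'); split; first exact: ImOZ.
    by rewrite crossZr pw scaler0.
  have := Ve => /eqP; rewrite subr_eq => /eqP ->; rewrite e' scalerDr !scalerA divff // scale1r.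
  by rewrite addrCA -scalerDl.
Unshelve. all: by end_near. Qed.

(** Independence follows from surjectivity: derivatives in the directions w and n
span the annihilator of f p together with f p, and this space has nonzero area. *)
Lemma distr_tangential : tangential U f.
Proof.
have C := lift_C2 L; split; first exact: C.
- by move=> p; exact: (lift_nul L).
- by move=> p w; exact: distr_Ann.
move=> p w n Up np hw hn pw pn wn.
have nf := lift_nul L Up np; have [hf _ _] := nf.
have [hW fW] := distr_Ann Up np hw pw; have [hN fN] := distr_Ann Up np hn pn.
have [m em] := Ann_cross np hw hn pw pn.
have m0 : m != 0 by apply: contraNneq wn => m0; rewrite em m0 scale0r.
have [k ek] := D_self Up np.
have gen V : ImO V -> cross (f p) V = 0 ->
    exists a b c : R, V = a *: f p + b *: 'D_w f p + c *: 'D_n f p.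
  move=> hV fV; have [w' [l [hw' pw' ->]]] := distr_onto Up np hV fV.
  have [a [b [c ->]]] := Ann_span np hw hn hw' pw pn pw' em m0.
  exists (a * k + l), b, c; rewrite !(D_add C) // !(D_scale C) // ek.
  move: ('D_w f p) ('D_n f p) (f p) => W N g.
  by apply: linear_ext => A AD AZ AN A0; rewrite !(AD, AZ, AN, A0); ring.
have [psi [psi1 _]] := Ann_frame nf; have [t1 t2 t3] := g2_table psi.
have h2 : ImO (psi (f2 R)) by apply: g2_ImO; exact: ImO_zorn.
have h3 : ImO (psi (f3 R)) by apply: g2_ImO; exact: ImO_zorn.
rewrite psi1 in t1 t2 t3.
have [a [b [c e2]]] := gen _ h2 t1; have [a' [b' [c' e3]]] := gen _ h3 t2.
apply/eqP => WN0; have f0 : f p = 0.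
  by rewrite -t3 e2 e3; exact: cross_span0.
by have [_ _ /eqP] := nf.
Qed.

End Distr.
End DistributionLifts.

(** * Automorphisms preserve the distribution *)

Section AutomorphismLifts.
Variable R : realType.
Implicit Types u v w p : Oct R.
Implicit Types x y z : Ein R.
Implicit Type psi : G2' R.

Lemma g2_line psi x : line (g2_act psi x) = (psi @: line x)%VS.
Proof. by []. Qed.

Lemma g2_local_lift psi : local_lift (g2_act psi) setT psi.
Proof.
split; [exact: openT|exact: lfun_Cinf|].
move=> y w _ wy w0; split; first exact: memv_img.
exact: g2_neq0.
Qed.

Lemma g2_derive psi u w : 'D_w psi u = psi w.
Proof.
apply: (der_unique (C2_d1 (lift_C2 (g2_local_lift psi)) (v := w) (x := u) I)).
have : der (fun s => psi u + s *: psi w) (0 + psi w).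
  apply: derD; first exact: der_cst.
  by apply: der_idZ; exact: cvg_cst.
by rewrite add0r; congr der; apply/funext => s; rewrite linearD linearZ.
Qed.

(** A direction w of Ann(u) is tangent to the null cone along a straight line, where
f and psi are proportional. *)
Lemma g2_lift_derive psi U f x u w : local_lift (g2_act psi) U f -> U u ->
  u \in line x -> u != 0 -> ImO w -> cross u w = 0 ->
  exists k m : R, f u = k *: psi u /\ 'D_w f u = k *: psi w + m *: psi u.
Proof.
move=> L Uu ux u0 hw uw; have nu := nul_in ux u0.
have C := lift_C2 L; have lf := lift_line L Uu ux u0.
have pu : psi u \in line (g2_act psi x) by exact: memv_img.
have pu0 := g2_neq0 psi u0.
have : f u \in line (g2_act psi x) by rewrite lf memv_line.
rewrite (line_of pu pu0) => /vlineP [k ek].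
have d1 : der (fun t => f (u + t *: w)) ('D_w f u) by exact: (C2_d1 C).
have d2 : der (fun t => psi (u + t *: w)) (psi w).
  by rewrite -(g2_derive psi u); exact: (C2_d1 (lift_C2 (g2_local_lift psi))).
have [||||m] := @parallel_curves R _ _ _ _ k d1 d2; rewrite ?scale0r ?addr0 //.
- by apply: g2_ImO; have [] := nu.
- near=> t.
  have Ut : U (u + t *: w + (t * t) *: 0) by near: t; exact: (near_quad C).
  rewrite scaler0 addr0 in Ut.
  have t0 : u + t *: w != 0 by near: t; exact: nz_near.
  have nt : nul (u + t *: w).
    have [wp|wp] := boolP (w \in <[u]>%VS).
      apply: (@nul_in _ x) => //; rewrite (line_of ux u0).
      by apply: memvD; [exact: memv_line|exact: memvZ].
    exact: nul_shift.
  have [y ly] := ex_pt nt.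
  have ty : u + t *: w \in line y by rewrite ly memv_line.
  have pty : psi (u + t *: w) \in line (g2_act psi y) by exact: memv_img.
  rewrite -(line_of pty (g2_neq0 psi t0)).
  by have [_ _ /(_ y _ Ut ty t0) []] := L.
- by exists k, m.
Unshelve. all: by end_near. Qed.

(** This is the differential of the map induced by psi, by g2_dmap; x and y are kept
independent so that psi and its inverse can be treated alike. *)
Definition push psi x y (X : subvs_of (line x) -> set (Oct R)) :
    subvs_of (line y) -> set (Oct R) :=
  fun t => psi @` X (vsproj (line x) (g2_inv psi (vsval t))).

Lemma push_distr psi x y X : line y = (psi @: line x)%VS -> distr X ->
  distr (@push psi x y X).
Proof.
move=> ly [[X1 X2] X3].
have inv_in (t : subvs_of (line y)) : g2_inv psi (vsval t) \in line x.
  have := subvsP t; rewrite {2}ly => /memv_imgP [u ux ->]; by rewrite g2_Kinv.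
have in_y u : (psi u \in line y) = (u \in line x).
  rewrite ly; apply/idP/idP => [/memv_imgP [v vx /g2_inj ->] //|]; exact: memv_img.
have [lx x0] := rep_line x.
have rx : rep x \in line x by exact: memv_pick.
have rn : psi (rep x) \in line y by rewrite in_y.
have AE := Ann_rep rn (g2_neq0 psi x0).
have [hx _ _] := nul_rep x.
split; first split.
- move=> t; have [w [hw wx] e] := X1 (vsproj (line x) (g2_inv psi (vsval t))).
  exists (psi w).
    split; first exact: g2_ImO.
    rewrite ly => _ /memv_imgP [u ux ->]; rewrite g2_odot ?wx //.
    by move: ux; rewrite lx => /vlineP [k ->]; exact: ImOZ.
  rewrite /push e; apply/seteqP; split=> [_ [v /= vw <-]|v vw].
    by rewrite /coset /= -linearB in_y.
  exists (g2_inv psi v); last exact: g2_invK.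
  rewrite /coset /=; move: vw; rewrite -in_y -{1}(g2_invK psi v).
  by rewrite /coset /= linearB.
- move=> a s t w w' [u us <-] [u' us' <-]; exists (a *: u + u').
    by rewrite !linearP /=; exact: X2.
  by rewrite linearP.
move=> t _ [u /X3 [hu cu] <-]; rewrite -AE; split; first exact: g2_ImO.
by rewrite /= -g2_cross // cu linear0.
Qed.

(** At t = 0 the differential is read off at any nonzero vector of the line with the
factor c = 0, and is the line of psi x. Elsewhere g2_lift_derive computes it. *)
Lemma g2_dmap psi x X : distr X -> @dmap R (g2_act psi) x X = push psi X.
Proof.
move=> [[X1 X2] X3]; apply/funext => t.
(* The value at 0 is the zero coset, by linearity for the quotient operations. *)
have X0 : X 0 = [set w | w \in line x].
  have [w _ e] := X1 0.
  have Xw : X 0 w by rewrite e /coset /= subrr mem0v.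
  have := X2 (-1) _ _ _ _ Xw Xw; rewrite scaleN1r oppr0 addr0 scaleN1r addNr e.
  rewrite /coset /= sub0r memvN => wx.
  apply/seteqP; split=> v /= h; last by rewrite memvB.
  by rewrite -(subrK w v) memvD.
have inv_in : g2_inv psi (vsval t) \in line x.
  by have := subvsP t; rewrite {2}g2_line => /memv_imgP [u ux ->]; rewrite g2_Kinv.
have [lx x0] := rep_line x.
have rx : rep x \in line x by exact: memv_pick.
apply/seteqP; split=> z.
  move=> [U [f [s [w [c [L Us s0 Xw [tc zc]]]]]]].
  have sx := subvsP s.
  have s0' : vsval s != 0 by apply: contraNneq s0 => e; apply/eqP/val_inj.
  have [hw sw] : Ann (vsval s) w by rewrite (Ann_rep sx s0'); exact: X3 Xw.
  have [k [m [fs Ds]]] := g2_lift_derive L Us sx s0' hw sw.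
  move: zc; rewrite /coset /= g2_line => /memv_imgP [l lx' zE].
  exists ((c * k) *: w + ((c * m) *: vsval s + l)).
    have -> : vsproj (line x) (g2_inv psi (vsval t)) = (c * k) *: s + 0.
      by rewrite tc fs !linearZ /= g2_Kinv vsvalK scalerA addr0.
    by apply: X2 => //; rewrite X0 /=; apply: memvD => //; exact: memvZ.
  move/eqP: zE; rewrite subr_eq => /eqP ->; rewrite Ds !linearD !linearZ /=.
  move: (psi w) (psi (vsval s)) (psi l) => a b d.
  by apply: linear_ext => A AD AZ AN A0; rewrite !(AD, AZ, AN, A0); ring.
move=> [w Xw <-]; have [s0|s0] := eqVneq (vsproj (line x) (g2_inv psi (vsval t))) 0.
  have t0 : vsval t = 0.
    rewrite -(g2_invK psi (vsval t)) -(vsprojK inv_in) s0.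
    by rewrite (_ : vsval 0 = 0) ?linear0.
  have [w' _ e] := X1 (vsproj _ (rep x)).
  exists setT, psi, (vsproj _ (rep x)), w', 0; split => //.
  - exact: g2_local_lift.
  - by apply: contra_neq x0 => e0; rewrite -(vsprojK rx) e0.
  - by rewrite e /coset /= subrr mem0v.
  - rewrite !scale0r t0; split=> //; rewrite /coset /= subr0; apply: memv_img.
    by move: Xw; rewrite s0 X0.
exists setT, psi, (vsproj (line x) (g2_inv psi (vsval t))), w, 1; split => //.
- exact: g2_local_lift.
- rewrite !scale1r vsprojK // g2_invK; split=> //.
  by rewrite /coset /= g2_derive subrr mem0v.
Qed.

Lemma g2_preserves_distr psi : preserves_distr (g2_act psi).
Proof.
move=> x; apply/seteqP; split=> [_ [X dX <-]|Y dY].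
  by rewrite g2_dmap //; apply: push_distr.
have lx : line x = (g2_inv psi @: line (g2_act psi x))%VS.
  by rewrite g2_line -limg_comp lker0_compVf ?g2_ker // lim1g.
have dX : distr (@push (g2_inv psi) _ x Y) by exact: push_distr lx dY.
exists (push (g2_inv psi) Y) => //; rewrite g2_dmap //.
apply/funext => t; rewrite /push.
have inv_in : g2_inv psi (vsval t) \in line x.
  by have := subvsP t; rewrite {2}g2_line => /memv_imgP [u ux ->]; rewrite g2_Kinv.
have E : vsproj (line (g2_act psi x)) (g2_inv (g2_inv psi) (vsval
    (vsproj (line x) (g2_inv psi (vsval t))))) = t.
  by rewrite vsprojK // g2_Kinv vsvalK.
rewrite E; apply/seteqP; split=> [_ [_ [u Yu <-] <-]|u Yu].
  by rewrite g2_invK.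
exists (g2_inv psi u); last exact: g2_invK.
by exists u.
Qed.

End AutomorphismLifts.

Theorem theoremC (R : realType) :
  injective (@F R) /\
  forall phi : Diff R,
    [/\ range (@F R) phi <-> preserves_distr phi,
        range (@F R) phi <-> preserves_PAnn phi,
        range (@F R) phi <-> d3_isometry phi &
        range (@F R) phi <-> preserves_ann_lines phi].
Proof.
split=> [|phi]; first exact: F_inj.
have [sm [ipsi [phiK ipsiK _]]] := diff_funP phi.
have inj : injective phi := can_inj phiK.
have surj y : exists x, phi x = y by exists (ipsi y).
have iso_range : d3_isometry phi -> range (@F R) phi.
  move=> /iso_g2 [psi e]; exists psi => //.
  case: phi e {sm phiK ipsiK inj surj} => f df /= e; subst f.
  by rewrite /F; congr MkDiff; exact: Prop_irrelevance.
have range_iso : range (@F R) phi -> d3_isometry phi.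
  by move=> [psi _ <-]; exact: g2_act_d3.
split; split.
- by move=> [psi _ <-]; exact: g2_preserves_distr.
- move=> P; apply: iso_range.
  have lift p : exists Uf : set (Oct R) * (Oct R -> Oct R), nul p ->
      Uf.1 p /\ local_lift phi Uf.1 Uf.2.
    have [np|np] := pselect (nul p); last by exists (setT, id).
    have [x lx] := ex_pt np; have [_ _ p0] := np.
    have [|U [f [Up L]]] := sm x p _ p0; first by rewrite lx memv_line.
    by exists (U, f).
  have [Uf H] := choice lift.
  apply: (tangential_iso inj (dom := fun p => (Uf p).1) (lft := fun p => (Uf p).2)).
  + by move=> p /H [].
  + by move=> p /H [].
  + by move=> p /H [_ L]; exact: (distr_tangential P L).
- by move=> /range_iso; exact: (iso_PAnn surj).
- by move=> /(PAnn_iso inj surj) /iso_range.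
- exact: range_iso.
- exact: iso_range.
- by move=> /range_iso; exact: (iso_lines surj).
- by move=> /(lines_iso inj) /iso_range.
Qed.
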